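(* Let $n,N\in\mathbb{N}$, $\Omega=\prod_{i=1}^N[a_i,b_i]$, $\delta\in\mathbb{N}_0^N$, let $\mathcal{D}_i\subseteq S_2^{\delta_i\mathrm{e}_i,n}[\Omega]$ ($i=1,\dots,N$) be admissible and consistent lifted univariate domains, let $\mathcal{D}:=\bigcap_{i=1}^N\mathcal{D}_i$, and let $A_\alpha\in\mathbb{R}^{n\times n}[s]$ for $\vec 0\le\alpha\le\delta$. Consider the PDE $$\partial_t\mathbf{u}(t,s)=\sum_{\vec 0\le\alpha\le\delta}A_\alpha(s)D^\alpha\mathbf{u}(t,s),\qquad \mathbf{u}(t)\in\mathcal{D},$$ and suppose that it admits, for every initial state $\mathbf{u}_0\in\mathcal{D}$, a unique solution that depends continuously on the initial state. Let $\mathcal{T}:=\prod_{i=1}^N\mathcal{T}_i$ and $\mathcal{A}:=\sum_{\vec 0\le\alpha\le\delta}\mathrm{M}[A_\alpha]\prod_{i=1}^N\mathcal{A}_{i,\alpha_i}$ be the associated operators as in the context. Let $\mathcal{Z}_d$ be the vector of basis operators defined in the context, with $\mu(d):=d^2+4d+3$. Let $d,d'\in\mathbb{N}_0$, $\epsilon>0$ and $k\ge0$. If there exist a matrix $P\in\mathbb{R}^{n\times n\mu(d)^N}$ and positive semidefinite symmetric matrices $R,Q\succeq0$ of size $n\mu(d')^N\times n\mu(d')^N$ such that $\mathcal{P}=\mathrm{M}[P](I_n\otimes\mathcal{Z}_d)$ satisfies $$\mathcal{P}^*\mathcal{T}=\mathcal{T}^*\mathcal{P}=\epsilon^2\mathcal{T}^*\mathcal{T}+(I_n\otimes\mathcal{Z}_{d'})^*\mathrm{M}[R](I_n\otimes\mathcal{Z}_{d'}),$$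 $$\mathcal{P}^*\mathcal{A}+\mathcal{A}^*\mathcal{P}+2k\mathcal{P}^*\mathcal{T}=-(I_n\otimes\mathcal{Z}_{d'})^*\mathrm{M}[Q](I_n\otimes\mathcal{Z}_{d'}),$$ then the PDE is exponentially PIE to PDE stable with rate $k$ and gain $M:=\sqrt{\|\mathcal{P}^*\mathcal{T}\|_{\mathrm{op}}}/\epsilon$.
   Context: Notation: $\alpha\le\beta$ for multi-indices is componentwise; $D^\alpha=\partial_{s_1}^{\alpha_1}\cdots\partial_{s_N}^{\alpha_N}$; $L_2^n[\Omega]$ is the space of square-integrable $\mathbb{R}^n$-valued functions; $\mathbb{R}^{n\times n}[s]$ is the set of $n\times n$ matrix polynomials in $s=(s_1,\dots,s_N)$; $(\mathrm{M}[A]\mathbf{u})(s)=A(s)\mathbf{u}(s)$ (also for constant matrices); $\mathrm{e}_i$ is the $i$th standard basis vector of $\mathbb{R}^N$; $S_2^{\delta,n}[\Omega]:=\{\mathbf{u}\in L_2^n[\Omega]: D^\alpha\mathbf{u}\in L_2^n[\Omega]\ \forall\,\vec 0\le\alpha\le\delta\}$ (with its natural Hilbert norm). $*$ is the $L_2$-adjoint and $\|\cdot\|_{\mathrm{op}}$ the operator norm on $L_2^n[\Omega]$. Univariate domains: for $d\in\mathbb{N}_0$, $[a,b]\subset\mathbb{R}$ and $B_{j,k},C_{j,k}\in\mathbb{R}^{n\times n}$ ($0\le j,k\le d-1$), consider $\{\mathbf{u}\in S_2^{d,n}[a,b]:\ \sum_{k=0}^{d-1}[B_{j,k}(\partial_s^k\mathbf{u})(a)+C_{j,k}(\partial_s^k\mathbf{u})(b)]=0\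 \ \forall j\in\{0,\dots,d-1\}\}$. Let $H_a,H_b\in\mathbb{R}^{nd\times nd}$ be the block matrices with blocks $B_{j,k}$, $C_{j,k}$, and let $Q(z)\in\mathbb{R}^{nd\times nd}$ be block upper triangular with $(k,l)$ block $\frac{z^{l-k}}{(l-k)!}I_n$ for $l\ge k$ and $0$ otherwise. The domain is admissible if $H_a+H_bQ(b-a)$ is invertible (no condition if $d=0$, where the domain is $L_2^n[a,b]$); then set $K:=(H_a+H_bQ(b-a))^{-1}H_b$. Lifted domains: given for each $i$ a univariate domain $\{\mathbf{w}\in S_2^{\delta_i,n}[a_i,b_i]:\ \sum_{k=0}^{\delta_i-1}[B^i_{j,k}(\partial_s^k\mathbf{w})(a_i)+C^i_{j,k}(\partial_s^k\mathbf{w})(b_i)]=0\ \ \forall j\in\{0,\dots,\delta_i-1\}\}$ (i.e. $d=\delta_i$, $[a,b]=[a_i,b_i]$) with parameters $B^i_{j,k},C^i_{j,k}\in\mathbb{R}^{n\times n}$, $\mathcal{D}_i$ is the set of $\mathbf{u}\in S_2^{\delta_i\mathrm{e}_i,n}[\Omega]$ such that for almost every value of the variables $s_j$, $j\ne i$, the function $s_i\mapsto\mathbf{u}(s)$ lies in that univariate domain. $\mathcal{D}_i$ is admissible if the univariate domain is; its matrix $K$ is denoted $K^i$, with $n\times n$ blocks $K^i_{k,l}$, $1\le k,l\le\delta_i$. The intersection $\bigcap_{i=1}^N\mathcal{D}_i$ is taken within $S_2^{\delta,n}[\Omega]$. The (admissible) domains are consistent if $K^i_{k,p}K^j_{\ell,q}=K^j_{\ell,q}K^i_{k,p}$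 for all $i\ne j$ and all $k,p\in\{1,\dots,\delta_i\}$, $\ell,q\in\{1,\dots,\delta_j\}$. Operators: with $d=\delta_i$, let $E_1(z):=[I_n,\,zI_n,\dots,\frac{z^{d-1}}{(d-1)!}I_n]^T$ and $E_d(z):=[\frac{z^{d-1}}{(d-1)!}I_n,\dots,zI_n,I_n]^T$, both in $\mathbb{R}^{nd\times n}$. For $0\le j<\delta_i$ define on $L_2^n[\Omega]$ $$(\mathcal{A}_{i,j}\mathbf{v})(s):=\int_{a_i}^{s_i}\tfrac{(s_i-\theta)^{\delta_i-1-j}}{(\delta_i-1-j)!}\mathbf{v}(s)|_{s_i=\theta}\,d\theta-\int_{a_i}^{b_i}\bigl(\tfrac{d^j}{dz^j}E_1\bigr)(s_i-a_i)^TK^iE_{\delta_i}(b_i-\theta)\,\mathbf{v}(s)|_{s_i=\theta}\,d\theta,$$ $\mathcal{A}_{i,\delta_i}:=I$, and $\mathcal{T}_i:=\mathcal{A}_{i,0}$ (so $\mathcal{T}_i=I$ if $\delta_i=0$). Products $\prod_{i=1}^N$ denote composition. Basis operators: let $\mathbf{z}_d(s)$ be the vector of the $d+1$ monomials in $s$ of degree at most $d$, and $\mathbf{z}_d(s,\theta)$ the vector of the $(d+1)(d+2)/2$ monomials in $(s,\theta)$ of total degree at most $d$. For each $i$, $\mathcal{Z}_{d,i}:L_2[\Omega]\to L_2^{\mu(d)}[\Omega]$ is the stacked operator, acting on variable $s_i$ only, $$(\mathcal{Z}_{d,i}\mathbf{v})(s)=\begin{bmatrix}\mathbf{z}_d(s_i)\mathbf{v}(s)\\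 \int_{a_i}^{s_i}\mathbf{z}_d(s_i,\theta)\mathbf{v}(s)|_{s_i=\theta}d\theta\\ \int_{s_i}^{b_i}\mathbf{z}_d(s_i,\theta)\mathbf{v}(s)|_{s_i=\theta}d\theta\end{bmatrix},$$ and $\mathcal{Z}_d:=\mathcal{Z}_{d,1}\otimes\cdots\otimes\mathcal{Z}_{d,N}:L_2[\Omega]\to L_2^{\mu(d)^N}[\Omega]$ is the Kronecker product, whose entries are the compositions of one entry from each $\mathcal{Z}_{d,i}$. $I_n\otimes\mathcal{Z}_d$ applies $\mathcal{Z}_d$ to each component of a function in $L_2^n[\Omega]$. Solutions and stability: $\mathbf{u}:[0,\infty)\to S_2^{\delta,n}[\Omega]$ solves the PDE with initial state $\mathbf{u}_0\in\mathcal{D}$ if it is Fréchet differentiable, $\mathbf{u}(0)=\mathbf{u}_0$, and $\mathbf{u}(t)\in\mathcal{D}$ and the PDE hold for all $t\ge0$. A PDE admitting unique solutions depending continuously on the initial state is exponentially PIE to PDE stable with rate $k\ge0$ and gain $M>0$ if for every $\mathbf{u}_0\in\mathcal{D}$ and all $t\ge0$ the associated solution satisfies $\|\mathbf{u}(t)\|_{L_2}\le Me^{-kt}\|D^\delta\mathbf{u}_0\|_{L_2}$. *)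

(* Defs.v *)
From HB Require Import structures.
From mathcomp Require Import all_boot all_order all_algebra.
From mathcomp Require Import all_classical all_reals all_analysis.
From mathcomp Require mpoly.
From mathcomp Require Import zify.

Set Implicit Arguments.
Unset Strict Implicit.
Unset Printing Implicit Defensive.

Import Order.TTheory GRing.Theory Num.Theory.
Import numFieldNormedType.Exports.
Local Open Scope classical_set_scope.
Local Open Scope ring_scope.

Definition tcons (T : Type) (N : nat) (p : T * N.-tuple T) : N.+1.-tuple T :=
  [tuple of p.1 :: p.2].

Section lebesgue_tuple_step.
Context (R : realType) (N : nat).
Variable m : {sigma_finite_measure set (N.-tuple R) -> \bar R}.

Lemma measurable_tcons : measurable_fun [set: R * N.-tuple R] (@tcons R N).
Proof. exact: measurable_cons. Qed.

Definition lebesgue_step : set (N.+1.-tuple R) -> \bar R :=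
  pushforward (@lebesgue_measure R \x m)%E (@tcons R N).

Let step0 : lebesgue_step set0 = 0%E.
Proof. by rewrite /lebesgue_step /pushforward preimage_set0 measure0. Qed.
Let step_ge0 A : (0 <= lebesgue_step A)%E.
Proof. by rewrite /lebesgue_step /pushforward. Qed.
Let step_sigma_additive : semi_sigma_additive lebesgue_step.
Proof.
move=> F mF tF mUF; rewrite /lebesgue_step /pushforward preimage_bigcup.
apply: measure_semi_sigma_additive.
- by move=> k; rewrite -[X in measurable X]setTI; exact: measurable_tcons.
- apply/trivIsetP => /= i j _ _ ij; rewrite -preimage_setI.
  by move/trivIsetP : tF => /(_ _ _ _ _ ij) ->//; rewrite preimage_set0.
- by rewrite -preimage_bigcup -[X in measurable X]setTI; exact: measurable_tcons.
Qed.
HB.instance Definition _ := isMeasure.Build _ _ _ lebesgue_step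
  step0 step_ge0 step_sigma_additive.

Let step_sigma_finite : sigma_finite [set: N.+1.-tuple R] lebesgue_step.
Proof.
have /sigma_finiteP[F [TF ndF Foo]] := sigma_finiteT (@lebesgue_measure R).
have /sigma_finiteP[G [TG ndG Goo]] := sigma_finiteT m.
pose un (t : N.+1.-tuple R) := (thead t, [tuple of behead t]).
have unK (p : R * N.-tuple R) : un (tcons p) = p.
  by case: p => x t; congr pair; exact/val_inj.
have mun : measurable_fun [set: N.+1.-tuple R] un.
  by apply: measurable_fun_pair; [exact: measurable_tnth|exact: measurable_behead].
exists (fun k => un @^-1` (F k `*` G k)).
  apply/seteqP; split => // t _.
  have [k _ Fk] : (\bigcup_i F i) (thead t) by rewrite -TF.
  have [l _ Gl] : (\bigcup_i G i) [tuple of behead t] by rewrite -TG.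
  exists (maxn k l) => //; split.
  - by have /subsetPset := ndF _ _ (leq_maxl k l); apply.
  - by have /subsetPset := ndG _ _ (leq_maxr k l); apply.
move=> k; have [mF Fk] := Foo k; have [mG Gk] := Goo k; split.
  by rewrite -[X in measurable X]setTI; apply: mun => //; exact: measurableX.
rewrite /lebesgue_step /pushforward (_ : _ @^-1` _ = F k `*` G k).
  by rewrite product_measure1E// lte_mul_pinfty// ge0_fin_numE.
by apply/funext => p; rewrite /preimage/= -[in RHS](unK p).
Qed.
HB.instance Definition _ :=
  Measure_isSigmaFinite.Build _ _ _ lebesgue_step step_sigma_finite.
End lebesgue_tuple_step.

(* Lebesgue measure on R^N, a point of R^N being an N.-tuple. *)
Fixpoint lebesgueN (R : realType) (N : nat) :
    {sigma_finite_measure set (N.-tuple R) -> \bar R} :=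
  match N with
  | 0 => \d_[tuple]
  | N'.+1 => lebesgue_step (lebesgueN R N')
  end.

Section coordinates.
Context (R : realType) (N : nat).

(* s with its i-th coordinate replaced by x *)
Definition upd (s : N.-tuple R) (i : 'I_N) (x : R) : N.-tuple R :=
  [tuple if j == i then x else tnth s j | j < N].

(* the point with i-th coordinate x and the other coordinates listed by t *)
Definition ins (i : 'I_N) (x : R) (t : N.-1.-tuple R) : N.-tuple R :=
  [tuple oapp (tnth t) x (unlift i j) | j < N].

Definition box (a b : 'I_N -> R) : set (N.-tuple R) :=
  [set s | forall i, a i <= tnth s i <= b i].

Definition comp_all (T : Type) (F : 'I_N -> T -> T) : T -> T :=
  \big[(fun f g : T -> T => f \o g)/id]_(i < N) F i.

(* multi-indices alpha with 0 <= alpha <= delta *)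
Definition midx (delta : 'I_N -> nat) :=
  {dffun forall i : 'I_N, 'I_(delta i).+1}.

Definition midx_nat (delta : 'I_N -> nat) (al : midx delta) : 'I_N -> nat :=
  fun i => al i.

Definition pderiv (i : 'I_N) (phi : N.-tuple R -> R) : N.-tuple R -> R :=
  fun s => derive1 (fun x : R => phi (upd s i x)) (tnth s i).

Definition mderiv (al : 'I_N -> nat) : (N.-tuple R -> R) -> N.-tuple R -> R :=
  comp_all (fun i => iter (al i) (pderiv i)).

(* All iterated partial derivatives exist and are continuous; tuples carry no
   topology in the library, so continuity is expressed on row vectors. *)
Definition smooth (phi : N.-tuple R -> R) : Prop :=
  forall l : seq 'I_N, let psi := foldr pderiv phi l in
    continuous (fun x : 'rV[R]_N => psi [tuple x ord0 i | i < N]) /\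
    forall i s, derivable (fun x : R => psi (upd s i x)) (tnth s i) 1.

(* smooth functions with compact support in the interior of the box *)
Definition test_fun (a b : 'I_N -> R) (phi : N.-tuple R -> R) : Prop :=
  smooth phi /\
  exists2 e : R, 0 < e &
    forall s, phi s != 0 -> forall i, a i + e <= tnth s i <= b i - e.

End coordinates.

(* Elements of L_2^n are represented by functions, equal in L_2^n when they
   agree almost everywhere on the box; their values outside it are irrelevant. *)
Section L2.
Context (R : realType) (N : nat) (a b : 'I_N -> R).
Local Notation Omega := (box a b).
Local Notation mu := (lebesgueN R N).

Definition eq_ae n (u v : N.-tuple R -> 'cV[R]_n) : Prop :=
  {ae mu, forall s, Omega s -> u s = v s}.

Definition L2 n (u : N.-tuple R -> 'cV[R]_n) : Prop :=
  forall k, measurable_fun Omega (fun s => u s k 0) /\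
    mu.-integrable Omega (fun s => (u s k 0 ^+ 2)%:E).

Definition dotL2 n (u v : N.-tuple R -> 'cV[R]_n) : R :=
  \int[mu]_(s in Omega) \sum_k u s k 0 * v s k 0.

Definition normL2 n (u : N.-tuple R -> 'cV[R]_n) : R := Num.sqrt (dotL2 u u).

Definition weak_deriv n (al : 'I_N -> nat) (u w : N.-tuple R -> 'cV[R]_n) :
    Prop :=
  forall phi, test_fun a b phi -> forall k,
    \int[mu]_(s in Omega) (u s k 0 * mderiv al phi s) =
    (-1) ^+ (\sum_i al i)%N * \int[mu]_(s in Omega) (w s k 0 * phi s).

Definition Deriv n (al : 'I_N -> nat) (u : N.-tuple R -> 'cV[R]_n) :
    N.-tuple R -> 'cV[R]_n :=
  xget (fun=> 0) [set w | L2 w /\ weak_deriv al u w].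

Definition S2 n (delta : 'I_N -> nat) (u : N.-tuple R -> 'cV[R]_n) : Prop :=
  L2 u /\ forall al : 'I_N -> nat, (forall i, (al i <= delta i)%N) ->
    exists2 w, L2 w & weak_deriv al u w.

Definition normS2 n (delta : 'I_N -> nat) (u : N.-tuple R -> 'cV[R]_n) : R :=
  Num.sqrt (\sum_(al : midx delta) normL2 (Deriv (midx_nat al) u) ^+ 2).

Definition eq_op_ae n m
    (F G : (N.-tuple R -> 'cV[R]_n) -> N.-tuple R -> 'cV[R]_m) : Prop :=
  forall v, L2 v -> eq_ae (F v) (G v).

Definition is_adjoint n m
    (F : (N.-tuple R -> 'cV[R]_n) -> N.-tuple R -> 'cV[R]_m)
    (G : (N.-tuple R -> 'cV[R]_m) -> N.-tuple R -> 'cV[R]_n) : Prop :=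
  (forall v, L2 v -> L2 (G v)) /\
  forall u v, L2 u -> L2 v -> dotL2 (F u) v = dotL2 u (G v).

Definition adjoint n m
    (F : (N.-tuple R -> 'cV[R]_n) -> N.-tuple R -> 'cV[R]_m) :
    (N.-tuple R -> 'cV[R]_m) -> N.-tuple R -> 'cV[R]_n :=
  xget (fun _ _ => 0) [set G | is_adjoint F G].

Definition opnorm n m
    (F : (N.-tuple R -> 'cV[R]_n) -> N.-tuple R -> 'cV[R]_m) : R :=
  sup [set normL2 (F v) | v in [set v | L2 v /\ normL2 v <= 1]].

End L2.

Section univariate.
Context (R : realType) (n : nat).

(* The endpoint values of the derivatives of w are those of their continuous
   representatives g_k, which exist for w in S_2^d[a, b]. *)
Definition univ_dom (a b : R) d (B C : 'I_d -> 'I_d -> 'M[R]_n)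
    (w : R -> 'cV[R]_n) : Prop :=
  let a1 := fun _ : 'I_1 => a in let b1 := fun _ : 'I_1 => b in
  let w1 := fun x : 1.-tuple R => w (thead x) in
  S2 a1 b1 (fun=> d) w1 /\
  exists2 g : 'I_d -> R -> 'cV[R]_n,
    forall k, {within `[a, b], continuous (g k)} /\
      eq_ae a1 b1 (fun x => g k (thead x)) (Deriv a1 b1 (fun=> val k) w1) &
    forall j, \sum_k (B j k *m g k a + C j k *m g k b) = 0.

Definition Hmx d (B : 'I_d -> 'I_d -> 'M[R]_n) := \mxblock_(j < d, k < d) B j k.

Definition Qmx d (z : R) := \mxblock_(k < d, l < d)
  (if (k <= l)%N then (z ^+ (l - k) / (l - k)`!%:R)%:M else 0 : 'M[R]_n).

(* for d = 0 these are empty matrices, and every domain is admissible *)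
Definition admissible (a b : R) d (B C : 'I_d -> 'I_d -> 'M[R]_n) : bool :=
  Hmx B + Hmx C *m Qmx d (b - a) \in unitmx.

Definition Kmx (a b : R) d (B C : 'I_d -> 'I_d -> 'M[R]_n) :=
  invmx (Hmx B + Hmx C *m Qmx d (b - a)) *m Hmx C.

(* j-th derivative of E_1 *)
Definition E1 d (j : nat) (z : R) := \mxcol_(k < d)
  ((derive1n j (fun y : R => y ^+ k / k`!%:R) z)%:M : 'M[R]_n).

Definition Ed d (z : R) := \mxcol_(k < d)
  ((z ^+ (d.-1 - k) / (d.-1 - k)`!%:R)%:M : 'M[R]_n).

Definition vintegral (D : set R) (f : R -> 'cV[R]_n) : 'cV[R]_n :=
  \col_k \int[@lebesgue_measure R]_(x in D) f x k 0.

End univariate.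

Section lifted.
Context (R : realType) (n N : nat) (a b : 'I_N -> R) (delta : 'I_N -> nat).
Context (B C : forall i, 'I_(delta i) -> 'I_(delta i) -> 'M[R]_n).

Definition lifted_dom (i : 'I_N) (u : N.-tuple R -> 'cV[R]_n) : Prop :=
  S2 a b (fun j => if j == i then delta i else 0%N) u /\
  {ae lebesgueN R N.-1, forall t, box (a \o lift i) (b \o lift i) t ->
    univ_dom (a i) (b i) (@B i) (@C i) (fun x => u (ins i x t))}.

Definition Dom (u : N.-tuple R -> 'cV[R]_n) : Prop :=
  S2 a b delta u /\ forall i, lifted_dom i u.

Definition Kmat i := Kmx (a i) (b i) (@B i) (@C i).

Definition consistent : Prop :=
  forall i j, i != j ->
  forall (k p : 'I_(delta i)) (l q : 'I_(delta j)),
    submxblock (Kmat i) k p *m submxblock (Kmat j) l q =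
    submxblock (Kmat j) l q *m submxblock (Kmat i) k p.

Definition opA_ (i : 'I_N) (j : nat) (v : N.-tuple R -> 'cV[R]_n) :
    N.-tuple R -> 'cV[R]_n :=
  if (j < delta i)%N then fun s =>
    vintegral `[a i, tnth s i] (fun th =>
      ((tnth s i - th) ^+ (delta i - 1 - j) / (delta i - 1 - j)`!%:R) *:
        v (upd s i th)) -
    vintegral `[a i, b i] (fun th =>
      (E1 n (delta i) j (tnth s i - a i))^T *m Kmat i *m Ed n (delta i) (b i - th)
        *m v (upd s i th))
  else v.

Definition opT : (N.-tuple R -> 'cV[R]_n) -> N.-tuple R -> 'cV[R]_n :=
  comp_all (fun i => opA_ i 0).

Definition mulM m p (P : 'M[R]_(m, p)) (v : N.-tuple R -> 'cV[R]_p) :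
  N.-tuple R -> 'cV[R]_m := fun s => P *m v s.

Definition mulMpoly (A : 'M[mpoly.mpoly N R]_n) (v : N.-tuple R -> 'cV[R]_n) :
  N.-tuple R -> 'cV[R]_n := fun s => map_mx (mpoly.meval (tnth s)) A *m v s.

Context (A : midx delta -> 'M[mpoly.mpoly N R]_n).

Definition opA (v : N.-tuple R -> 'cV[R]_n) : N.-tuple R -> 'cV[R]_n :=
  fun s => \sum_(al : midx delta)
    mulMpoly (A al) (comp_all (fun i => opA_ i (al i)) v) s.

Definition pde_rhs (u : N.-tuple R -> 'cV[R]_n) : N.-tuple R -> 'cV[R]_n :=
  fun s => \sum_(al : midx delta)
    mulMpoly (A al) (Deriv a b (midx_nat al) u) s.

(* Frechet differentiability is for the norm of S_2^delta; at t = 0 it is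
   one-sided. *)
Definition solution (u0 : N.-tuple R -> 'cV[R]_n)
    (u : R -> N.-tuple R -> 'cV[R]_n) : Prop :=
  [/\ forall t, 0 <= t -> Dom (u t),
      eq_ae a b (u 0) u0 &
      forall t, 0 <= t -> exists2 u' : N.-tuple R -> 'cV[R]_n,
        S2 a b delta u' /\
        (forall e, 0 < e -> exists2 h, 0 < h &
          forall r, 0 <= r -> `|r - t| < h ->
            normS2 a b delta (fun s => u r s - u t s - (r - t) *: u' s) <=
              e * `|r - t|) &
        eq_ae a b u' (pde_rhs (u t))].

Definition well_posed : Prop :=
  (forall u0, Dom u0 -> exists2 u, solution u0 u &
     forall w, solution u0 w -> forall t, 0 <= t -> eq_ae a b (w t) (u t)) /\
  (forall u0 u, Dom u0 -> solution u0 u ->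
   forall t, 0 <= t -> forall e, 0 < e -> exists2 h, 0 < h &
   forall w0 w, Dom w0 -> solution w0 w ->
     normS2 a b delta (fun s => w0 s - u0 s) < h ->
     normL2 a b (fun s => w t s - u t s) < e).

Definition exp_stable (k M : R) : Prop :=
  [/\ 0 <= k, 0 < M &
      forall u0 u, Dom u0 -> solution u0 u -> forall t, 0 <= t ->
        normL2 a b (u t) <=
          M * expR (- k * t) * normL2 a b (Deriv a b delta u0)].

End lifted.

Section basis.
Context (R : realType) (N : nat) (a b : 'I_N -> R).
Local Notation sfun := (N.-tuple R -> R).

Definition mudim (d : nat) : nat := (d ^ 2 + 4 * d + 3)%N.

(* exponents (p, q) of the monomials s^p theta^q with p + q <= d *)
Definition exps2 (d : nat) : seq (nat * nat) :=
  [seq (p, (m - p)%N) | m <- iota 0 d.+1, p <- iota 0 m.+1].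

Definition Zmul (i : 'I_N) (p : nat) (v : sfun) : sfun :=
  fun s => tnth s i ^+ p * v s.

Definition Zlower (i : 'I_N) (pq : nat * nat) (v : sfun) : sfun :=
  fun s => \int[@lebesgue_measure R]_(th in `[a i, tnth s i])
    (tnth s i ^+ pq.1 * th ^+ pq.2 * v (upd s i th)).

Definition Zupper (i : 'I_N) (pq : nat * nat) (v : sfun) : sfun :=
  fun s => \int[@lebesgue_measure R]_(th in `[tnth s i, b i])
    (tnth s i ^+ pq.1 * th ^+ pq.2 * v (upd s i th)).

Definition Z1 (d : nat) (i : 'I_N) : seq (sfun -> sfun) :=
  [seq Zmul i p | p <- iota 0 d.+1] ++
  [seq Zlower i pq | pq <- exps2 d] ++ [seq Zupper i pq | pq <- exps2 d].

(* Kronecker product of the lists Z1 d i, in row-major order *)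
Definition Zbasis (d : nat) : seq (sfun -> sfun) :=
  foldr (fun i Zs => [seq F \o G | F <- Z1 d i, G <- Zs]) [:: id] (enum 'I_N).

Lemma size_Z1 d i : size (Z1 d i) = mudim d.
Proof.
have E e : (size (exps2 e)).*2 = (e.+1 * e.+2)%N.
  elim: e => [//|e IHe]; rewrite /exps2 -(addn1 e.+1) iotaD map_cat flatten_cat.
  rewrite size_cat -/(exps2 e) doubleD IHe /= cats0 size_map size_iota.
  by lia.
by rewrite /Z1 !size_cat !size_map size_iota addnn E /mudim; nia.
Qed.

Lemma size_Zbasis d : size (Zbasis d) = (mudim d ^ N)%N.
Proof.
rewrite /Zbasis -[in RHS](size_enum_ord N); elim: (enum 'I_N) => [//|i l IHl].
by rewrite [LHS](size_allpairs (fun F G => F \o G)) IHl size_Z1 expnS.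
Qed.

(* Block c of the result is Z_d applied to the component c of v; mxvec lists
   the entries of a matrix row by row. *)
Definition IZ n (d : nat) (v : N.-tuple R -> 'cV[R]_n) :
    N.-tuple R -> 'cV[R]_(n * mudim d ^ N) :=
  fun s => (mxvec (\matrix_(c < n, q < mudim d ^ N)
    nth id (Zbasis d) q (fun r => v r c 0) s))^T.

End basis.

Definition psd (R : realType) m (P : 'M[R]_m) : Prop :=
  P^T = P /\ forall x : 'cV[R]_m, 0 <= (x^T *m P *m x) 0 0.

(* Main.v *)
(* The function v = D^delta u of a state u in the domain determines it: u = T v.
   On almost every line parallel to the axis s_i, Taylor's formula with integral
   remainder expresses D_i^j u by the endpoint values of its derivatives at a_i and by
   D_i^{delta_i} u; the boundary conditions, which are solvable by admissibility,
   eliminate the endpoint values and leave D_i^j u = A_{i,j} D_i^{delta_i} u.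
   Testing against tensor products of bump functions extends this to mixed
   derivatives, and composing over i gives D^alpha u = (prod_i A_{i,alpha_i}) v,
   hence u = T v and A v is the right-hand side of the PDE.
   Since u is differentiable for the norm of S_2^delta, v is differentiable in L_2 and
   T v' = A v. So V = <T v, P v> is differentiable, V' = 2 <A v, P v> <= - 2 k V by the
   second operator identity, and eps^2 |u|^2 <= V <= |P^* T| |v|^2 by the first one.
   The gain is positive because T maps the delta-th derivative of a compactly
   supported tensor product to the tensor product itself. *)

From HB Require Import structures.
Require Import Defs.
From mathcomp Require Import all_boot all_order all_algebra.
From mathcomp Require Import all_classical all_reals all_analysis.
From mathcomp Require Import measurable_realfun.
From mathcomp Require mpoly.
From mathcomp Require Import zify ring lra.
Import Order.TTheory GRing.Theory Num.Theory.
Import numFieldNormedType.Exports.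
Local Open Scope classical_set_scope.
Local Open Scope ring_scope.

Set Implicit Arguments.
Unset Strict Implicit.
Unset Printing Implicit Defensive.

(** Functions are raw representatives, [adjoint] and [Deriv] are picked by [xget], and [opnorm] is a
    [sup]: they carry information only once an adjoint, a weak derivative or a bound has been
    produced. Hence every operator of the statement is shown to preserve L_2, to be bounded and to
    have an adjoint, by reduction to multiplications and to integral operators along one coordinate
    with bounded kernels. A second obstacle is that the null set of a weak identity depends on the
    test function. Along a line, tests are therefore restricted to a countable family of bumps, and
    an identity on the box becomes one on almost every line. The boundary conditions live on such
    lines and concern continuous representatives, which the du Bois-Reymond lemma links to weak
    derivatives. A last obstacle is the time derivative: a solution has u' in S_2^delta, but nothing
    places u' in the domain, so the representation formula does not apply to it directly. It applies
    to the states at two times, hence to difference quotients, and passes to the limit because T is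
    bounded. *)

Section insertion.
Context (R : realType).

Definition insp N (i : 'I_N.+1) (p : R * N.-tuple R) : N.+1.-tuple R :=
  @ins R N.+1 i p.1 p.2.

Lemma tnth_ins N (i : 'I_N.+1) x (t : N.-tuple R) : tnth (@ins R N.+1 i x t) i = x.
Proof. by rewrite tnth_mktuple unlift_none. Qed.

Lemma tnth_ins_lift N (i : 'I_N.+1) x (t : N.-tuple R) j :
  tnth (@ins R N.+1 i x t) (lift i j) = tnth t j.
Proof. by rewrite tnth_mktuple liftK. Qed.

Lemma upd_ins N (i : 'I_N.+1) x y (t : N.-tuple R) :
  upd (@ins R N.+1 i x t) i y = @ins R N.+1 i y t.
Proof.
apply: eq_from_tnth => j; rewrite tnth_mktuple.
have [->|] := eqVneq j i; first by rewrite tnth_ins.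
by rewrite eq_sym => /unlift_some[k -> _]; rewrite !tnth_ins_lift.
Qed.

Lemma ins_split N (i : 'I_N.+1) (s : N.+1.-tuple R) :
  s = @ins R N.+1 i (tnth s i) [tuple tnth s (lift i j) | j < N].
Proof.
apply: eq_from_tnth => j.
have [->|] := eqVneq j i; first by rewrite tnth_ins.
by rewrite eq_sym => /unlift_some[k -> _]; rewrite tnth_ins_lift tnth_mktuple.
Qed.

Lemma insp_ord0 N : insp (ord0 : 'I_N.+1) = @tcons R N.
Proof.
apply/funext => -[x t]; apply: eq_from_tnth => j.
case: (unliftP ord0 j) => [k ->|->]; rewrite /insp /tcons.
  by rewrite tnth_ins_lift tnthS.
by rewrite tnth_ins tnth0.
Qed.

Lemma insp_lift0 N (i : 'I_N.+1) x y (t : N.-tuple R) :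
  insp (lift ord0 i) (x, tcons (y, t)) = tcons (y, insp i (x, t)).
Proof.
apply: eq_from_tnth => j; rewrite /insp /tcons /=.
case: (unliftP ord0 j) => [k ->|->]; last first.
  have -> : ord0 = lift (lift ord0 i) ord0 :> 'I_N.+2 by apply/val_inj.
  by rewrite tnth_ins_lift !tnth0.
rewrite tnthS; case: (unliftP i k) => [l ->|->]; last by rewrite !tnth_ins.
have -> : lift ord0 (lift i l) = lift (lift ord0 i) (lift ord0 l).
  by apply/val_inj => /=; rewrite /bump /=; lia.
by rewrite !tnth_ins_lift tnthS.
Qed.

Lemma measurable_insp N (i : 'I_N.+1) : measurable_fun setT (@insp N i).
Proof.
apply/measurable_fun_tnthP => j.
have [->|] := eqVneq j i.
  rewrite [X in measurable_fun _ X](_ : _ = fst); first exact: measurable_fst.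
  by apply/funext => -[x t] /=; rewrite tnth_ins.
rewrite eq_sym => /unlift_some[k -> _].
rewrite [X in measurable_fun _ X](_ : _ = (fun p => tnth p.2 k)); last first.
  by apply/funext => -[x t] /=; rewrite tnth_ins_lift.
apply: (@measurableT_comp _ _ _ _ _ _ (fun x => tnth x k)) => //.
exact: measurable_tnth.
Qed.

Lemma lebesgueN_ins N (i : 'I_N.+1) A : measurable A ->
  lebesgueN R N.+1 A = pushforward (@lebesgue_measure R \x lebesgueN R N)%E
    (insp i) A.
Proof.
elim: N i A => [|N IH] i A mA; first by rewrite ord1 insp_ord0.
case: (unliftP ord0 i) => [j ->|->]; last by rewrite insp_ord0.
have mA' : measurable (@tcons R N.+1 @^-1` A).
  by rewrite -[X in measurable X]setTI; exact: measurable_tcons.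
have mA'' : measurable (insp (lift ord0 j) @^-1` A).
  by rewrite -[X in measurable X]setTI; exact: measurable_insp.
pose Rm : measurableType _ := measurableTypeR R.
(* [A] in the coordinates (y, x, t): y is the head and x the entry inserted at place j of the
   tail. *)
pose E := [set q : (Rm * Rm) * N.-tuple R | A (tcons (q.1.1, insp j (q.1.2, q.2)))].
have mE : measurable E.
  rewrite -[X in measurable X]setTI.
  apply: (_ : measurable_fun setT (fun q : (Rm * Rm) * N.-tuple R =>
    tcons (q.1.1, insp j (q.1.2, q.2)))) => //.
  apply: (@measurableT_comp _ _ _ _ (R * N.+1.-tuple R)%type); first exact: measurable_tcons.
  apply: measurable_fun_pair => /=.
    exact: measurableT_comp measurable_fst measurable_fst.
  apply: (@measurableT_comp _ _ _ _ (R * N.-tuple R)%type); first exact: measurable_insp.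
  apply: measurable_fun_pair => /=; last exact: measurable_snd.
  exact: measurableT_comp measurable_snd measurable_fst.
pose g (p : Rm * Rm) : \bar R := lebesgueN R N (xsection E p).
transitivity (\int[@lebesgue_measure R]_y \int[@lebesgue_measure R]_x g (y, x))%E.
  rewrite [LHS](_ : _ = \int[@lebesgue_measure R]_y
    lebesgueN R N.+1 (xsection (@tcons R N.+1 @^-1` A) y))%E; last by [].
apply: eq_integral => y _; rewrite (IH j); last exact: measurable_xsection.
  apply: eq_integral => x _; congr (lebesgueN R N _); apply/seteqP.
  by split => t /xsectionP h; apply/xsectionP;
    [move/xsectionP : h|apply/xsectionP].
have mg : measurable_fun setT g by exact: measurable_fun_xsection.
have g0 p : (0 <= g p)%E by [].
rewrite (@fubini_tonelli _ _ Rm Rm R lebesgue_measure lebesgue_measure g mg g0).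
rewrite [RHS](_ : _ = \int[@lebesgue_measure R]_x
  (@lebesgue_measure R \x lebesgueN R N)%E
    (@tcons R N @^-1` xsection (insp (lift ord0 j) @^-1` A) x))%E; last by [].
apply: eq_integral => x _; apply: eq_integral => y _.
congr (lebesgueN R N _); apply/seteqP; split => t /xsectionP h; apply/xsectionP.
  by apply/xsectionP; rewrite /preimage /= insp_lift0.
by move: h => /xsectionP; rewrite /preimage /= insp_lift0.
Qed.

End insertion.

(** * Almost everywhere equality and Fubini on rectangles *)

Section ae_lemmas.
Context d (T : measurableType d) (R : realType) (mu : {measure set T -> \bar R}).
Implicit Types (D : set T) (f g : T -> \bar R).

Lemma ge0_integral_eq0 D f : measurable D -> measurable_fun D f ->
  (forall x, (0 <= f x)%E) ->
  (\int[mu]_(x in D) f x)%E = 0%E <-> {ae mu, forall x, D x -> f x = 0%E}.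
Proof.
move=> mD mf f0.
rewrite (_ : (\int[mu]_(x in D) f x)%E = \int[mu]_(x in D) `|f x|)%E.
  exact: ae_eq_integral_abs.
by apply: eq_integral => x _; rewrite gee0_abs.
Qed.

Lemma ae_integrable D f g : measurable D -> measurable_fun D g ->
  ae_eq mu D f g -> mu.-integrable D f -> mu.-integrable D g.
Proof.
move=> mD mg fg /integrableP[mf ioo]; apply/integrableP; split => //.
rewrite (le_lt_trans _ ioo)// le_eqVlt; apply/orP; left; apply/eqP.
apply: ae_eq_integral => //; try exact: measurableT_comp.
by apply: ae_eq_abse; exact: ae_eq_sym.
Qed.

Lemma ae_eq_Rintegral D (f g : T -> R) : measurable D ->
  measurable_fun D f -> measurable_fun D g ->
  {ae mu, forall x, D x -> f x = g x} ->
  \int[mu]_(x in D) f x = \int[mu]_(x in D) g x.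
Proof.
move=> mD mf mg fg; congr fine; apply: ae_eq_integral => //.
- exact/measurable_EFinP.
- exact/measurable_EFinP.
- by apply: filterS fg => x fgx Dx; rewrite fgx.
Qed.

End ae_lemmas.

Section rectangle.
Context d1 d2 (T1 : measurableType d1) (T2 : measurableType d2) (R : realType).
Variables (m1 : {sigma_finite_measure set T1 -> \bar R}).
Variables (m2 : {sigma_finite_measure set T2 -> \bar R}).

Lemma ae_xsection (A : set (T1 * T2)) : measurable A ->
  (m1 \x m2)%E A = 0%E <-> {ae m1, forall x, m2 (xsection A x) = 0%E}.
Proof.
move=> mA; have mphi := measurable_fun_xsection m2 mA.
rewrite /product_measure1 ge0_integral_eq0//.
by split; apply: filterS => x // /(_ I).
Qed.

(** The product measure is built from x-sections; by uniqueness on rectangles it is also the measure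
    built from y-sections. *)
Lemma ae_ysection (A : set (T1 * T2)) : measurable A ->
  (m1 \x m2)%E A = 0%E <-> {ae m2, forall y, m1 (ysection A y) = 0%E}.
Proof.
move=> mA; have mphi := measurable_fun_ysection m1 mA.
have -> : (m1 \x m2)%E A = (m1 \x^ m2)%E A.
  apply: product_measure_unique => // B C mB mC /=.
  by rewrite product_measure2E.
rewrite /product_measure2 ge0_integral_eq0//.
by split; apply: filterS => x // /(_ I).
Qed.

Variables (D1 : set T1) (D2 : set T2).
Hypotheses (mD1 : measurable D1) (mD2 : measurable D2).

Let mD : measurable (D1 `*` D2). Proof. exact: measurableX. Qed.

Let patchXE (f : T1 * T2 -> \bar R) x y :
  (f \_ (D1 `*` D2)) (x, y) = if x \in D1 then (fun y => f (x, y)) \_ D2 y else 0%E.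
Proof. by rewrite !patchE in_setX /=; case: (x \in D1). Qed.

Let patchXE2 (f : T1 * T2 -> \bar R) x y :
  (f \_ (D1 `*` D2)) (x, y) = if y \in D2 then (fun x => f (x, y)) \_ D1 x else 0%E.
Proof. by rewrite !patchE in_setX /= andbC; case: (y \in D2). Qed.

Variable f : T1 * T2 -> R.
Hypothesis intf : (m1 \x m2)%E.-integrable (D1 `*` D2) (EFin \o f).

(** Extension by 0 outside the rectangle turns Fubini on the rectangle into Fubini on the whole
    product. *)
Let g := (EFin \o f) \_ (D1 `*` D2).
Let intg : (m1 \x m2)%E.-integrable setT g.
Proof. exact/(integrable_mkcond _ mD).1. Qed.

Lemma ae_integrable_rect1 :
  {ae m1, forall x, D1 x -> m2.-integrable D2 (EFin \o (fun y => f (x, y)))}.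
Proof.
have := ae_integrable1 intg; apply: filterS => x /= ix D1x.
apply/(integrable_mkcond _ mD2); apply: eq_integrable ix => // y _.
by rewrite /g patchXE// mem_set.
Qed.

Lemma ae_integrable_rect2 :
  {ae m2, forall y, D2 y -> m1.-integrable D1 (EFin \o (fun x => f (x, y)))}.
Proof.
have := ae_integrable2 intg; apply: filterS => y /= iy D2y.
apply/(integrable_mkcond _ mD1); apply: eq_integrable iy => // x _.
by rewrite /g patchXE2// mem_set.
Qed.

Let FE x : fubini_F m2 g x =
  (fun x => \int[m2]_(y in D2) (f (x, y))%:E)%E \_ D1 x.
Proof.
rewrite patchE /fubini_F; under eq_integral do rewrite /g patchXE//.
by case: ifPn => _; [rewrite -integral_mkcond|rewrite integral0].
Qed.

Let GE y : fubini_G m1 g y =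
  (fun y => \int[m1]_(x in D1) (f (x, y))%:E)%E \_ D2 y.
Proof.
rewrite patchE /fubini_G; under eq_integral do rewrite /g patchXE2//.
by case: ifPn => _; [rewrite -integral_mkcond|rewrite integral0].
Qed.

Let intF : m1.-integrable D1 (fun x => \int[m2]_(y in D2) (f (x, y))%:E)%E.
Proof.
apply/(integrable_mkcond _ mD1); have <- : fubini_F m2 g = _ := funext FE.
exact: (integrable_fubini_F intg).
Qed.

Let intG : m2.-integrable D2 (fun y => \int[m1]_(x in D1) (f (x, y))%:E)%E.
Proof.
apply/(integrable_mkcond _ mD2); have <- : fubini_G m1 g = _ := funext GE.
  have /integrableP[_ i2] := intg.
  apply/integrableP; split; first exact: (measurable_fubini_G intg).
  have mg : measurable_fun setT g by exact: measurable_int intg.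
  move/(integrable21ltyP _ _ mg).1 : intg; apply: le_lt_trans.
  apply: ge0_le_integral => //.
  - by apply: measurableT_comp => //; exact: (measurable_fubini_G intg).
  - apply: (measurable_fun_fubini_tonelli_G (abse \o g)).
      exact: measurableT_comp.
    by move=> ?; exact: abse_ge0.
  - move=> y _; apply: le_abse_integral => //.
    exact: measurableT_comp.
Qed.

(** For a null set of x the slice may fail to be integrable, and its integral may then be infinite
    while [Rintegral] keeps only a finite part. Hence equality almost everywhere only. *)
Let finF : {ae m1, forall x, D1 x ->
  (\int[m2]_(y in D2) (f (x, y))%:E)%E = (\int[m2]_(y in D2) f (x, y))%:E}.
Proof.
have := ae_integrable_rect1; apply: filterS => x /= ix D1x.
by rewrite /Rintegral fineK// integrable_fin_num//; exact: ix.
Qed.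

Let finG : {ae m2, forall y, D2 y ->
  (\int[m1]_(x in D1) (f (x, y))%:E)%E = (\int[m1]_(x in D1) f (x, y))%:E}.
Proof.
have := ae_integrable_rect2; apply: filterS => y /= iy D2y.
by rewrite /Rintegral fineK// integrable_fin_num//; exact: iy.
Qed.

Let mF : measurable_fun D1 (fun x => (\int[m2]_(y in D2) f (x, y))%:E).
Proof.
apply/measurable_EFinP; rewrite /Rintegral.
apply: (@measurableT_comp _ _ _ _ _ _ fine) => //; exact: measurable_int intF.
Qed.

Let mG : measurable_fun D2 (fun y => (\int[m1]_(x in D1) f (x, y))%:E).
Proof.
apply/measurable_EFinP; rewrite /Rintegral.
apply: (@measurableT_comp _ _ _ _ _ _ fine) => //; exact: measurable_int intG.
Qed.

Lemma integrable_rect1 :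
  m1.-integrable D1 (EFin \o (fun x => \int[m2]_(y in D2) f (x, y))).
Proof. exact: (ae_integrable mD1 mF finF intF). Qed.

Lemma integrable_rect2 :
  m2.-integrable D2 (EFin \o (fun y => \int[m1]_(x in D1) f (x, y))).
Proof. exact: (ae_integrable mD2 mG finG intG). Qed.

Lemma Rintegral_rect1 :
  \int[(m1 \x m2)%E]_(z in D1 `*` D2) f z =
  \int[m1]_(x in D1) \int[m2]_(y in D2) f (x, y).
Proof.
rewrite /Rintegral; congr fine; rewrite [LHS]integral_mkcond.
rewrite -(integral12_prod_meas1 intg).
rewrite (funext FE : fubini_F _ g = _) -integral_mkcond.
by apply: ae_eq_integral => //; exact: measurable_int intF.
Qed.

Lemma Rintegral_rect2 :
  \int[(m1 \x m2)%E]_(z in D1 `*` D2) f z =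
  \int[m2]_(y in D2) \int[m1]_(x in D1) f (x, y).
Proof.
rewrite /Rintegral; congr fine; rewrite [LHS]integral_mkcond.
rewrite -(integral21_prod_meas1 intg).
rewrite (funext GE : fubini_G _ g = _) -integral_mkcond.
by apply: ae_eq_integral => //; exact: measurable_int intG.
Qed.

End rectangle.

(** The integral is by definition the difference of the integrals of the positive and negative
    parts, and each of these depends measurably on x by Tonelli, integrable or not. *)
Lemma measurable_Rintegral_param d1 d2 (T1 : measurableType d1)
    (T2 : measurableType d2) (R : realType)
    (m2 : {sigma_finite_measure set T2 -> \bar R}) (D1 : set T1) (D2 : set T2)
    (f : T1 * T2 -> R) : measurable D1 -> measurable D2 ->
  measurable_fun (D1 `*` D2) f ->
  measurable_fun D1 (fun x => \int[m2]_(y in D2) f (x, y)).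
Proof.
move=> mD1 mD2 mf; have mD : measurable (D1 `*` D2) by exact: measurableX.
pose g := (EFin \o f) \_ (D1 `*` D2).
have mg : measurable_fun setT g.
  by apply/(measurable_restrictT _ _).1 => //; exact/measurable_EFinP.
have mG : measurable_fun setT (fun x => \int[m2]_y g (x, y))%E.
  rewrite (_ : (fun x => _) = fubini_F m2 g^\+ \- fubini_F m2 g^\-)%E.
    apply: emeasurable_funB; apply: measurable_fun_fubini_tonelli_F => //.
      exact: measurable_funepos.
    exact: measurable_funeneg.
  apply/funext => x; rewrite [LHS]integralE.
  under eq_integral do rewrite funepos_comp/=.
  by under [X in (_ - X)%E = _]eq_integral do rewrite funeneg_comp/=.
apply: (eq_measurable_fun (fun x => fine (\int[m2]_y g (x, y))%E)).
  move=> x D1x; rewrite /Rintegral; congr fine; rewrite [RHS]integral_mkcond.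
  by apply: eq_integral => y _; rewrite /g !patchE in_setX /= D1x.
by apply: (@measurableT_comp _ _ _ _ _ _ fine) => //; exact: measurable_funTS.
Qed.

(** * Slices of a box along one coordinate *)

Section box.
Context (R : realType).

Lemma measurable_box N (a b : 'I_N -> R) : measurable (box a b).
Proof.
rewrite (_ : box a b = \big[setI/setT]_(i < N)
    ((fun s => tnth s i) @^-1` `[a i, b i])).
  apply: bigsetI_measurable => i _; rewrite -[X in measurable X]setTI.
  by apply: measurable_tnth => //; exact: measurable_itv.
rewrite -bigcap_seq; apply/seteqP; split=> s.
  by move=> h i _ /=; rewrite in_itv /=.
by move=> h i; have := h i (mem_index_enum i); rewrite /= in_itv.
Qed.

Lemma measurable_fun_tuple d (T : measurableType d) N (f : T -> N.-tuple R) :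
  (forall i, measurable_fun setT (fun x => tnth (f x) i)) -> measurable_fun setT f.
Proof. by move=> h; apply/measurable_fun_tnthP. Qed.

Lemma measurable_updp N (i : 'I_N) :
  measurable_fun setT (fun p : N.-tuple R * measurableTypeR R => upd p.1 i p.2).
Proof.
apply: measurable_fun_tuple => j; under eq_fun do rewrite tnth_mktuple.
have [_|_] := boolP (j == i); first exact: measurable_snd.
apply: (@measurableT_comp _ _ _ _ _ _ (fun x => tnth x j)) => //.
exact: measurable_tnth.
Qed.

Lemma box_upd N (a b : 'I_N -> R) i s x :
  box a b s -> a i <= x <= b i -> box a b (upd s i x).
Proof.
by move=> h hx j; rewrite tnth_mktuple; have [->//|_] := eqVneq j i.
Qed.

Context (N : nat) (a b : 'I_N.+1 -> R) (i : 'I_N.+1).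
Local Notation mu := (lebesgueN R N.+1).
Local Notation mu' := (lebesgueN R N).
Local Notation leb := (@lebesgue_measure R).
Local Notation Om := (box a b).
Local Notation Om' := (box (a \o lift i) (b \o lift i)).
Local Notation I := (`[a i, b i]%classic : set (measurableTypeR R)).
Local Notation Rm := (measurableTypeR R).
Local Notation ins x t := (@ins R N.+1 i x t).

Lemma box_ins x (t : N.-tuple R) :
  box a b (ins x t) <-> `[a i, b i]%classic x /\ box (a \o lift i) (b \o lift i) t.
Proof.
split=> [h|[hx ht] j].
  split; first by have := h i; rewrite tnth_ins /= in_itv.
  by move=> j /=; have := h (lift i j); rewrite tnth_ins_lift.
case: (unliftP i j) => [k ->|->].
  by rewrite tnth_ins_lift; exact: ht.
by rewrite tnth_ins; move: hx; rewrite /= in_itv.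
Qed.

Lemma preimage_insp_box : (@insp R N i) @^-1` Om = I `*` Om'.
Proof. by apply/seteqP; split => -[x t]; rewrite /preimage /= => /box_ins. Qed.

Let mI : measurable I. Proof. exact: measurable_itv. Qed.
Let mOm' : measurable Om'. Proof. exact: measurable_box. Qed.
Let mOm : measurable Om. Proof. exact: measurable_box. Qed.

Let minsp : measurable_fun setT (fun p : Rm * N.-tuple R => insp i p).
Proof. exact: measurable_insp. Qed.

Lemma measurable_fun_insp d (T : measurableType d) (f : N.+1.-tuple R -> T) :
  measurable_fun Om f -> measurable_fun (I `*` Om') (fun p => f (insp i p)).
Proof.
move=> mf.
apply: (measurable_comp mOm _ mf (measurable_funS measurableT _ minsp)) => //.
by move=> _ [p hp <-]; move: hp; rewrite -preimage_insp_box.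
Qed.

Lemma ge0_integral_insp (f : N.+1.-tuple R -> \bar R) : measurable_fun Om f ->
  (forall s, Om s -> 0 <= f s)%E ->
  (\int[mu]_(s in Om) f s = \int[(leb \x mu')]_(p in I `*` Om') f (insp i p))%E.
Proof.
move=> mf f0.
have f0' : {in Om, forall s, 0 <= f s}%E by move=> s /set_mem; exact: f0.
have := ge0_integral_pushforward minsp (leb \x mu')%E mOm mf f0'.
rewrite preimage_insp_box => <-.
by apply: eq_measure_integral => A mA _; exact: lebesgueN_ins.
Qed.

Lemma integrable_insp (f : N.+1.-tuple R -> R) : mu.-integrable Om (EFin \o f) ->
  (leb \x mu')%E.-integrable (I `*` Om') (EFin \o (fun p => f (insp i p))).
Proof.
move=> /integrableP[/measurable_EFinP mf ioo]; apply/integrableP; split.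
  by apply/measurable_EFinP; exact: measurable_fun_insp.
move: ioo; rewrite ge0_integral_insp//.
by apply/measurable_EFinP; exact: measurableT_comp.
Qed.

Lemma Rintegral_insp (f : N.+1.-tuple R -> R) : measurable_fun Om f ->
  \int[mu]_(s in Om) f s = \int[(leb \x mu')%E]_(p in I `*` Om') f (insp i p).
Proof.
move=> mf; rewrite /Rintegral integralE [in RHS]integralE; congr (fine (_ - _)%E).
  rewrite ge0_integral_insp//; first by apply: eq_integral => p _; rewrite ?funeposE ?funenegE.
  exact/measurable_funepos/measurable_EFinP.
rewrite ge0_integral_insp//; first by apply: eq_integral => p _; rewrite ?funeposE ?funenegE.
exact/measurable_funeneg/measurable_EFinP.
Qed.

Section slices.
Variable f : N.+1.-tuple R -> R.
Hypothesis intf : mu.-integrable Om (EFin \o f).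

Let mf : measurable_fun Om f.
Proof. by apply/measurable_EFinP; exact: measurable_int intf. Qed.

Lemma ae_integrable_slice : {ae mu', forall t, Om' t ->
  leb.-integrable I (EFin \o (fun x => f (ins x t)))}.
Proof. exact: ae_integrable_rect2 (integrable_insp intf). Qed.

Lemma ae_integrable_slice1 : {ae leb, forall x, I x ->
  mu'.-integrable Om' (EFin \o (fun t => f (ins x t)))}.
Proof. exact: ae_integrable_rect1 (integrable_insp intf). Qed.

Lemma integrable_slice :
  mu'.-integrable Om' (EFin \o (fun t => \int[leb]_(x in I) f (ins x t))).
Proof. exact: integrable_rect2 (integrable_insp intf). Qed.

Lemma integrable_slice1 :
  leb.-integrable I (EFin \o (fun x => \int[mu']_(t in Om') f (ins x t))).
Proof. exact: integrable_rect1 (integrable_insp intf). Qed.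

Lemma Rintegral_slice :
  \int[mu]_(s in Om) f s = \int[mu']_(t in Om') \int[leb]_(x in I) f (ins x t).
Proof.
by rewrite Rintegral_insp// Rintegral_rect2//; exact: integrable_insp.
Qed.

Lemma Rintegral_slice1 :
  \int[mu]_(s in Om) f s = \int[leb]_(x in I) \int[mu']_(t in Om') f (ins x t).
Proof.
by rewrite Rintegral_insp// Rintegral_rect1//; exact: integrable_insp.
Qed.

End slices.

Let null_insp (A : set (N.+1.-tuple R)) : measurable A -> mu A = 0%E ->
  (leb \x mu')%E ((fun p : Rm * N.-tuple R => insp i p) @^-1` A) = 0%E.
Proof. by move=> mA; rewrite (lebesgueN_ins i). Qed.

Let measurable_insp_preimage (A : set (N.+1.-tuple R)) : measurable A ->
  measurable ((fun p : Rm * N.-tuple R => insp i p) @^-1` A).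
Proof. by move=> mA; rewrite -[X in measurable X]setTI; exact: minsp. Qed.

Lemma ae_slice (P : N.+1.-tuple R -> Prop) : {ae mu, forall s, Om s -> P s} ->
  {ae mu', forall t, Om' t -> {ae leb, forall x, I x -> P (ins x t)}}.
Proof.
move=> [A [mA A0 PA]].
have := (ae_ysection leb mu' (measurable_insp_preimage mA)).1 (null_insp mA A0).
apply: filterS => t At0 Ot.
exists (ysection ((fun p : Rm * N.-tuple R => insp i p) @^-1` A) t); split => //.
  by apply: measurable_ysection; exact: measurable_insp_preimage.
move=> x /= /not_implyP[Ix nP]; apply/ysectionP; apply: PA => /=.
by apply/not_implyP; split => //; apply/box_ins.
Qed.

(** Measurability of f and g makes the set where they differ measurable; null slices then force this
    set to be null. *)
Lemma slice_ae (f g : N.+1.-tuple R -> R) :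
  measurable_fun Om f -> measurable_fun Om g ->
  {ae mu', forall t, Om' t -> {ae leb, forall x, I x -> f (ins x t) = g (ins x t)}} ->
  {ae mu, forall s, Om s -> f s = g s}.
Proof.
move=> mf mg h; pose A := Om `&` [set s | (f s - g s) != 0].
have mA : measurable A.
  have -> : A = Om `&` (fun s => f s - g s) @^-1` ~` [set 0].
    by apply/seteqP; split => s [Os /= /eqP fg]; split => //=; apply/eqP.
  by apply: measurable_funB => //; exact: measurableC.
exists A; split => //; last first.
  move=> s /= /not_implyP[Os fg]; split => //=; rewrite subr_eq0; exact/eqP.
rewrite (lebesgueN_ins i)//; apply/(ae_ysection leb mu').
  exact: measurable_insp_preimage.
apply: filterS h => t h.
have [Ot|nOt] := pselect (Om' t); last first.
  rewrite (_ : ysection _ _ = set0) ?measure0//; apply/seteqP; split => // x.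
  by move=> /ysectionP[/box_ins[]].
have [B [mB B0 fB]] := h Ot.
apply: (subset_measure0 _ mB _ B0).
  by apply: measurable_ysection; exact: measurable_insp_preimage.
move=> x /ysectionP[/box_ins[Ix _]] /= fg; apply: fB => /=.
by apply/not_implyP; split=> // /eqP; rewrite -subr_eq0; apply/negP.
Qed.

Lemma measurable_slice d (T : measurableType d) (f : N.+1.-tuple R -> T) t :
  measurable_fun Om f -> Om' t ->
  measurable_fun (I : set R) (fun x : R => f (ins x t)).
Proof.
move=> mf Ot; apply: (measurable_comp mOm _ mf) => //.
  by move=> _ [x Ix <-]; apply/box_ins.
apply: (@measurable_funTS _ _ R).
apply: (@measurableT_comp _ _ _ _ (R * N.-tuple R)%type _ (insp i) _ (fun x => (x, t))).
  exact: measurable_insp.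
exact: measurable_fun_pair.
Qed.

End box.

Lemma lebesgueN_box_fin (R : realType) N (a b : 'I_N -> R) :
  (lebesgueN R N (box a b) < +oo)%E.
Proof.
elim: N => [|N IH] in a b *.
  by rewrite /= diracE ltry.
rewrite (lebesgueN_ins ord0) ?/pushforward; last exact: measurable_box.
rewrite preimage_insp_box product_measure1E; last 2 first.
- exact: measurable_itv.
- exact: measurable_box.
rewrite lte_mul_pinfty// ?IH// [X in X \is a fin_num]/=.
  by rewrite lebesgue_measure_itv /=; case: ifP.
Qed.

(** Cauchy-Schwarz in abstract form, with A = <f, f>, B = <f, g> and C = <g, g>; it serves the
    scalar and the vector-valued inner product. *)
Lemma discr_le (R : realFieldType) (A B C : R) :
  (forall c c', 0 <= c ^+ 2 * A + 2 * c * c' * B + c' ^+ 2 * C) -> B ^+ 2 <= A * C.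
Proof.
move=> h; have C0 : 0 <= C by have := h 0 1; lra.
have [C0'|Cn0] := eqVneq C 0.
  have [->|B0] := eqVneq B 0; first by rewrite C0' mulr0 expr0n.
  (* With C = 0 the form is affine in c', and this value of c' makes it equal to -1. *)
  have := h 1 (- (A + 1) / (2 * B)).
  have -> : 2 * 1 * (- (A + 1) / (2 * B)) * B = - (A + 1) by field.
  by rewrite C0'; lra.
have Cp : 0 < C by rewrite lt_neqAle eq_sym Cn0.
(* The minimizer of the form up to scaling; its value is C (A C - B^2). *)
have := h C (- B).
have -> : C ^+ 2 * A + 2 * C * - B * B + (- B) ^+ 2 * C = C * (A * C - B ^+ 2) by ring.
by rewrite pmulr_rge0// subr_ge0.
Qed.

(** * Scalar square-integrable functions *)

Section square_integrable.
Context d (T : measurableType d) (R : realType) (mu : {measure set T -> \bar R}).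
Variables (D : set T) (mD : measurable D).
Implicit Types f g h : T -> R.

(** Phrased so that [L2 a b u] unfolds to it for each component, and over an arbitrary measure so
    that boxes, lines and intervals share the same lemmas. *)
Definition sqint f := measurable_fun D f /\
  mu.-integrable D (EFin \o (fun x => f x ^+ 2)).

Definition ip f g := \int[mu]_(x in D) (f x * g x).

Lemma sqint_mul f g : sqint f -> sqint g ->
  mu.-integrable D (EFin \o (fun x => f x * g x)).
Proof.
move=> [mf f2] [mg g2]; apply: (le_integrable mD _ _ (integrableD mD f2 g2)).
  by apply/measurable_EFinP; exact: measurable_funM.
move=> x Dx; rewrite /= lee_fin [leRHS]ger0_norm ?addr_ge0 ?sqr_ge0//.
rewrite ler_norml; apply/andP; split; nra.
Qed.

Lemma sqint_bmul M h f : measurable_fun D h -> (forall x, D x -> `|h x| <= M) ->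
  sqint f -> sqint (fun x => h x * f x).
Proof.
move=> mh hM [mf f2]; split; first exact: measurable_funM.
apply: (le_integrable mD _ _ (integrableZl mD (M ^+ 2) f2)).
  by apply/measurable_EFinP/measurable_funX; exact: measurable_funM.
move=> x Dx; rewrite /= lee_fin ger0_norm ?sqr_ge0//.
rewrite ger0_norm; last by apply: mulr_ge0; exact: sqr_ge0.
rewrite exprMn ler_wpM2r ?sqr_ge0//.
by have := hM _ Dx; rewrite ler_norml => /andP[? ?]; nra.
Qed.

Lemma sqintZ c f : sqint f -> sqint (fun x => c * f x).
Proof. by apply: (@sqint_bmul `|c| (fun=> c)). Qed.

Lemma sqintD f g : sqint f -> sqint g -> sqint (fun x => f x + g x).
Proof.
move=> sf sg; have [[mf f2] [mg g2]] := (sf, sg).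
split; first exact: measurable_funD.
have i1 := integrableD mD f2 g2.
apply: (le_integrable mD _ _ (integrableZl mD 2 i1)).
  by apply/measurable_EFinP/measurable_funX; exact: measurable_funD.
move=> x Dx; rewrite /= lee_fin ger0_norm ?sqr_ge0//.
rewrite ger0_norm; last by apply: mulr_ge0 => //; apply: addr_ge0; exact: sqr_ge0.
rewrite -subr_ge0 (_ : _ - _ = (f x - g x) ^+ 2) ?sqr_ge0//.
rewrite /=; ring.
Qed.

Lemma sqint0 : sqint (fun=> 0).
Proof.
split => //; rewrite (_ : _ \o _ = cst 0%E); first exact: integrable0.
by apply/funext => x /=; rewrite expr0n.
Qed.

Lemma sqint_sum I (r : seq I) (P : pred I) (F : I -> T -> R) :
  (forall i, sqint (F i)) -> sqint (fun x => \sum_(i <- r | P i) F i x).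
Proof.
move=> sF; elim: r => [|i r IH].
  by under eq_fun do rewrite big_nil; exact: sqint0.
under eq_fun do rewrite big_cons; case: (P i) => //.
exact: sqintD.
Qed.

Lemma sqint_ae f g : measurable_fun D g -> {ae mu, forall x, D x -> f x = g x} ->
  sqint f -> sqint g.
Proof.
move=> mg fg [mf f2]; split => //; apply: ae_integrable f2 => //.
  exact/measurable_EFinP/measurable_funX.
by apply: filterS fg => x + Dx => /(_ Dx) /= ->.
Qed.

Lemma eq_sqint f g : (forall x, D x -> f x = g x) -> sqint f -> sqint g.
Proof.
move=> fg [mf f2]; split; first by apply: eq_measurable_fun mf => x /set_mem /fg.
by apply: eq_integrable f2 => // x /set_mem /fg /= ->.
Qed.

Lemma ipC f g : ip f g = ip g f.
Proof. by apply: eq_Rintegral => x _; rewrite mulrC. Qed.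

Lemma eq_ip f f' g g' : (forall x, D x -> f x = f' x) ->
  (forall x, D x -> g x = g' x) -> ip f g = ip f' g'.
Proof. by move=> ff gg; apply: eq_Rintegral => x /set_mem Dx; rewrite ff ?gg. Qed.

Lemma ipDl f f' g : sqint f -> sqint f' -> sqint g ->
  ip (fun x => f x + f' x) g = ip f g + ip f' g.
Proof.
move=> sf sf' sg; rewrite /ip -RintegralD//; last 2 first.
- exact: sqint_mul.
- exact: sqint_mul.
by apply: eq_Rintegral => x _; rewrite mulrDl.
Qed.

Lemma ipZl c f g : sqint f -> sqint g -> ip (fun x => c * f x) g = c * ip f g.
Proof.
move=> sf sg; rewrite /ip -RintegralZl//; last exact: sqint_mul.
by apply: eq_Rintegral => x _; rewrite mulrA.
Qed.

Lemma ip_suml I (r : seq I) (P : pred I) (F : I -> T -> R) g :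
  (forall i, sqint (F i)) -> sqint g ->
  ip (fun x => \sum_(i <- r | P i) F i x) g = \sum_(i <- r | P i) ip (F i) g.
Proof.
move=> sF sg; elim: r => [|i r IH].
  rewrite big_nil /ip -[RHS](@mul0r _ (fine (mu D))) -Rintegral_cst//.
  by apply: eq_Rintegral => x _; rewrite big_nil mul0r.
rewrite big_cons /ip; case: ifPn => Pi; last first.
  by rewrite -IH; apply: eq_Rintegral => x _; rewrite big_cons (negbTE Pi).
rewrite -IH -ipDl//; last exact: sqint_sum.
by apply: eq_Rintegral => x _; rewrite big_cons Pi.
Qed.

Lemma ip_ge0 f : 0 <= ip f f.
Proof. by apply: Rintegral_ge0 => x _; rewrite -expr2 sqr_ge0. Qed.

Lemma ip_cs f g : sqint f -> sqint g -> ip f g ^+ 2 <= ip f f * ip g g.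
Proof.
move=> sf sg.
have h c c' : 0 <= c ^+ 2 * ip f f + 2 * c * c' * ip f g + c' ^+ 2 * ip g g.
  have scf := sqintZ c sf; have scg := sqintZ c' sg.
  have := ip_ge0 (fun x => c * f x + c' * g x).
  rewrite ipDl//; last exact: sqintD.
  rewrite !ipZl//; try exact: sqintD.
  rewrite ![ip _ (fun x => _ + _)]ipC !ipDl// !ipZl// (ipC g f).
  by move=> /le_trans; apply; rewrite le_eqVlt; apply/orP; left; apply/eqP; ring.
exact: discr_le.
Qed.

Lemma ip_eq0 f : sqint f -> ip f f = 0 -> {ae mu, forall x, D x -> f x = 0}.
Proof.
move=> sf f0; have /integrableP[m2 i2] := sf.2.
have : (\int[mu]_(x in D) (f x ^+ 2)%:E)%E = 0%E.
  rewrite -[LHS](fineK (integrable_fin_num mD sf.2)) (_ : fine _ = ip f f) ?f0//.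
move=> /(ge0_integral_eq0 mu mD (f := EFin \o (fun x => f x ^+ 2)) m2 _).1 h.
have : {ae mu, forall x, D x -> (EFin \o (fun x => f x ^+ 2)) x = 0%E}.
  by apply: h => x; rewrite /= lee_fin sqr_ge0.
by apply: filterS => x + Dx => /(_ Dx) /= [] /eqP; rewrite sqrf_eq0 => /eqP.
Qed.

Lemma ae_eq_ip f f' g : measurable_fun D f -> measurable_fun D f' ->
  measurable_fun D g -> {ae mu, forall x, D x -> f x = f' x} -> ip f g = ip f' g.
Proof.
move=> mf mf' mg ff'; apply: ae_eq_Rintegral => //; try exact: measurable_funM.
by apply: filterS ff' => x h Dx; rewrite h.
Qed.

Hypothesis Dfin : (mu D < +oo)%E.

Lemma sqint_cst c : sqint (fun=> c).
Proof.
split => //; apply/integrableP; split; first exact/measurable_EFinP.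
rewrite /= integral_cst//; exact: lte_mul_pinfty.
Qed.

Lemma sqint_bounded M h : measurable_fun D h -> (forall x, D x -> `|h x| <= M) ->
  sqint h.
Proof.
move=> mh hM; have := sqint_bmul mh hM (sqint_cst 1).
by under eq_fun do rewrite mulr1.
Qed.

Lemma sqint_integrable f : sqint f -> mu.-integrable D (EFin \o f).
Proof.
move=> sf; have := sqint_mul sf (sqint_cst 1).
by under eq_fun do rewrite mulr1.
Qed.

End square_integrable.

(** * Smooth functions of one variable, bumps and the fundamental lemma *)

Section derive_tools.
Context (R : realType).
Implicit Types (f g : R -> R) (x l : R).

Lemma is_derive_eps f x l :
  (forall e, 0 < e -> exists2 d, 0 < d & forall h, `|h| < d ->
    `|f (x + h) - f x - h * l| <= e * `|h|) -> is_derive x 1 f l.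
Proof.
move=> H.
have cv : h^-1 *: (f (h *: 1 + x) - f x) @[h --> 0^'] --> l.
  apply/cvgrPdist_le => e e0; have [d d0 Hd] := H _ e0.
  near=> h.
  have h0 : h != 0 by near: h; exact: nbhs_dnbhs_neq.
  have hd : `|h| < d.
    near: h; apply: (@dnbhs0_lt R R^o d) => //.
  have -> : l - h^-1 *: (f (h *: 1 + x) - f x) =
      - (h^-1 * (f (x + h) - f x - h * l)).
    rewrite [h *: 1](_ : _ = h); last by rewrite /GRing.scale /= mulr1.
    rewrite (addrC h x) /GRing.scale /=; field.
    exact: h0.
  rewrite normrN normrM normfV mulrC ler_pdivrMr ?normr_gt0//.
  exact: Hd.
apply: DeriveDef; first by apply/cvg_ex; exists l.
exact: cvg_lim cv.
Unshelve. all: by end_near. Qed.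

Lemma is_derive1P f x l : is_derive x 1 f l <-> derivable f x 1 /\ derive1 f x = l.
Proof.
split=> [[df fl]|[df fl]]; first by rewrite derive1E.
by apply: DeriveDef => //; rewrite -derive1E.
Qed.

Lemma is_derive_inv x : x != 0 -> is_derive x 1 (fun y : R => y^-1) (- (x^-1 ^+ 2)).
Proof.
move=> x0; apply: DeriveDef.
  exact: derivableV (x0 : id x != 0) (@derivable_id _ _ x 1).
rewrite (deriveV (x0 : id x != 0) (@derivable_id _ _ x 1)) derive_id.
by rewrite /GRing.scale /= mulr1 exprVn.
Qed.

Definition smooth1 f := forall k x, derivable (derive1n k f) x 1.

(** Coinduction principle for smoothness: it suffices to exhibit a family of differentiable
    functions that is stable under differentiation. *)
Lemma smooth1_family (S : (R -> R) -> Prop) :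
  (forall f, S f -> (forall x, derivable f x 1) /\ S f^`()%classic) ->
  forall f, S f -> smooth1 f.
Proof.
move=> HS f Sf k; have : S (derive1n k f); last by move=> /HS[].
by elim: k => // k /HS[_]; rewrite derive1nS.
Qed.

Lemma smooth1_derive f : smooth1 f -> smooth1 f^`()%classic.
Proof.
move=> sf k x; have := sf k.+1 x.
by rewrite /derive1n iterSr.
Qed.

Lemma smooth1_derivable f x : smooth1 f -> derivable f x 1.
Proof. by move=> /(_ 0%N x). Qed.

Lemma smooth1_iter f k : smooth1 f -> smooth1 (derive1n k f).
Proof. move=> sf; elim: k => [|k IH]; [exact: sf|exact: smooth1_derive IH]. Qed.

Lemma smooth1_continuous f : smooth1 f -> continuous f.
Proof.
move=> sf x; apply/differentiable_continuous.
by rewrite -derivable1_diffP; exact: smooth1_derivable.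
Qed.

Lemma smooth1_cst c : smooth1 (fun=> c).
Proof.
apply: (@smooth1_family (fun f => exists c, f = fun=> c)); last by exists c.
move=> _ [e ->]; split => [x|]; first exact: derivable_cst.
by exists 0; apply/funext => x; rewrite derive1_cst.
Qed.

Lemma smooth1D f g : smooth1 f -> smooth1 g -> smooth1 (fun x => f x + g x).
Proof.
move=> sf sg; apply: (@smooth1_family (fun h => exists f g,
  [/\ smooth1 f, smooth1 g & h = fun x => f x + g x])); last by exists f, g.
move=> _ [f1 [g1 [s1 s2 ->]]]; split=> [x|].
  by apply: derivableD; exact: smooth1_derivable.
exists f1^`()%classic, g1^`()%classic; split; [exact: smooth1_derive..|].
apply/funext => x; rewrite !derive1E deriveD//; exact: smooth1_derivable.
Qed.

(** The derivative of a product of smooth functions is a sum of two such products, so closing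
    products under sums gives a family to which [smooth1_family] applies. *)
Inductive sum_of_products : (R -> R) -> Prop :=
| SumOfProductsM f g : smooth1 f -> smooth1 g -> sum_of_products (fun x => f x * g x)
| SumOfProductsD f g : sum_of_products f -> sum_of_products g ->
    sum_of_products (fun x => f x + g x).

Lemma smooth1M f g : smooth1 f -> smooth1 g -> smooth1 (fun x => f x * g x).
Proof.
move=> sf sg; apply: (@smooth1_family sum_of_products); last exact: SumOfProductsM.
move=> h; elim=> [f1 g1 s1 s2|f1 g1 _ [d1 e1] _ [d2 e2]].
  split=> [x|]; first by apply: derivableM; exact: smooth1_derivable.
  have -> : (fun x => f1 x * g1 x)^`()%classic =
      (fun x => (f1 x * g1^`()%classic x) + (g1 x * f1^`()%classic x)).
    by apply/funext => x; rewrite !derive1E deriveM//; exact: smooth1_derivable.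
  exact: SumOfProductsD (SumOfProductsM s1 (smooth1_derive s2))
    (SumOfProductsM s2 (smooth1_derive s1)).
split=> [x|]; first exact: derivableD.
have -> : (fun x => f1 x + g1 x)^`()%classic =
    (fun x => f1^`()%classic x + g1^`()%classic x).
  by apply/funext => x; rewrite !derive1E deriveD.
exact: SumOfProductsD.
Qed.

Lemma is_derive_affine c e x : is_derive x 1 (fun y : R => c * y + e) c.
Proof.
have -> : (fun y : R => c * y + e) = horner (c *: 'X + e%:P).
  by apply/funext => y; rewrite !hornerE.
have := is_derive_poly (c *: 'X + e%:P) x.
by rewrite derivD derivZ derivX derivC addr0 hornerZ hornerC mulr1.
Qed.

Lemma smooth1_affine f c e : smooth1 f -> smooth1 (fun x => f (c * x + e)).
Proof.
move=> sf; apply: (@smooth1_family (fun h => exists k f, smooth1 f /\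
  h = fun x => k * f (c * x + e))); last first.
  by exists 1, f; split => //; apply/funext => x; rewrite mul1r.
move=> _ [k [f1 [s1 ->]]].
have H x : is_derive x 1 (fun x => k * f1 (c * x + e))
    (k * c * f1^`()%classic (c * x + e)).
  have /derivableP d1 : derivable f1 (c * x + e) 1 by exact: smooth1_derivable.
  have := is_deriveZ k (is_derive1_comp (g := fun x => c * x + e) d1 (is_derive_affine c e x)).
  by rewrite /GRing.scale /= -derive1E (mulrC _ c) mulrA.
split=> [x|]; first by have [] := H x.
exists (k * c), f1^`()%classic; split; first exact: smooth1_derive.
by apply/funext => x; have /is_derive1P[] := H x.
Qed.

Lemma smooth1_eq_near f : smooth1 f -> forall x, (\forall y \near x, f y = 0) ->
  f^`()%classic x = 0.
Proof.
move=> sf x fx; rewrite derive1E (@near_eq_derive _ _ _ f (fun=> 0))//.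
exact: derive_cst.
Qed.

End derive_tools.

Section flat.
Context (R : realType).

(* y |-> P(1/y) exp(-1/y), extended by 0 on y <= 0: this family is stable under
   differentiation, P becoming 'X^2 * (P - P'). *)
Definition flat (P : {poly R}) (y : R) : R :=
  if 0 < y then P.[y^-1] * expR (- y^-1) else 0.

Lemma expRN_bound (z : R) k : 0 < z -> z ^+ k.+1 * expR (- z) <= k.+1`!%:R.
Proof.
move=> z0; rewrite expRN ler_pdivrMr ?expR_gt0//.
have f0 : (0 : R) < k.+1`!%:R by rewrite ltr0n fact_gt0.
rewrite mulrC -ler_pdivrMr// (le_trans _ (expR_ge1Dxn k (ltW z0)))//.
by rewrite lerDr.
Qed.

(** With z = 1/y, the monomial of degree i contributes z^i exp(-z), which is at most (i+2)! z^-2. A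
    quadratic bound is what makes the derivative at 0 vanish. *)
Lemma flat_bound P : exists C, forall y, `|flat P y| <= C * y ^+ 2.
Proof.
exists (\sum_(i < size P) `|P`_i| * i.+2`!%:R) => y; rewrite /flat.
case: ifPn => [y0|_]; last first.
  by rewrite normr0 mulr_ge0 ?sqr_ge0// sumr_ge0// => i _; rewrite mulr_ge0.
rewrite normrM (gtr0_norm (expR_gt0 _)) horner_coef.
rewrite (le_trans (ler_wpM2r (expR_ge0 _) (ler_norm_sum _ _ _)))// !mulr_suml.
apply: ler_sum => i _; rewrite normrM -!mulrA ler_wpM2l//.
rewrite ger0_norm ?exprn_ge0 ?invr_ge0 ?(ltW y0)//.
have yV0 : 0 < y^-1 by rewrite invr_gt0.
rewrite -ler_pdivrMr ?exprn_gt0// -exprVn mulrAC -exprD addn2.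
exact: expRN_bound.
Qed.

Lemma is_derive_flat (P : {poly R}) (y : R) : is_derive y (1 : R) (flat P) (flat ('X^2 * (P - P^`())) y).
Proof.
have [y0|y0|->] := ltgtP y 0.
- have -> : flat ('X^2 * (P - P^`())) y = 0 by rewrite /flat ltNge (ltW y0).
  apply: (@near_eq_is_derive _ _ _ (cst 0)).
  near=> z; have z0 : z < 0 by near: z; exact: lt_nbhsl.
  by rewrite /flat ltNge ltW.
- have yn0 : y != 0 by rewrite gt_eqF.
  apply: (@near_eq_is_derive _ _ _ ((fun w => P.[w] * expR (- w)) \o (fun z => z^-1))).
    near=> z; have z0 : 0 < z by near: z; exact: lt_nbhsr.
    by rewrite /flat z0.
  have h : is_derive y^-1 1 (fun w => P.[w] * expR (- w))
      ((P^`().[y^-1] - P.[y^-1]) * expR (- y^-1)).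
    have e1 : is_derive y^-1 1 (fun w : R => expR (- w)) (expR (- y^-1) * -1).
      exact: (@is_derive1_comp _ expR (fun w => - w)).
    apply: is_derive_eq.
    by rewrite /GRing.scale /=; ring.
  have := is_derive1_comp h (is_derive_inv yn0).
  congr (is_derive _ _ _ _).
  by rewrite /flat y0 !hornerE; ring.
(* At 0 the difference quotient is at most C |h| by the quadratic bound, whence the radius e / (|C|
   + 1). *)
- have [C HC] := flat_bound P; have HC' := HC 1.
  have -> : flat ('X^2 * (P - P^`())) 0 = 0 by rewrite /flat ltxx.
  have f00 : flat P 0 = 0 by rewrite /flat ltxx.
  apply: is_derive_eps => e e0.
  exists (e / (`|C| + 1)); first by rewrite divr_gt0// ltr_wpDl.
  move=> h hd; rewrite add0r mulr0 subr0 f00 subr0.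
  rewrite (le_trans (HC h))// -real_normK ?num_real// expr2 mulrA ler_wpM2r//.
  rewrite (le_trans (ler_wpM2r (normr_ge0 _) (ler_norm C)))//.
  move: hd; rewrite ltr_pdivlMr ?ltr_wpDl// => /ltW; apply: le_trans.
  by rewrite mulrC ler_wpM2l// lerDl.
Unshelve. all: by end_near. Qed.

Lemma smooth1_flat P : smooth1 (flat P).
Proof.
apply: (@smooth1_family _ (fun f => exists P, f = flat P)); last by exists P.
move=> _ [Q ->]; split=> [x|].
  by have [] := is_derive_flat Q x.
exists ('X^2 * (Q - Q^`())); apply/funext => x.
by have /is_derive1P[] := is_derive_flat Q x.
Qed.

(** [flat 1] is exp(-1/y) for y > 0 and tends to 1 at infinity. Hence the bumps stay in [0, 1] and
    tend pointwise to the indicator of ]p, q[ as m grows, as dominated convergence requires. *)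
Definition bump (p q : R) (m : nat) (x : R) : R :=
  flat 1 (m.+1%:R * (x - p)) * flat 1 (m.+1%:R * (q - x)).

Lemma flat1_itv y : 0 <= flat 1 y <= 1.
Proof.
rewrite /flat; case: ifPn => y0; last by rewrite lexx ler01.
by rewrite hornerC mul1r expR_ge0 expR_le1 oppr_le0 invr_ge0 ltW.
Qed.

Lemma smooth1_bump p q m : smooth1 (bump p q m).
Proof.
apply: smooth1M.
  under eq_fun do rewrite mulrBr -mulrN; exact/smooth1_affine/smooth1_flat.
under eq_fun do rewrite mulrBr addrC -mulNr; exact/smooth1_affine/smooth1_flat.
Qed.

Lemma bump_itv p q m x : 0 <= bump p q m x <= 1.
Proof.
have /andP[h1 h2] := flat1_itv (m.+1%:R * (x - p)).
have /andP[h3 h4] := flat1_itv (m.+1%:R * (q - x)).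
by rewrite /bump mulr_ge0//= mulr_ile1.
Qed.

Lemma bump_out p q m x : ~~ (p < x < q) -> bump p q m x = 0.
Proof.
rewrite negb_and -!leNgt => /orP[h|h]; rewrite /bump /flat.
  by rewrite pmulr_rgt0// subr_gt0 ltNge h mul0r.
by rewrite [X in _ * X]ifF ?mulr0// pmulr_rgt0// subr_gt0 ltNge h.
Qed.

Lemma bump_gt0 p q m x : p < x < q -> 0 < bump p q m x.
Proof.
move=> /andP[h1 h2].
have e1 : 0 < m.+1%:R * (x - p) by rewrite pmulr_rgt0// subr_gt0.
have e2 : 0 < m.+1%:R * (q - x) by rewrite pmulr_rgt0// subr_gt0.
by rewrite /bump /flat e1 e2 !hornerC !mul1r mulr_gt0// expR_gt0.
Qed.

Lemma flat1_cvg (y : R) : 0 < y -> flat 1 (m.+1%:R * y) @[m --> \oo] --> (1 : R).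
Proof.
move=> y0; rewrite /flat.
have -> : (fun m : nat => if 0 < m.+1%:R * y then (1 : {poly R}).[(m.+1%:R * y)^-1] *
    expR (- (m.+1%:R * y)^-1) else 0) = fun m => expR (- (m.+1%:R^-1 * y^-1)).
  by apply/funext => m; rewrite mulr_gt0// hornerC mul1r invfM.
rewrite -[X in _ --> X](@expR0 R); apply: continuous_cvg; first exact: continuous_expR.
rewrite -[X in _ --> X]oppr0; apply: cvgN.
have H : @harmonic R n * y^-1 @[n --> \oo] --> 0 * y^-1.
  by apply: cvgM; [exact: (@cvg_harmonic R)|exact: cvg_cst].
by rewrite mul0r in H.
Qed.

Lemma bump_cvg p q x : bump p q m x @[m --> \oo] --> ((p < x < q)%R%:R : R).
Proof.
case: (boolP (p < x < q)) => [/andP[h1 h2]|h]; last first.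
  by under eq_fun do rewrite bump_out//; exact: cvg_cst.
rewrite /bump -[X in _ --> X]mulr1.
by apply: cvgM; apply: flat1_cvg; rewrite subr_gt0.
Qed.

End flat.

Section test1.
Context (R : realType).
Local Notation leb := (@lebesgue_measure R).
Implicit Types (a b : R) (f phi : R -> R).

Definition test1 a b phi := smooth1 phi /\
  exists2 e, 0 < e & forall x, phi x != 0 -> a + e <= x <= b - e.

Lemma test1_bump a b p q m : a < p -> q < b -> test1 a b (bump p q m).
Proof.
move=> ap qb; split; first exact: smooth1_bump.
exists (Num.min (p - a) (b - q)); first by rewrite lt_min !subr_gt0 ap qb.
move=> x bx; have /andP[px xq] : p < x < q.
  by apply: contraNT bx => h; rewrite bump_out.
apply/andP; split.
  by rewrite -lerBrDl ge_min lerB// ltW.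
by rewrite lerBrDr -lerBrDl ge_min orbC lerB// ltW.
Qed.

Lemma test1_derive a b phi : test1 a b phi -> test1 a b (derive1 phi).
Proof.
move=> [sp [e e0 he]]; split; first exact: smooth1_derive.
exists e => // x; apply: contraNT => h; apply/eqP; apply: smooth1_eq_near => //.
move: h; rewrite negb_and -!ltNge => /orP[h|h].
  near=> y; apply/eqP/negPn/negP => /he /andP[+ _].
  by rewrite leNgt => /negP; apply; near: y; exact: lt_nbhsl.
near=> y; apply/eqP/negPn/negP => /he /andP[_].
by rewrite leNgt => /negP; apply; near: y; exact: lt_nbhsr.
Unshelve. all: by end_near. Qed.

Lemma test1_iter a b phi k : test1 a b phi -> test1 a b (derive1n k phi).
Proof. by move=> tp; elim: k => [//|k IH]; exact: test1_derive IH. Qed.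

Lemma smooth1_bounded a b phi : a <= b -> smooth1 phi ->
  exists M, forall x, `[a, b]%classic x -> `|phi x| <= M.
Proof.
move=> ab sp; have cp : {within `[a, b], continuous (fun x => `|phi x|)}.
  apply: continuous_subspaceT => x; apply: cvg_norm.
  exact: smooth1_continuous.
have [c _ hc] := EVT_max ab cp; exists `|phi c| => x xab; exact: hc.
Qed.

Lemma smooth1_measurable phi (D : set R) : smooth1 phi -> measurable_fun D phi.
Proof.
move=> sp; apply: measurable_funTS; apply: continuous_measurable_fun.
exact: smooth1_continuous.
Qed.

Lemma smooth1_measurableR phi (D : set (measurableTypeR R)) : smooth1 phi ->
  measurable_fun D phi.
Proof. exact: smooth1_measurable. Qed.

Lemma integrable_itv_smooth1 a b f phi : a <= b ->
  leb.-integrable `[a, b] (EFin \o f) -> smooth1 phi ->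
  leb.-integrable `[a, b] (EFin \o (fun x => f x * phi x)).
Proof.
move=> ab intf sp; have [M hM] := smooth1_bounded ab sp.
have mI : measurable (`[a, b]%classic : set (measurableTypeR R)) by exact: measurable_itv.
apply: (le_integrable mI _ _ (integrableZl mI M intf)).
  apply/measurable_EFinP; apply: measurable_funM.
    by apply/measurable_EFinP; exact: measurable_int intf.
  exact: smooth1_measurable.
move=> x Ix; rewrite /= lee_fin !normrM mulrC ler_wpM2r//.
by rewrite (le_trans (hM _ Ix))// ler_norm.
Qed.

(* Rational endpoints make the family of tests countable, so that null sets depending
   on the test can be united. *)
Lemma fundamental1 a b f : a < b -> leb.-integrable `[a, b] (EFin \o f) ->
  (forall (p q : rat) m, a < ratr p -> ratr p < ratr q :> R -> ratr q < b ->
     \int[leb]_(x in `[a, b]) (f x * bump (ratr p) (ratr q) m x) = 0) ->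
  {ae leb, forall x, `[a, b]%classic x -> f x = 0}.
Proof.
move=> ab intf H.
have mI : measurable (`[a, b]%classic : set (measurableTypeR R)) by exact: measurable_itv.
have mf : measurable_fun (`[a, b]%classic : set (measurableTypeR R)) f.
  by apply/measurable_EFinP; exact: measurable_int intf.
have intS (i : interval R) : [set` i] `<=` `[a, b]%classic ->
    leb.-integrable [set` i] (EFin \o f).
  by move=> iS; apply: integrableS intf => //; exact: measurable_itv.
(* Dominated convergence: the bumps tend to the indicator of ]p, q[ and |f| dominates. *)
have Hpq (p q : rat) : a < ratr p -> ratr p < ratr q :> R -> ratr q < b ->
    \int[leb]_(x in `]ratr p, ratr q[) f x = 0.
  move=> ap pq qb.
  have pqab : `](ratr p : R), ratr q[ `<=` `[a, b].
    by move=> x /=; rewrite !in_itv/= => /andP[h1 h2]; rewrite !ltW//;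
      [exact: lt_trans qb|exact: lt_trans h1].
  have -> : \int[leb]_(x in `]ratr p, ratr q[) f x =
      \int[leb]_(x in `[a, b]) (f x * (ratr p < x < ratr q)%R%:R).
    have -> : `](ratr p : R), ratr q[%classic = `[a, b] `&` `]ratr p, ratr q[.
      by rewrite setIC setIidl.
    rewrite Rintegral_mkcondr; apply: eq_Rintegral => x _.
    rewrite patchE mem_setE in_itv/=.
    by case: ifPn => _; rewrite ?mulr1 ?mulr0.
  have [|||||_ _] := @dominated_convergence _ _ R leb `[a, b] mI
    (fun m x => (f x * bump (ratr p) (ratr q) m x)%:E)
    (fun x => (f x * (ratr p < x < ratr q)%R%:R)%:E) (fun x => `|f x|%:E).
  - move=> m; apply/measurable_EFinP; apply: (measurable_funM mf).
    exact: smooth1_measurableR (@smooth1_bump R _ _ _).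
  - apply/measurable_EFinP; apply: (measurable_funM mf).
    apply: measurable_funTS; rewrite (_ : (fun x => _) =
      \1_(`](ratr p : R), ratr q[%classic : set (measurableTypeR R))).
      exact: measurable_indic.
    by apply/funext => x; rewrite indicE mem_setE in_itv.
  - apply: aeW => x _; apply: cvg_EFin; first exact: nearW.
    by apply: cvgM; [exact: cvg_cst|exact: bump_cvg].
  - exact: integrable_norm.
  - apply: aeW => x m _; rewrite /= lee_fin normrM ler_piMr//.
    by have /andP[h1 h2] := bump_itv (ratr p : R) (ratr q) m x; rewrite ger0_norm.
  rewrite /=; set s := (X in X @ _ --> _ -> _).
  have -> : s = fun=> 0%E.
    apply/funext => m; rewrite /s.
    rewrite -[LHS]fineK; first by congr EFin; exact: H.
    apply: integrable_fin_num => //.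
    by apply: integrable_itv_smooth1 => //; [exact: ltW|exact: smooth1_bump].
  rewrite /Rintegral => h.
  suff -> : (\int[leb]_(x in `[a, b]) (f x * (ratr p < x < ratr q)%R%:R)%:E = 0)%E by [].
  apply/esym; apply: cvg_unique h; last exact: cvg_cst.
  exact: ereal_hausdorff.
(* The primitive of f takes the same value at all rational points of ]a, b[. Being continuous it is
   constant there, and f is its derivative almost everywhere. *)
pose F x := \int[leb]_(t in `[a, x]) f t.
have FB (p q : rat) : a < ratr p -> ratr p < ratr q :> R -> ratr q < b ->
    F (ratr p) = F (ratr q).
  move=> ap pq qb; apply/esym/eqP; rewrite -subr_eq0; apply/eqP.
  rewrite /F Rintegral_itvB ?bnd_simp ?ltW//; last first.
    apply: intS => x /=; rewrite !in_itv /= => /andP[-> h] /=.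
    exact: le_trans (ltW qb).
  rewrite -Rintegral_itv_bndo_bndc; first exact: Hpq.
  apply: intS => x /=; rewrite !in_itv /= => /andP[h1 h2].
  by rewrite !ltW//; [exact: lt_trans qb|exact: lt_trans h1].
have cF : {within `[a, b], continuous F}.
  exact: parameterized_integral_continuous (ltW ab) intf.
have [p0 p0ab] := rat_in_itvoo ab.
have Fp (p : rat) : a < ratr p < b -> F (ratr p) = F (ratr p0).
  move: p0ab; rewrite in_itv/= => /andP[ap0 p0b] /andP[ap pb].
  by have [h|h|->//] := ltgtP (ratr p : R) (ratr p0); [|apply/esym]; exact: FB.
(* If F x differed from the common value, continuity would separate the two on a ball around x, but
   this ball contains a rational point of ]a, b[. *)
have Fc x : a < x < b -> F x = F (ratr p0).
  move=> /andP[ax xb]; apply/eqP; rewrite -subr_eq0 -normr_eq0; apply/negPn/negP => h.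
  have e0 : 0 < `|F x - F (ratr p0)| by rewrite lt_neqAle eq_sym h normr_ge0.
  have cx : {for x, continuous F}.
    by apply: (within_continuous_continuous ab cF); rewrite in_itv /= ax.
  have : \forall y \near x, `|F x - F y| < `|F x - F (ratr p0)|.
    by move/cvgrPdist_lt : cx => /(_ _ e0).
  move=> /nbhs_ballP[r r0 hr].
  have : Num.max a (x - r) < Num.min b (x + r).
    have r0' : 0 < r by [].
    by rewrite lt_min !gt_max; apply/andP; split; apply/andP; split; lra.
  move=> /rat_in_itvoo[q]; rewrite in_itv /= gt_max lt_min => /andP[/andP[aq xq] /andP[qb qx]].
  have := hr (ratr q); rewrite Fp ?aq ?qb//.
  rewrite ltxx => /(_ _)/negP; apply => //.
  by rewrite /ball /= ltr_distlC xq qx.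
(* Lebesgue's differentiation theorem is applied to f extended by 0, which is integrable on every
   left half-line. *)
have intP y : leb.-integrable [set` Interval (BLeft a) (BRight y)]
    (EFin \o f \_ `[a, b]).
  rewrite -restrict_EFin; apply/integrable_restrict; [exact: measurable_itv..|].
  by apply: integrableS intf => //; apply: measurableI => //; exact: measurable_itv.
have /= f0 := FTC1 intP (integrable_locally mI intf).
(* The primitive is constant only in the open interval, so the two endpoints join the null set. *)
have fa : {ae leb, forall x, x != a}.
  exists [set a]; split => //; first exact: lebesgue_measure_set1.
  by move=> x /= /negP/negPn/eqP.
have fb : {ae leb, forall x, x != b}.
  exists [set b]; split => //; first exact: lebesgue_measure_set1.
  by move=> x /= /negP/negPn/eqP.
apply: filterS3 f0 fa fb; first exact: (ae_filter_ringOfSetsType leb).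
move=> x h xa xb; rewrite /= in_itv/= => /andP[ax bx].
have {ax}ax : a < x by rewrite lt_neqAle eq_sym xa.
have {bx}bx : x < b by rewrite lt_neqAle xb.
have [|_] := h; first by rewrite lte_fin.
rewrite patchE mem_setE in_itv /= !ltW//= => <-.
rewrite derive1E (@near_eq_derive _ _ _ _ (fun=> F (ratr p0))) ?derive_cst//.
near=> y.
have ay : a < y by near: y; exact: lt_nbhsr.
have yb : y < b by near: y; exact: lt_nbhsl.
rewrite -(Fc y) ?ay//; apply: eq_Rintegral => t /set_mem /=.
rewrite in_itv/= => /andP[at_ ty].
by rewrite patchE mem_setE in_itv/= at_ (le_trans ty)// ltW.
Unshelve. all: by end_near. Qed.

End test1.

Lemma ae_forall_count d (T : measurableType d) (R : realType)
    (mu : {measure set T -> \bar R}) (I : countType) (P : I -> T -> Prop) :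
  (forall i, {ae mu, forall x, P i x}) -> {ae mu, forall x, forall i, P i x}.
Proof.
move=> h.
have : {ae mu, forall x, forall n, if unpickle n is Some i then P i x else True}.
  apply/ae_foralln => n; case: (unpickle n) => [i|]; first exact: h.
  exact: aeW.
by apply: filterS => x hx i; have := hx (pickle i); rewrite pickleK.
Qed.

Lemma le_integrable_mul d (T : measurableType d) (R : realType)
    (mu : {measure set T -> \bar R}) (D : set T) (f h : T -> R) M :
  measurable D -> mu.-integrable D (EFin \o f) -> measurable_fun D h ->
  (forall x, D x -> `|h x| <= M) ->
  mu.-integrable D (EFin \o (fun x => f x * h x)).
Proof.
move=> mD intf mh hM.
apply: (le_integrable mD _ _ (integrableZl mD M intf)).
  apply/measurable_EFinP; apply: measurable_funM mh.
  by apply/measurable_EFinP; exact: measurable_int intf.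
move=> x Dx; rewrite /= lee_fin !normrM mulrC ler_wpM2r//.
by rewrite (le_trans (hM _ Dx))// ler_norm.
Qed.

Lemma Rintegral_lebesgue0 (R : realType) (a b : 'I_0 -> R) (h : 0.-tuple R -> R) :
  \int[lebesgueN R 0]_(t in box a b) h t = h [tuple].
Proof.
have -> : box a b = setT by apply/seteqP; split => // t _ [].
rewrite /Rintegral /= integral_dirac//=; first by rewrite indicE in_setT mul1r.
apply/measurable_EFinP => _ Y mY; rewrite setTI.
have [Y0|Y0] := pselect (Y (h [tuple])).
  by rewrite (_ : _ @^-1` _ = setT)//; apply/seteqP; split => // t _; rewrite (tuple0 t).
rewrite (_ : _ @^-1` _ = set0)//; apply/seteqP; split => // t.
by rewrite /preimage /= (tuple0 t).
Qed.

(** * Tensor products of tests and the fundamental lemma on a box *)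

Section tensor.
Context (R : realType).

Definition tensor N (phi : 'I_N -> R -> R) (s : N.-tuple R) : R :=
  \prod_(i < N) phi i (tnth s i).

Lemma tensor_upd N (phi : 'I_N -> R -> R) s i x :
  tensor phi (upd s i x) = (\prod_(j < N | j != i) phi j (tnth s j)) * phi i x.
Proof.
rewrite /tensor (bigD1 i)//= mulrC tnth_mktuple eqxx; congr (_ * _).
by apply: eq_bigr => j /negbTE ji; rewrite tnth_mktuple ji.
Qed.

Definition dtensor N (al : 'I_N -> nat) (phi : 'I_N -> R -> R) :=
  fun i => derive1n (al i) (phi i).

Lemma smooth1_dtensor N (al : 'I_N -> nat) (phi : 'I_N -> R -> R) :
  (forall i, smooth1 (phi i)) -> forall i, smooth1 (dtensor al phi i).
Proof. by move=> sp i; exact: smooth1_iter. Qed.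

Lemma is_derive_tensor N (phi : 'I_N -> R -> R) s i x :
  (forall i, smooth1 (phi i)) ->
  is_derive x (1 : R) (fun y => tensor phi (upd s i y))
    (tensor (dtensor (fun j => nat_of_bool (j == i)) phi) (upd s i x)).
Proof.
move=> sp; rewrite (_ : (fun y => _) =
  (\prod_(j < N | j != i) phi j (tnth s j)) \*: phi i); last first.
  by apply/funext => y; rewrite tensor_upd.
have /derivableP h : derivable (phi i) x 1 by exact: smooth1_derivable.
have := is_deriveZ (\prod_(j < N | j != i) phi j (tnth s j)) h.
rewrite tensor_upd /dtensor eqxx /= -derive1E.
congr (is_derive _ _ _ _); rewrite /GRing.scale /=; congr (_ * _).
by apply: eq_bigr => j /negbTE ->.
Qed.

Lemma upd_tnth N (s : N.-tuple R) i : upd s i (tnth s i) = s.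
Proof.
by apply: eq_from_tnth => j; rewrite tnth_mktuple; case: eqVneq => // ->.
Qed.

Lemma pderiv_tensor N (phi : 'I_N -> R -> R) i : (forall i, smooth1 (phi i)) ->
  pderiv i (tensor phi) = tensor (dtensor (fun j => nat_of_bool (j == i)) phi).
Proof.
move=> sp; apply/funext => s; rewrite /pderiv.
by have /is_derive1P[_ ->] := is_derive_tensor s i (tnth s i) sp; rewrite upd_tnth.
Qed.

Lemma dtensor_comp N al be (phi : 'I_N -> R -> R) :
  dtensor al (dtensor be phi) = dtensor (fun i => al i + be i)%N phi.
Proof. by apply/funext => i; rewrite /dtensor /derive1n -iterD. Qed.

Lemma foldr_pderiv_tensor N (phi : 'I_N -> R -> R) l : (forall i, smooth1 (phi i)) ->
  foldr (@pderiv R N) (tensor phi) l = tensor (dtensor (fun i => count_mem i l) phi).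
Proof.
move=> sp; elim: l => [//|i l IH] /=; rewrite IH pderiv_tensor; last first.
  exact: smooth1_dtensor.
by rewrite dtensor_comp; congr tensor; apply/funext => j; rewrite /dtensor eq_sym.
Qed.

Lemma mderiv_tensor N al (phi : 'I_N -> R -> R) : (forall i, smooth1 (phi i)) ->
  mderiv al (tensor phi) = tensor (dtensor al phi).
Proof.
move=> sp; rewrite /mderiv /comp_all.
have it k i psi : (forall i, smooth1 (psi i)) -> iter k (pderiv i) (tensor psi) =
    tensor (dtensor (fun j : 'I_N => (k * (j == i))%N) psi).
  move=> spsi; elim: k => [//|k IH]; rewrite iterS IH pderiv_tensor; last first.
    exact: smooth1_dtensor.
  by rewrite dtensor_comp.
(* The list has no repetition, so each coordinate is differentiated once, by [al i] steps. *)
have H (r : seq 'I_N) : uniq r ->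
    (\big[(fun f g => f \o g)/id]_(i <- r) iter (al i) (pderiv i)) (tensor phi) =
    tensor (dtensor (fun i => ((i \in r) * al i)%N) phi).
  elim: r => [_|i r IH /= /andP[ir ur]]; first by rewrite big_nil.
  rewrite big_cons /= IH// it; last exact: smooth1_dtensor.
  rewrite dtensor_comp; congr tensor; apply/funext => j; rewrite /dtensor inE.
  have [->|_] := eqVneq j i; first by rewrite (negbTE ir) muln1 mul1n addn0.
  by rewrite muln0.
rewrite H ?index_enum_uniq//; congr tensor; apply/funext => i; rewrite /dtensor.
by rewrite mem_index_enum mul1n.
Qed.

Lemma test_fun_tensor N (a b : 'I_N -> R) phi :
  (forall i, test1 (a i) (b i) (phi i)) -> test_fun a b (tensor phi).
Proof.
move=> tp; have sp i : smooth1 (phi i) by have [] := tp i.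
split=> [l /=|].
  rewrite foldr_pderiv_tensor//; split=> [|i s]; last first.
    by have [] := is_derive_tensor s i (tnth s i) (@smooth1_dtensor _ (fun i => count_mem i l) _ sp).
  rewrite /tensor; set psi := dtensor _ _.
  have spsi i : smooth1 (psi i) by exact: smooth1_dtensor.
  have H (r : seq 'I_N) :
      continuous (fun x : 'rV[R]_N => \prod_(i <- r) psi i (x ord0 i)).
    elim: r => [|i r IH].
      by under eq_fun do rewrite big_nil; exact: cst_continuous.
    under eq_fun do rewrite big_cons; move=> x.
    apply: (@continuousM _ _ (fun x : 'rV[R]_N => psi i (x ord0 i))); last exact: IH.
    apply: (@continuous_comp _ _ _ (fun x : 'rV[R]_N => x ord0 i) (psi i)).
      exact: coord_continuous.
    exact: smooth1_continuous.
  rewrite (_ : (fun x => _) = (fun x : 'rV[R]_N => \prod_i psi i (x ord0 i))).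
    exact: H.
  apply/funext => x.
  by apply: eq_bigr => i _; rewrite tnth_mktuple.
have /choice[e he] i : exists e, 0 < e /\
    forall x, phi i x != 0 -> a i + e <= x <= b i - e.
  by have [_ [e e0 he]] := tp i; exists e.
exists (\big[Num.min/1]_i e i).
  by apply: lt_bigmin => // i _; have [] := he i.
move=> s /prodf_neq0 h i; have [_ /(_ _ (h i isT))/andP[h1 h2]] := he i.
have le : \big[Num.min/1]_i e i <= e i by exact: bigmin_le_cond.
apply/andP; split; first by apply: le_trans h1; rewrite lerD2l.
by apply: le_trans h2 _; rewrite lerB.
Qed.

Lemma measurable_tensor N (phi : 'I_N -> R -> R) D : (forall i, smooth1 (phi i)) ->
  measurable_fun D (tensor phi).
Proof.
move=> sp; apply: measurable_funTS; apply: measurable_prod => i _.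
apply: (@measurableT_comp _ _ _ _ _ _ (phi i)); last exact: measurable_tnth.
exact: smooth1_measurable.
Qed.

Lemma tensor_bounded N (a b : 'I_N -> R) phi : (forall i, a i <= b i) ->
  (forall i, smooth1 (phi i)) ->
  exists M, forall s, box a b s -> `|tensor phi s| <= M.
Proof.
move=> ab sp.
have /choice[M hM] i : exists M, forall x, `[a i, b i]%classic x -> `|phi i x| <= M.
  exact: smooth1_bounded.
exists (\prod_i M i) => s sab; rewrite /tensor normr_prod; apply: ler_prod => i _.
by rewrite normr_ge0 hM//= in_itv /=.
Qed.

Lemma tensor_ins N (phi : 'I_N.+1 -> R -> R) i x (t : N.-tuple R) :
  tensor phi (@ins R N.+1 i x t) = phi i x * tensor (phi \o lift i) t.
Proof.
rewrite /tensor (bigD1_ord i)//= tnth_ins; congr (_ * _).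
by apply: eq_bigr => j _; rewrite tnth_ins_lift.
Qed.

Lemma integrable_tensor N (a b : 'I_N -> R) f phi : (forall i, a i <= b i) ->
  (forall i, smooth1 (phi i)) -> (lebesgueN R N).-integrable (box a b) (EFin \o f) ->
  (lebesgueN R N).-integrable (box a b) (EFin \o (fun s => f s * tensor phi s)).
Proof.
move=> ab sp intf; have [M hM] := tensor_bounded ab sp.
apply: le_integrable_mul hM => //; first exact: measurable_box.
exact: measurable_tensor.
Qed.

(** Induction on the dimension. For a fixed test in the first variable, the integral of f along that
    variable is orthogonal to all tensors in the other variables, hence vanishes almost everywhere;
    [fundamental1] then concludes on almost every line. *)
Lemma fundamentalN N (a b : 'I_N -> R) f : (forall i, a i < b i) ->
  (lebesgueN R N).-integrable (box a b) (EFin \o f) ->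
  (forall phi, (forall i, test1 (a i) (b i) (phi i)) ->
    \int[lebesgueN R N]_(s in box a b) (f s * tensor phi s) = 0) ->
  {ae lebesgueN R N, forall s, box a b s -> f s = 0}.
Proof.
elim: N => [|N IH] in a b f *.
  move=> _ intf /(_ (fun=> fun=> 0)) H.
  apply: aeW => /= s _; rewrite (tuple0 s).
  have <- : \int[lebesgueN R 0]_(s in box a b) (f s * tensor (fun=> fun=> 0) s) =
      f [tuple].
    by rewrite (Rintegral_lebesgue0 a b) /tensor big_ord0 mulr1.
  by apply: H => -[].
move=> ab intf H; pose i : 'I_N.+1 := ord0.
have ab' j : a j <= b j by exact: ltW.
have ablift j : (a \o lift i) j < (b \o lift i) j by exact: ab.
have key phi0 : test1 (a i) (b i) phi0 -> {ae lebesgueN R N, forall t,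
    box (a \o lift i) (b \o lift i) t ->
    \int[@lebesgue_measure R]_(x in `[a i, b i]) (f (@ins R N.+1 i x t) * phi0 x) = 0}.
  move=> t0; pose g s := f s * phi0 (tnth s i).
  have intg : (lebesgueN R N.+1).-integrable (box a b) (EFin \o g).
    have [M hM] := smooth1_bounded (ab' i) t0.1.
    apply: (@le_integrable_mul _ _ _ _ _ _ (fun s => phi0 (tnth s i)) M _ intf).
    - exact: measurable_box.
    - apply: measurable_funTS; apply: (@measurableT_comp _ _ _ _ _ _ phi0).
        exact: smooth1_measurable t0.1.
      exact: measurable_tnth.
    - by move=> s sab; apply: hM; rewrite /= in_itv /=.
  have gE t : \int[@lebesgue_measure R]_(x in `[a i, b i]) (f (@ins R N.+1 i x t) * phi0 x)
      = \int[@lebesgue_measure R]_(x in `[a i, b i]) g (@ins R N.+1 i x t).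
    by apply: eq_Rintegral => x _; rewrite /g tnth_ins.
  suff : {ae lebesgueN R N, forall t, box (a \o lift i) (b \o lift i) t ->
      \int[@lebesgue_measure R]_(x in `[a i, b i]) g (@ins R N.+1 i x t) = 0}.
    by apply: filterS => t h Ot; rewrite gE; exact: h.
  apply: IH => //; first exact: integrable_slice intg.
  move=> phi tphi.
  (* The tensor with factor phi0 in coordinate i and phi in the others: a test on the whole box. *)
  pose psi (j : 'I_N.+1) := oapp phi phi0 (unlift i j).
  have tpsi j : test1 (a j) (b j) (psi j).
    rewrite /psi; case: unliftP => [k ->|->] //=; exact: tphi.
  have := H _ tpsi.
  have sps j : smooth1 (psi j) by have [] := tpsi j.
  rewrite (Rintegral_slice i (integrable_tensor ab' sps intf)) => <-.
  have := ae_integrable_slice i intg.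
  have := integrable_slice i intg.
  move=> i1 i2.
  apply: ae_eq_Rintegral.
  - exact: measurable_box.
  - apply: measurable_funM; first by apply/measurable_EFinP; exact: measurable_int i1.
    by apply: measurable_tensor => j; have [] := tphi j.
  - have i3 := integrable_slice i (integrable_tensor ab' sps intf).
    by apply/measurable_EFinP; exact: measurable_int i3.
  apply: filterS i2 => t i2 Ot.
  rewrite -RintegralZr//; last exact: i2.
  apply: eq_Rintegral => x _; rewrite tensor_ins /psi unlift_none /= /g tnth_ins mulrA.
  congr (_ * _); congr tensor; apply/funext => j /=; by rewrite liftK.
(* The null set in [key] depends on the test; over rational endpoints and natural m these sets have
   a null union. *)
have key2 : {ae lebesgueN R N, forall t, forall z : rat * rat * nat,
    a i < ratr z.1.1 -> ratr z.1.2 < b i ->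
    box (a \o lift i) (b \o lift i) t ->
    \int[@lebesgue_measure R]_(x in `[a i, b i])
      (f (@ins R N.+1 i x t) * bump (ratr z.1.1) (ratr z.1.2) z.2 x) = 0}.
  apply: ae_forall_count => -[[p q] m] /=.
  have [ap|ap] := pselect (a i < ratr p); last exact: aeW.
  have [qb|qb] := pselect (ratr q < b i); last exact: aeW.
  by have := key _ (test1_bump m ap qb); apply: filterS => t h _ _.
apply: (@slice_ae R N a b i f (fun=> 0)) => //.
  by apply/measurable_EFinP; exact: measurable_int intf.
have := ae_integrable_slice i intf.
move: key2; apply: filterS2 => t h1 h2 Ot.
apply: fundamental1 => //; first exact: h2.
by move=> p q m ap pq qb; exact: (h1 (p, q, m)).
Qed.

End tensor.

Section integral_comparison.
Context d (T : measurableType d) (R : realType) (mu : {measure set T -> \bar R}).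
Variables (D : set T) (mD : measurable D).
Implicit Types f g : T -> R.

Lemma ae_le_Rintegral f g : mu.-integrable D (EFin \o f) ->
  mu.-integrable D (EFin \o g) -> {ae mu, forall x, D x -> f x <= g x} ->
  \int[mu]_(x in D) f x <= \int[mu]_(x in D) g x.
Proof.
move=> fi gi fg; rewrite -subr_ge0 -RintegralB//.
have mf : measurable_fun D f by apply/measurable_EFinP; exact: measurable_int fi.
have mg : measurable_fun D g by apply/measurable_EFinP; exact: measurable_int gi.
have mB : measurable_fun D (fun x => g x - f x) by exact: measurable_funB.
rewrite (@ae_eq_Rintegral _ _ _ _ _ _ (fun x => `|g x - f x|))//.
- by apply: Rintegral_ge0 => x _; exact: normr_ge0.
- exact: measurableT_comp.
- by apply: filterS fg => x fg Dx; rewrite ger0_norm// subr_ge0 fg.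
Qed.

Lemma ae_le_integrable f g : measurable_fun D f -> mu.-integrable D (EFin \o g) ->
  {ae mu, forall x, D x -> `|f x| <= g x} -> mu.-integrable D (EFin \o f).
Proof.
move=> mf /integrableP[mg goo] fg; apply/integrableP; split.
  exact/measurable_EFinP.
apply: le_lt_trans goo; apply: ae_ge0_le_integral => //.
- by apply: measurableT_comp => //; exact/measurable_EFinP.
- exact: measurableT_comp.
- apply: filterS fg => x fg Dx; rewrite /= lee_fin (le_trans (fg Dx))//.
  exact: ler_norm.
Qed.

End integral_comparison.

Lemma integrable_tensor2 d1 d2 (T1 : measurableType d1) (T2 : measurableType d2)
    (R : realType) (m1 : {sigma_finite_measure set T1 -> \bar R})
    (m2 : {sigma_finite_measure set T2 -> \bar R}) (D1 : set T1) (D2 : set T2)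
    (g : T1 -> R) (f : T2 -> R) :
  measurable D1 -> measurable D2 ->
  m1.-integrable D1 (EFin \o g) -> m2.-integrable D2 (EFin \o f) ->
  (m1 \x m2)%E.-integrable (D1 `*` D2) (EFin \o (fun z => g z.1 * f z.2)).
Proof.
move=> mD1 mD2 gi fi.
pose g' := g \_ D1; pose f' := f \_ D2.
have gi' : m1.-integrable setT (EFin \o g').
  by rewrite -restrict_EFin; apply/(integrable_mkcond _ mD1).
have fi' : m2.-integrable setT (EFin \o f').
  by rewrite -restrict_EFin; apply/(integrable_mkcond _ mD2).
have mg' : measurable_fun setT g' by apply/measurable_EFinP; exact: measurable_int gi'.
have mf' : measurable_fun setT f' by apply/measurable_EFinP; exact: measurable_int fi'.
have mD : measurable (D1 `*` D2) by exact: measurableX.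
apply/(integrable_mkcond _ mD).
rewrite (_ : _ \_ _ = EFin \o (fun z => g' z.1 * f' z.2)); last first.
  apply/funext => -[x y]; rewrite /g' /f' /= !patchE in_setX /=.
  by case: (x \in D1); case: (y \in D2); rewrite ?mul0r ?mulr0.
have m : measurable_fun setT (EFin \o (fun z : T1 * T2 => g' z.1 * f' z.2)).
  apply/measurable_EFinP; apply: measurable_funM.
    exact: measurableT_comp mg' measurable_fst.
  exact: measurableT_comp mf' measurable_snd.
apply/(integrable12ltyP m1 m2 m).
have /integrableP[_ goo] := gi'; have /integrableP[_ foo] := fi'.
have e (x : T1) : (\int[m2]_y `|(EFin \o (fun z => g' z.1 * f' z.2)%R) (x, y)| =
    `|g' x|%:E * \int[m2]_y `|(EFin \o f') y|)%E.
  rewrite -ge0_integralZl//; first by apply: eq_integral => y _ /=; rewrite normrM.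
  by apply: measurableT_comp => //; exact/measurable_EFinP.
under eq_integral do rewrite e.
rewrite ge0_integralZr//; last 2 first.
- by apply/measurable_EFinP; exact: measurableT_comp.
- exact: integral_ge0.
by apply: lte_mul_pinfty => //; [exact: integral_ge0|rewrite ge0_fin_numE// integral_ge0].
Qed.

(** * Integral operators along one coordinate *)

Section kernel1.
Context (R : realType) (a b : R).
Hypothesis ab : a <= b.
Local Notation leb := (@lebesgue_measure R).
Local Notation Rm := (measurableTypeR R).
Local Notation I := (`[a, b]%classic : set Rm).

Let mI : measurable I. Proof. exact: measurable_itv. Qed.

Lemma leb_itvE : leb I = (b - a)%:E.
Proof.
rewrite lebesgue_measure_itv /= lte_fin -EFinB.
by case: ltP => // h; have -> : a = b by [apply/eqP; rewrite eq_le ab h];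
  rewrite subrr.
Qed.

Lemma leb_itv_fin : (leb I < +oo)%E.
Proof. by rewrite leb_itvE ltry. Qed.

Lemma Rintegral_itv_cst (c : R) : \int[leb]_(x in I) c = c * (b - a).
Proof. by rewrite Rintegral_cst//; congr (_ * _); exact: (congr1 fine leb_itvE). Qed.

Variables (ka : Rm * Rm -> R) (M : R).
Hypotheses (mka : measurable_fun setT ka)
  (kaM : forall x y, I x -> I y -> `|ka (x, y)| <= M).

Lemma kernel1_bound f x : sqint leb I f -> I x ->
  (\int[leb]_(th in I) (ka (x, th) * f th)) ^+ 2 <= M ^+ 2 * (b - a) * ip leb I f f.
Proof.
move=> sf Ix.
have mk : measurable_fun I (fun th => ka (x, th)).
  apply: measurable_funTS; apply: measurableT_comp mka _.
  exact: measurable_fun_pair.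
have sk : sqint leb I (fun th => ka (x, th)).
  by apply: (sqint_bounded mI leb_itv_fin mk) => y Iy; exact: kaM.
apply: le_trans (ip_cs mI sk sf) _; rewrite ler_wpM2r ?ip_ge0//.
rewrite -Rintegral_itv_cst; apply: le_Rintegral => //.
- exact: sqint_mul.
- exact: (sqint_integrable mI leb_itv_fin (sqint_cst mI leb_itv_fin _)).
- move=> y Iy; have := kaM Ix Iy; rewrite ler_norml => /andP[h1 h2]; nra.
Qed.

(** Fubini for the product of g x, f th and the kernel: on a bounded interval square-integrable
    functions are integrable, and the kernel is bounded. *)
Lemma kernel1_adjoint f g : sqint leb I f -> sqint leb I g ->
  \int[leb]_(x in I) ((\int[leb]_(th in I) (ka (x, th) * f th)) * g x) =
  \int[leb]_(th in I) (f th * \int[leb]_(x in I) (ka (x, th) * g x)).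
Proof.
move=> sf sg.
have fi := sqint_integrable mI leb_itv_fin sf.
have gi := sqint_integrable mI leb_itv_fin sg.
pose H (z : Rm * Rm) := (g z.1 * f z.2) * ka z.
have Hi : (leb \x leb)%E.-integrable (I `*` I) (EFin \o H).
  apply: (@le_integrable_mul _ _ _ _ _ _ _ M _ (integrable_tensor2 mI mI gi fi)).
  - exact: measurableX.
  - exact: measurable_funTS.
  - by move=> [x y] [/= Ix Iy]; exact: kaM.
have ki c y h : sqint leb I h -> I y -> leb.-integrable I (EFin \o (fun x => c * (ka (x, y) * h x))).
  move=> [mh ih] Iy.
  have hi := sqint_integrable mI leb_itv_fin (conj mh ih).
  have mk : measurable_fun I (fun th => ka (th, y)).
    apply: measurable_funTS; apply: measurableT_comp mka _.
    exact: measurable_fun_pair.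
  have := le_integrable_mul mI hi mk (fun x Ix => kaM Ix Iy).
  move=> /(integrableZl mI c); apply: eq_integrable => // x _ /=.
  by rewrite (mulrC (h x)).
have ki' c y h : sqint leb I h -> I y -> leb.-integrable I (EFin \o (fun x => c * (ka (y, x) * h x))).
  move=> [mh ih] Iy.
  have hi := sqint_integrable mI leb_itv_fin (conj mh ih).
  have mk : measurable_fun I (fun th => ka (y, th)).
    apply: measurable_funTS; apply: measurableT_comp mka _.
    exact: measurable_fun_pair.
  have := le_integrable_mul mI hi mk (fun x Ix => kaM Iy Ix).
  move=> /(integrableZl mI c); apply: eq_integrable => // x _ /=.
  by rewrite (mulrC (h x)).
transitivity (\int[(leb \x leb)%E]_(z in I `*` I) H z).
  rewrite Rintegral_rect1//; apply: eq_Rintegral => x /set_mem Ix.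
  rewrite -RintegralZr//; last first.
    have := ki' 1 x _ sf Ix; apply: eq_integrable => // y _ /=; by rewrite mul1r.
  by apply: eq_Rintegral => y _; rewrite /H /=; ring.
rewrite Rintegral_rect2//; apply: eq_Rintegral => y /set_mem Iy.
rewrite -RintegralZl//; last first.
  have := ki 1 y _ sg Iy; apply: eq_integrable => // x _ /=; by rewrite mul1r.
by apply: eq_Rintegral => x _; rewrite /H /=; ring.
Qed.

End kernel1.

Section good_operator.
Context (R : realType) (N : nat) (a b : 'I_N -> R).
Local Notation mu := (lebesgueN R N).
Local Notation Om := (box a b).
Local Notation sfun := (N.-tuple R -> R).
Local Notation sq := (sqint mu Om).
Local Notation ip := (ip mu Om).

Let mOm : measurable Om := measurable_box a b.

(** The adjoint G is carried along, with its stability on L_2, because [adjoint] is meaningful only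
    once some adjoint exists. The class is closed under composition, which covers Kronecker products
    of basis operators. *)
Definition goodS (F : sfun -> sfun) : Prop := exists G C, [/\ 0 <= C,
  forall v, sq v -> sq (F v),
  forall v, sq v -> sq (G v),
  forall v, sq v -> ip (F v) (F v) <= C * ip v v &
  forall u v, sq u -> sq v -> ip (F u) v = ip u (G v)].

Lemma goodS_id : goodS id.
Proof. by exists id, 1; split => // v sv; rewrite mul1r. Qed.

Lemma goodS_comp F1 F2 : goodS F1 -> goodS F2 -> goodS (F1 \o F2).
Proof.
move=> [G1 [C1 [C10 F1L G1L F1b F1a]]] [G2 [C2 [C20 F2L G2L F2b F2a]]].
exists (G2 \o G1), (C1 * C2); split; first exact: mulr_ge0.
- by move=> v sv; apply/F1L/F2L.
- by move=> v sv; apply/G2L/G1L.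
- move=> v sv /=; rewrite (le_trans (F1b _ (F2L _ sv)))// -mulrA ler_wpM2l//.
  exact: F2b.
- by move=> u v su sv /=; rewrite F1a ?F2a//; [exact: G1L|exact: F2L].
Qed.

Lemma goodS_zero : goodS (fun _ _ => 0).
Proof.
exists (fun _ _ => 0), 0.
have z v : ip (fun=> 0) v = 0.
  rewrite /ip (_ : (fun x => _) = fun=> 0); first by rewrite Rintegral_cst// mul0r.
  by apply/funext => x; rewrite mul0r.
split => //; try by move=> v _; exact: sqint0.
- by move=> v _; rewrite z mul0r.
- by move=> u v _ _; rewrite z ipC z.
Qed.

Lemma goodS_mul (h : sfun) M : measurable_fun Om h ->
  (forall s, Om s -> `|h s| <= M) -> goodS (fun v s => h s * v s).
Proof.
move=> mh hM; exists (fun v s => h s * v s), (M ^+ 2); split => //.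
- exact: sqr_ge0.
- by move=> v; exact: (sqint_bmul mOm mh hM).
- by move=> v; exact: (sqint_bmul mOm mh hM).
- move=> v sv; have sv2 := sqint_mul mOm sv sv.
  rewrite /ip -RintegralZl//; apply: le_Rintegral => //.
  + by apply: sqint_mul => //; exact: (sqint_bmul mOm mh hM).
  + exact: (integrableZl mOm _ sv2).
  + move=> s Os; have -> : h s * v s * (h s * v s) = h s ^+ 2 * (v s * v s) by ring.
    rewrite ler_wpM2r -?expr2 ?sqr_ge0//.
    by have := hM _ Os; rewrite ler_norml => /andP[? ?]; nra.
- by move=> u v su sv; apply: eq_Rintegral => s _; ring.
Qed.

Lemma eq_goodS F F' : (forall v s, Om s -> F v s = F' v s) -> goodS F -> goodS F'.
Proof.
move=> FF' [G [C [C0 FL GL Fb Fa]]]; exists G, C; split => //.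
- by move=> v sv; apply: eq_sqint (FL v sv) => // s; exact: FF'.
- by move=> v sv; rewrite -(eq_ip _ (FF' v) (FF' v)); exact: Fb.
- by move=> u v su sv; rewrite -Fa//; apply: eq_ip => // s Os; rewrite FF'.
Qed.

End good_operator.

Section kernel_operator.
Context (R : realType) (N : nat) (a b : 'I_N.+1 -> R) (i : 'I_N.+1).
Hypothesis ab : a i <= b i.
Local Notation mu := (lebesgueN R N.+1).
Local Notation mu' := (lebesgueN R N).
Local Notation leb := (@lebesgue_measure R).
Local Notation Om := (box a b).
Local Notation Om' := (box (a \o lift i) (b \o lift i)).
Local Notation Rm := (measurableTypeR R).
Local Notation I := (`[a i, b i]%classic : set Rm).
Local Notation ins x t := (@ins R N.+1 i x t).

Let mI : measurable I. Proof. exact: measurable_itv. Qed.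
Let mOm : measurable Om := measurable_box a b.
Let mOm' : measurable Om' := measurable_box (a \o lift i) (b \o lift i).

Lemma sqint_slice v : sqint mu Om v ->
  {ae mu', forall t, Om' t -> sqint leb I (fun x => v (ins x t))}.
Proof.
move=> [mv iv]; have := ae_integrable_slice i iv.
apply: filterS => t h Ot; split; last exact: h.
exact: (measurable_slice mv Ot).
Qed.

Lemma insp_integrable (f : N.+1.-tuple R -> R) : measurable_fun Om f ->
  (leb \x mu')%E.-integrable (I `*` Om') (EFin \o (fun p => f (insp i p))) ->
  mu.-integrable Om (EFin \o f).
Proof.
move=> mf /integrableP[_ ioo]; apply/integrableP; split.
  exact/measurable_EFinP.
rewrite (ge0_integral_insp i)//.
by apply: measurableT_comp => //; exact/measurable_EFinP.
Qed.

Lemma measurable_fun_upd (F : N.+1.-tuple R -> R) : measurable_fun Om F ->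
  measurable_fun (Om `*` I) (fun p : N.+1.-tuple R * Rm => F (upd p.1 i p.2)).
Proof.
move=> mF; apply: (measurable_comp mOm _ mF).
  move=> _ [[s x] [/= Os Ix] <-]; move: Ix.
  by rewrite /= in_itv /=; exact: box_upd.
exact: measurable_funTS (measurable_updp i).
Qed.

(** A variable endpoint of integration is encoded by an indicator inside the kernel. The domain of
    integration is then fixed, and transposing the kernel gives the adjoint. *)
Definition kop (ka : Rm * Rm -> R) (v : N.+1.-tuple R -> R) (s : N.+1.-tuple R) : R :=
  \int[leb]_(th in I) (ka (tnth s i, th) * v (upd s i th)).

Lemma kop_ins ka v x t : kop ka v (ins x t) =
  \int[leb]_(th in I) (ka (x, th) * v (ins th t)).
Proof. by apply: eq_Rintegral => th _; rewrite tnth_ins upd_ins. Qed.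

Lemma measurable_kop ka v : measurable_fun setT ka -> measurable_fun Om v ->
  measurable_fun Om (kop ka v).
Proof.
move=> mka mv.
apply: (@measurable_Rintegral_param _ _ _ _ _ leb Om I
  (fun p => ka (tnth p.1 i, p.2) * v (upd p.1 i p.2))) => //.
apply: measurable_funM; last exact: measurable_fun_upd.
apply: measurable_funTS; apply: (measurableT_comp mka).
apply: measurable_fun_pair => /=; last exact: measurable_snd.
apply: (@measurableT_comp _ _ _ _ _ _ (fun s => tnth s i)) => //.
exact: measurable_tnth.
Qed.

Variables (ka : Rm * Rm -> R) (M : R).
Hypotheses (mka : measurable_fun setT ka)
  (kaM : forall x y, I x -> I y -> `|ka (x, y)| <= M).

(** The line through s depends only on the coordinates other than i, so the exceptional set is the
    cylinder over a null set of lines. *)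
Lemma ae_sqint_upd v : sqint mu Om v ->
  {ae mu, forall s, Om s -> sqint leb I (fun th => v (upd s i th))}.
Proof.
move=> sv; have [A [mA A0 hA]] := sqint_slice sv.
pose tl (s : N.+1.-tuple R) := [tuple tnth s (lift i j) | j < N].
have mtl : measurable_fun setT tl.
  apply: measurable_fun_tuple => j; under eq_fun do rewrite tnth_mktuple.
  exact: measurable_tnth.
have mtlA : measurable (tl @^-1` A).
  by rewrite -[X in measurable X]setTI; exact: mtl.
have tlK x t : tl (ins x t) = t.
  by apply: eq_from_tnth => j; rewrite tnth_mktuple tnth_ins_lift.
exists (tl @^-1` A); split => //.
  rewrite (lebesgueN_ins i)//.
  apply/(ae_xsection leb mu').
    rewrite -[X in measurable X]setTI.
    exact: (measurable_insp i : measurable_fun setT (fun p : Rm * N.-tuple R => insp i p)).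
  apply: aeW => x; rewrite (_ : xsection _ _ = A)//.
  by apply/seteqP; split => t; rewrite xsectionE /preimage /= /insp /= tlK.
move=> s /= /not_implyP[Os ns]; apply: hA => /=; apply/not_implyP.
have sE := ins_split i s; rewrite -/(tl s) in sE; split.
  by have := Os; rewrite {1}sE => /box_ins[].
move=> h; apply: ns; rewrite (_ : (fun th => _) = (fun x => v (ins x (tl s))))//.
by apply/funext => th; rewrite {1}sE upd_ins.
Qed.

(** By Cauchy-Schwarz on the line through s, the square is dominated by a multiple of the integral
    of v^2 over that line. This majorant is constant in s_i and integrable in the other variables,
    hence integrable on the box. *)
Lemma sqint_kop v : sqint mu Om v -> sqint mu Om (kop ka v).
Proof.
move=> sv; have mk := measurable_kop mka sv.1; split => //.
pose C := M ^+ 2 * (b i - a i).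
pose H s := C * \int[leb]_(th in I) (v (upd s i th) * v (upd s i th)).
apply: (@ae_le_integrable _ _ _ _ _ _ _ H) => //.
- exact: measurable_funX.
- have mvv : measurable_fun Om (fun s => v s * v s) by apply: measurable_funM; exact: sv.1.
  apply: insp_integrable.
    apply: measurable_funM => //.
    apply: (@measurable_Rintegral_param _ _ _ _ _ leb Om I
      (fun p => v (upd p.1 i p.2) * v (upd p.1 i p.2))) => //.
    exact: (@measurable_fun_upd (fun s => v s * v s)).
  have i1 := integrable_slice i (sqint_mul mOm sv sv).
  have i2 := sqint_integrable mI (leb_itv_fin ab) (sqint_cst mI (leb_itv_fin ab) C).
  have := integrable_tensor2 mI mOm' i2 i1.
  apply: eq_integrable; first exact: measurableX.
  move=> [x t] _ /=; congr (_ * _)%:E; apply: eq_Rintegral => th _.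
  by rewrite /insp upd_ins.
- have := ae_sqint_upd sv; apply: filterS => s hs Os.
  rewrite ger0_norm ?sqr_ge0//.
  apply: (kernel1_bound ab mka kaM (hs Os)).
  by have := Os i; rewrite /= in_itv.
Qed.

(** One factor b_i - a_i comes from Cauchy-Schwarz on a line, the other from integrating the
    resulting constant along that line. *)
Lemma kop_bound v : sqint mu Om v -> ip mu Om (kop ka v) (kop ka v) <=
  (M ^+ 2 * (b i - a i) * (b i - a i)) * ip mu Om v v.
Proof.
move=> sv; have sk := sqint_kop sv.
have iv := sqint_mul mOm sv sv; have ik := sqint_mul mOm sk sk.
rewrite /ip (Rintegral_slice i ik) (Rintegral_slice i iv) -RintegralZl//; last first.
  exact: integrable_slice iv.
apply: ae_le_Rintegral => //.
- exact: integrable_slice ik.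
- have /(integrableZl mOm' (M ^+ 2 * (b i - a i) * (b i - a i))) := integrable_slice i iv.
  by apply: eq_integrable.
have := sqint_slice sv; have := sqint_slice sk; apply: filterS2 => t skt svt Ot.
set B := M ^+ 2 * (b i - a i).
rewrite -mulrA (mulrC (b i - a i)) mulrA -(Rintegral_itv_cst ab).
apply: le_Rintegral => //.
- by apply: sqint_mul => //; exact: skt.
- exact: (sqint_integrable mI (leb_itv_fin ab) (sqint_cst mI (leb_itv_fin ab) _)).
move=> x Ix; rewrite -expr2 kop_ins; exact: (kernel1_bound ab mka kaM (svt Ot) Ix).
Qed.

End kernel_operator.

Section kernel_good.
Context (R : realType) (N : nat) (a b : 'I_N.+1 -> R) (i : 'I_N.+1).
Hypothesis ab : a i <= b i.
Local Notation Rm := (measurableTypeR R).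
Local Notation I := (`[a i, b i]%classic : set Rm).
Variables (ka : Rm * Rm -> R) (M : R).
Hypotheses (mka : measurable_fun setT ka)
  (kaM : forall x y, I x -> I y -> `|ka (x, y)| <= M).

Let kb (p : Rm * Rm) := ka (p.2, p.1).

Let mkb : measurable_fun setT kb.
Proof.
apply: measurableT_comp mka _.
by apply: measurable_fun_pair; [exact: measurable_snd|exact: measurable_fst].
Qed.

Let kbM x y : I x -> I y -> `|kb (x, y)| <= M. Proof. by move=> Ix Iy; exact: kaM. Qed.

(** Fubini reduces the pairing to lines, where [kernel1_adjoint] transposes the kernel. *)
Lemma kop_adjoint u v :
  sqint (lebesgueN R N.+1) (box a b) u -> sqint (lebesgueN R N.+1) (box a b) v ->
  ip (lebesgueN R N.+1) (box a b) (kop a b i ka u) v =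
  ip (lebesgueN R N.+1) (box a b) u (kop a b i (fun p => ka (p.2, p.1)) v).
Proof.
move=> su sv; have mOm := measurable_box a b.
have sku := sqint_kop ab mka kaM su; have skv := sqint_kop ab mkb kbM sv.
have i1 := sqint_mul mOm sku sv; have i2 := sqint_mul mOm su skv.
rewrite /ip (Rintegral_slice i i1) (Rintegral_slice i i2).
apply: ae_eq_Rintegral.
- exact: measurable_box.
- by apply/measurable_EFinP; apply: measurable_int (integrable_slice i i1).
- by apply/measurable_EFinP; apply: measurable_int (integrable_slice i i2).
have := sqint_slice i su; have := sqint_slice i sv; apply: filterS2 => t svt sut Ot.
transitivity (\int[@lebesgue_measure R]_(x in I)
  ((\int[@lebesgue_measure R]_(th in I) (ka (x, th) * u (@ins R N.+1 i th t))) *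
    v (@ins R N.+1 i x t))).
  by apply: eq_Rintegral => x _; rewrite kop_ins.
rewrite (kernel1_adjoint ab mka kaM (sut Ot) (svt Ot)).
by apply: eq_Rintegral => x _; rewrite kop_ins.
Qed.

Lemma goodS_kop : goodS a b (kop a b i ka).
Proof.
exists (kop a b i kb), (M ^+ 2 * (b i - a i) * (b i - a i)); split.
- by rewrite mulr_ge0 ?subr_ge0// mulr_ge0 ?subr_ge0// sqr_ge0.
- by move=> v; exact: (sqint_kop ab mka kaM).
- by move=> v; exact: (sqint_kop ab mkb kbM).
- by move=> v; exact: (kop_bound ab mka kaM).
- exact: kop_adjoint.
Qed.

End kernel_good.

Lemma Rintegral_sum d (T : measurableType d) (R : realType)
    (mu : {measure set T -> \bar R}) (D : set T) I (r : seq I) (F : I -> T -> R) :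
  measurable D -> (forall i, mu.-integrable D (EFin \o F i)) ->
  \int[mu]_(x in D) (\sum_(i <- r) F i x) = \sum_(i <- r) \int[mu]_(x in D) F i x.
Proof.
move=> mD iF.
have h (s : seq I) : mu.-integrable D (EFin \o (fun x => \sum_(i <- s) F i x)).
  elim: s => [|i s IH].
    apply: (eq_integrable _ (cst 0%E)) => //; last exact: integrable0.
    by move=> x _ /=; rewrite big_nil.
  have := integrableD mD (iF i) IH; apply: eq_integrable => // x _ /=.
  by rewrite big_cons.
elim: r => [|i r IH].
  rewrite big_nil -[RHS](@mul0r _ (fine (mu D))) -Rintegral_cst//.
  by apply: eq_Rintegral => x _; rewrite big_nil.
rewrite big_cons -IH -RintegralD//.
by apply: eq_Rintegral => x _; rewrite big_cons.
Qed.

(** * Vector-valued L_2 and bounded operators with an adjoint *)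

Section vector_L2.
Context (R : realType) (N : nat) (a b : 'I_N -> R).
Local Notation mu := (lebesgueN R N).
Local Notation Om := (box a b).
Local Notation sq := (sqint mu Om).
Local Notation vfun n := (N.-tuple R -> 'cV[R]_n).

Let mOm : measurable Om := measurable_box a b.

Definition cmp n (u : vfun n) (k : 'I_n) : N.-tuple R -> R := fun s => u s k 0.

Lemma L2P n (u : vfun n) : L2 a b u <-> forall k, sq (cmp u k).
Proof. by []. Qed.

Lemma dotL2E n (u v : vfun n) : L2 a b u -> L2 a b v ->
  dotL2 a b u v = \sum_k ip mu Om (cmp u k) (cmp v k).
Proof.
move=> su sv; rewrite /dotL2 Rintegral_sum// => k.
by apply: (sqint_mul mOm); [exact: su|exact: sv].
Qed.

Lemma L2D n (u v : vfun n) : L2 a b u -> L2 a b v -> L2 a b (fun s => u s + v s).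
Proof.
move=> su sv k; apply: (eq_sqint mOm _ (sqintD mOm (su k) (sv k))) => // s _.
by rewrite mxE.
Qed.

Lemma L2Z n c (u : vfun n) : L2 a b u -> L2 a b (fun s => c *: u s).
Proof.
move=> su k; apply: (eq_sqint mOm _ (sqintZ mOm c (su k))) => // s _.
by rewrite mxE.
Qed.

Lemma L2_0 n : L2 a b (fun=> 0 : 'cV[R]_n).
Proof. by move=> k; apply: (@eq_sqint _ _ _ mu _ mOm (fun=> 0)); [move=> s _; rewrite mxE|exact: sqint0]. Qed.

Lemma L2N n (u : vfun n) : L2 a b u -> L2 a b (fun s => - u s).
Proof. by move=> /(L2Z (-1)); under eq_fun do rewrite scaleN1r. Qed.

Lemma L2B n (u v : vfun n) : L2 a b u -> L2 a b v -> L2 a b (fun s => u s - v s).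
Proof. by move=> su /L2N; exact: L2D. Qed.

Lemma dotL2C n (u v : vfun n) : dotL2 a b u v = dotL2 a b v u.
Proof.
by apply: eq_Rintegral => s _; apply: eq_bigr => k _; rewrite mulrC.
Qed.

Lemma dotL2Dl n (u v w : vfun n) : L2 a b u -> L2 a b v -> L2 a b w ->
  dotL2 a b (fun s => u s + v s) w = dotL2 a b u w + dotL2 a b v w.
Proof.
move=> su sv sw; rewrite !dotL2E//; last exact: L2D.
rewrite -big_split; apply: eq_bigr => k _; apply: (etrans _ (ipDl mOm (su k) (sv k) (sw k))).
by apply: eq_ip => // s _; rewrite /cmp mxE.
Qed.

Lemma dotL2Zl n c (u w : vfun n) : L2 a b u -> L2 a b w ->
  dotL2 a b (fun s => c *: u s) w = c * dotL2 a b u w.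
Proof.
move=> su sw; rewrite !dotL2E//; last exact: L2Z.
rewrite mulr_sumr; apply: eq_bigr => k _; apply: (etrans _ (ipZl mOm c (su k) (sw k))).
by apply: eq_ip => // s _; rewrite /cmp mxE.
Qed.

Lemma dotL2Nl n (u w : vfun n) : L2 a b u -> L2 a b w ->
  dotL2 a b (fun s => - u s) w = - dotL2 a b u w.
Proof.
by move=> su sw; rewrite -mulN1r -dotL2Zl//; under eq_fun do rewrite -scaleN1r.
Qed.

Lemma dotL2Bl n (u v w : vfun n) : L2 a b u -> L2 a b v -> L2 a b w ->
  dotL2 a b (fun s => u s - v s) w = dotL2 a b u w - dotL2 a b v w.
Proof. by move=> su sv sw; rewrite dotL2Dl ?dotL2Nl//; exact: L2N. Qed.

Lemma dotL2Dr n (u v w : vfun n) : L2 a b u -> L2 a b v -> L2 a b w ->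
  dotL2 a b w (fun s => u s + v s) = dotL2 a b w u + dotL2 a b w v.
Proof. by move=> su sv sw; rewrite dotL2C dotL2Dl// !(dotL2C _ w). Qed.

Lemma dotL2Zr n c (u w : vfun n) : L2 a b u -> L2 a b w ->
  dotL2 a b w (fun s => c *: u s) = c * dotL2 a b w u.
Proof. by move=> su sw; rewrite dotL2C dotL2Zl// dotL2C. Qed.

Lemma dotL2Br n (u v w : vfun n) : L2 a b u -> L2 a b v -> L2 a b w ->
  dotL2 a b w (fun s => u s - v s) = dotL2 a b w u - dotL2 a b w v.
Proof. by move=> su sv sw; rewrite dotL2C dotL2Bl// !(dotL2C _ w). Qed.

Lemma dotL2_ge0 n (u : vfun n) : 0 <= dotL2 a b u u.
Proof.
apply: Rintegral_ge0 => s _; apply: sumr_ge0 => k _; rewrite -expr2; exact: sqr_ge0.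
Qed.

Lemma dotL2_cs n (u v : vfun n) : L2 a b u -> L2 a b v ->
  dotL2 a b u v ^+ 2 <= dotL2 a b u u * dotL2 a b v v.
Proof.
move=> su sv; apply: discr_le => c c'.
have scu := L2Z c su; have scv := L2Z c' sv.
have := dotL2_ge0 (fun s => c *: u s + c' *: v s).
rewrite dotL2Dl//; last exact: L2D.
rewrite !dotL2Dr// !dotL2Zl// !dotL2Zr// (dotL2C v u).
by move=> /le_trans; apply; rewrite le_eqVlt; apply/orP; left; apply/eqP; ring.
Qed.

Lemma normL2_ge0 n (u : vfun n) : 0 <= normL2 a b u.
Proof. exact: sqrtr_ge0. Qed.

Lemma normL2_sqr n (u : vfun n) : normL2 a b u ^+ 2 = dotL2 a b u u.
Proof. by rewrite sqr_sqrtr// dotL2_ge0. Qed.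

Lemma normL2_cs n (u v : vfun n) : L2 a b u -> L2 a b v ->
  `|dotL2 a b u v| <= normL2 a b u * normL2 a b v.
Proof.
move=> su sv; rewrite -(ger0_norm (mulr_ge0 (normL2_ge0 u) (normL2_ge0 v))).
rewrite -ler_sqr ?nnegrE// !real_normK ?num_real// exprMn !normL2_sqr.
exact: dotL2_cs.
Qed.

Lemma normL2_triangle n (u v : vfun n) : L2 a b u -> L2 a b v ->
  normL2 a b (fun s => u s + v s) <= normL2 a b u + normL2 a b v.
Proof.
move=> su sv; rewrite -ler_sqr ?nnegrE ?addr_ge0 ?normL2_ge0//.
rewrite sqrrD !normL2_sqr dotL2Dl//; last exact: L2D.
rewrite !dotL2Dr// (dotL2C v u).
have := normL2_cs su sv => /(le_trans (ler_norm _)); lra.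
Qed.

Lemma normL2Z n c (u : vfun n) : L2 a b u ->
  normL2 a b (fun s => c *: u s) = `|c| * normL2 a b u.
Proof.
move=> su; rewrite /normL2 dotL2Zl//; last exact: L2Z.
by rewrite dotL2Zr// mulrA -expr2 sqrtrM ?sqr_ge0// sqrtr_sqr.
Qed.

Lemma eq_ae_cmp n (u v : vfun n) : eq_ae a b u v <->
  forall k, {ae mu, forall s, Om s -> cmp u k s = cmp v k s}.
Proof.
split=> [h k|h]; first by apply: filterS h => s h Os; rewrite /cmp h.
have := ae_forall_count h; apply: filterS => s hs Os.
by apply/colP => k; exact: hs.
Qed.

Lemma eq_ae_refl n (u : vfun n) : eq_ae a b u u.
Proof. exact: aeW. Qed.

Lemma eq_ae_sym n (u v : vfun n) : eq_ae a b u v -> eq_ae a b v u.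
Proof. by apply: filterS => s h Os; rewrite h. Qed.

Lemma eq_ae_trans n (u v w : vfun n) :
  eq_ae a b u v -> eq_ae a b v w -> eq_ae a b u w.
Proof. by apply: filterS2 => s h1 h2 Os; rewrite h1 ?h2. Qed.

Lemma eq_ae_dotL2 n (u u' w : vfun n) : L2 a b u -> L2 a b u' -> L2 a b w ->
  eq_ae a b u u' -> dotL2 a b u w = dotL2 a b u' w.
Proof.
move=> su su' sw /eq_ae_cmp h; rewrite !dotL2E//; apply: eq_bigr => k _.
by apply: (ae_eq_ip mOm _ _ _ (h k)); [exact: (su k).1|exact: (su' k).1|exact: (sw k).1].
Qed.

Lemma eq_ae_normL2 n (u u' : vfun n) : L2 a b u -> L2 a b u' ->
  eq_ae a b u u' -> normL2 a b u = normL2 a b u'.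
Proof.
move=> su su' h; rewrite /normL2 (eq_ae_dotL2 su su' su h) dotL2C.
by rewrite (eq_ae_dotL2 su su' su' h).
Qed.

Lemma dotL2_eq0 n (u : vfun n) : L2 a b u -> dotL2 a b u u = 0 ->
  eq_ae a b u (fun=> 0).
Proof.
move=> su; rewrite dotL2E// => /eqP; rewrite psumr_eq0; last first.
  by move=> k _; exact: ip_ge0.
move=> /allP h; apply/eq_ae_cmp => k.
have /eqP h0 := h k (mem_index_enum k).
have := ip_eq0 mOm (su k) h0; apply: filterS => s hs Os.
by rewrite /cmp hs// mxE.
Qed.

(** Pairing with u - v itself. Identities between values of an operator are proved this way, since a
    pairing gives access to the adjoint. *)
Lemma eq_ae_dual n (u v : vfun n) : L2 a b u -> L2 a b v ->
  (forall w, L2 a b w -> dotL2 a b u w = dotL2 a b v w) -> eq_ae a b u v.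
Proof.
move=> su sv h; have sw := L2B su sv.
have := dotL2_eq0 sw _; rewrite dotL2Bl// h// subrr => /(_ erefl).
by apply: filterS => s hs Os; apply/eqP; rewrite -subr_eq0 hs.
Qed.

Lemma L2_ae n (u v : vfun n) : (forall k, measurable_fun Om (cmp v k)) ->
  eq_ae a b u v -> L2 a b u -> L2 a b v.
Proof.
move=> mv /eq_ae_cmp uv su k.
exact: (sqint_ae mOm (mv k) (uv k) (su k)).
Qed.

(* No linearity is required: the adjoint forces linearity and compatibility with
   almost everywhere equality, see goodV_lin and goodV_eq_ae. *)
Definition goodV n m (F : vfun n -> vfun m) : Prop := [/\
  forall v, L2 a b v -> L2 a b (F v),
  exists2 C, 0 <= C & forall v, L2 a b v ->
    dotL2 a b (F v) (F v) <= C * dotL2 a b v v &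
  exists G, is_adjoint a b F G].

Lemma goodV_adjoint n m (F : vfun n -> vfun m) : goodV F ->
  is_adjoint a b F (adjoint a b F).
Proof. by move=> [_ _ h]; exact: (@xgetPex _ (fun _ _ => 0) _ h). Qed.

Lemma goodV_comp n m p (F : vfun m -> vfun p) (G : vfun n -> vfun m) :
  goodV F -> goodV G -> goodV (F \o G).
Proof.
move=> [F1 [C1 C10 F2] [F' [F3 F4]]] [G1 [C2 C20 G2] [G' [G3 G4]]]; split.
- by move=> v sv; apply/F1/G1.
- exists (C1 * C2); first exact: mulr_ge0.
  move=> v sv /=; rewrite (le_trans (F2 _ (G1 _ sv)))// -mulrA ler_wpM2l//.
  exact: G2.
- exists (G' \o F'); split => [v sv|u v su sv] /=; first exact/G3/F3.
  by rewrite F4 ?G4//; [exact: F3|exact: G1].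
Qed.

Lemma goodV_id n : goodV (@id (vfun n)).
Proof.
by split => //; [exists 1 => // v _; rewrite mul1r|exists id].
Qed.

Lemma goodV_zero n m : goodV (fun (_ : vfun n) _ => 0 : 'cV[R]_m).
Proof.
have z p (v : vfun p) : dotL2 a b (fun=> 0) v = 0.
  rewrite /dotL2 -[RHS](@mul0r _ (fine (mu Om))) -Rintegral_cst//.
  by apply: eq_Rintegral => s _; rewrite big1// => k _; rewrite mxE mul0r.
split; first by move=> v _; exact: L2_0.
- by exists 0 => // v _; rewrite z mul0r.
- exists (fun _ _ => 0); split=> [v _|u v _ _]; first exact: L2_0.
  by rewrite z dotL2C z.
Qed.

Lemma goodV_add n m (F G : vfun n -> vfun m) : goodV F -> goodV G ->
  goodV (fun v s => F v s + G v s).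
Proof.
move=> [F1 [C1 C10 F2] [F' [F3 F4]]] [G1 [C2 C20 G2] [G' [G3 G4]]]; split.
- by move=> v sv; apply: L2D; [exact: F1|exact: G1].
- exists (2 * C1 + 2 * C2); first by rewrite addr_ge0 ?mulr_ge0.
  move=> v sv; have sF := F1 v sv; have sG := G1 v sv.
  (* Nonnegativity of |F v - G v|^2 bounds the cross term by the squares, whence the factors 2 in
     the constant. *)
  have := dotL2_ge0 (fun s => F v s - G v s).
  rewrite dotL2Bl//; last exact: L2B.
  rewrite !dotL2Br// dotL2Dl//; last exact: L2D.
  rewrite !dotL2Dr// (dotL2C (G v)) => h.
  have := F2 v sv; have := G2 v sv; lra.
- exists (fun v s => F' v s + G' v s); split=> [v sv|u v su sv].
    by apply: L2D; [exact: F3|exact: G3].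
  rewrite dotL2Dl ?F4 ?G4 ?dotL2Dr//.
  + exact: F3.
  + exact: G3.
  + exact: F1.
  + exact: G1.
Qed.

Lemma goodV_sum n m I (r : seq I) (F : I -> vfun n -> vfun m) :
  (forall i, goodV (F i)) -> goodV (fun v s => \sum_(i <- r) F i v s).
Proof.
move=> gF; elim: r => [|i r IH].
  have -> : (fun v s => \sum_(i <- [::]) F i v s) = (fun (_ : vfun n) _ => 0 : 'cV[R]_m).
    by apply/funext => v; apply/funext => s; rewrite big_nil.
  exact: goodV_zero.
have -> : (fun v s => \sum_(i <- i :: r) F i v s) =
    (fun v s => F i v s + \sum_(i <- r) F i v s).
  by apply/funext => v; apply/funext => s; rewrite big_cons.
exact: goodV_add.
Qed.

(** [opA_] agrees with a sum of kernel operators only almost everywhere. Measurability of F' is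
    asked for separately because equality almost everywhere does not transport it. *)
Lemma goodV_ae n m (F F' : vfun n -> vfun m) :
  (forall v, L2 a b v -> forall k, measurable_fun Om (cmp (F' v) k)) ->
  (forall v, L2 a b v -> eq_ae a b (F v) (F' v)) -> goodV F -> goodV F'.
Proof.
move=> mF' FF' [F1 [C1 C10 F2] [G [G1 G2]]].
have F'1 v : L2 a b v -> L2 a b (F' v).
  by move=> sv; apply: L2_ae (F1 v sv); [exact: mF'|exact: FF'].
split => //.
  exists C1 => // v sv; have sF := F1 v sv; have sF' := F'1 v sv.
  rewrite -(eq_ae_dotL2 sF sF' sF' (FF' v sv)) dotL2C.
  by rewrite -(eq_ae_dotL2 sF sF' sF (FF' v sv)); exact: F2.
exists G; split => // u v su sv; rewrite -G2//.
by apply/esym; apply: eq_ae_dotL2 => //; [exact: F1|exact: F'1|exact: FF'].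
Qed.

(** One column of a matrix of operators: it reads the component c alone, so its adjoint writes into
    the component c alone. *)
Let goodV_column n m (c : 'I_n) (Fs : 'I_m -> (N.-tuple R -> R) -> N.-tuple R -> R) :
  (forall k, goodS a b (Fs k)) ->
  goodV (fun (v : vfun n) s => \col_k Fs k (cmp v c) s).
Proof.
move=> gF.
have cE k (v : vfun n) : cmp (fun s => \col_k Fs k (cmp v c) s) k = Fs k (cmp v c).
  by apply/funext => s; rewrite /cmp mxE.
have /choice[G /choice[C hGC]] : forall k, exists G C, _ := gF.
have FL v : L2 a b v -> L2 a b (fun s => \col_k Fs k (cmp v c) s).
  by move=> sv; apply/L2P => k; rewrite cE; have [_ h _ _ _] := hGC k; exact/h/sv.
have GL (v : vfun m) : L2 a b v ->
    L2 a b (fun s => \col_(c' < n) (if c' == c then \sum_k G k (cmp v k) s else 0)).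
  move=> sv; apply/L2P => c'; rewrite (_ : cmp _ c' =
    (fun s => if c' == c then \sum_k G k (cmp v k) s else 0)); last first.
    by apply/funext => s; rewrite /cmp mxE.
  have [_|_] := eqVneq c' c; last exact: sqint0.
  by apply: sqint_sum => // k; have [_ _ h _ _] := hGC k; exact/h/sv.
split => //.
- exists (\sum_k C k); first by apply: sumr_ge0 => k _; have [] := hGC k.
  move=> v sv; rewrite dotL2E//; [|exact: FL..].
  rewrite mulr_suml; apply: ler_sum => k _; rewrite cE.
  have [C0 _ _ h _] := hGC k; apply: le_trans (h _ (sv c)) _; rewrite ler_wpM2l//.
  rewrite dotL2E// (bigD1 c)//= lerDl sumr_ge0// => k' _; exact: ip_ge0.
- exists (fun (v : vfun m) s => \col_(c' < n) (if c' == c then \sum_k G k (cmp v k) s else 0)).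
  split => // u v su sv; rewrite !dotL2E//; [|exact: GL|exact: FL].
  rewrite (bigD1 c)//= [X in _ + X]big1 ?addr0; last first.
    move=> c' /negbTE cc; rewrite /ip -[RHS](@mul0r _ (fine (mu Om))) -Rintegral_cst//.
    by apply: eq_Rintegral => s _; rewrite /cmp mxE cc mulr0.
  rewrite ipC.
  transitivity (ip mu Om (fun s => \sum_k G k (cmp v k) s) (cmp u c)); last first.
    by apply: eq_ip => // s _; rewrite /cmp mxE eqxx.
  rewrite (ip_suml mOm); [|by move=> k; have [_ _ h _ _] := hGC k; exact/h/sv|exact: su].
  apply: eq_bigr => k _; rewrite cE; have [_ _ _ _ h] := hGC k.
  by rewrite (h _ _ (su c) (sv k)) ipC.
Qed.

(** Reduction to scalar entries. The expansion is asked for almost everywhere only, since a sum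
    leaves an integral only on lines where every component is integrable. *)
Lemma goodV_matrix n m (F : vfun n -> vfun m)
    (Fs : 'I_m -> 'I_n -> (N.-tuple R -> R) -> N.-tuple R -> R) :
  (forall k c, goodS a b (Fs k c)) ->
  (forall v, L2 a b v -> forall k, measurable_fun Om (cmp (F v) k)) ->
  (forall v, L2 a b v -> forall k, {ae mu, forall s, Om s ->
     cmp (F v) k s = \sum_c Fs k c (cmp v c) s}) -> goodV F.
Proof.
move=> gF mF FE.
apply: (@goodV_ae _ _ (fun v s => \sum_c \col_k Fs k c (cmp v c) s)) => //.
  move=> v sv; apply/eq_ae_cmp => k; have := FE v sv k; apply: filterS => s hs Os.
  by rewrite hs// /cmp summxE; apply: eq_bigr => c _; rewrite mxE.
by apply: goodV_sum => c; apply: (@goodV_column _ _ c (Fs^~ c)).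
Qed.

Section linearity.
Context n m (F : vfun n -> vfun m) (gF : goodV F).

Lemma goodV_lin c u v : L2 a b u -> L2 a b v ->
  eq_ae a b (F (fun s => u s + c *: v s)) (fun s => F u s + c *: F v s).
Proof.
move=> su sv; have [F1 _ [G [G1 G2]]] := gF.
have scv := L2Z c sv; have suv := L2D su scv.
apply: eq_ae_dual; [exact: F1|by apply: L2D; [|apply: L2Z]; exact: F1|].
move=> w sw; rewrite G2// dotL2Dl//; last exact: G1.
rewrite dotL2Zl//; last exact: G1.
rewrite -!G2// dotL2Dl//; [|exact: F1|by apply: L2Z; exact: F1].
by rewrite dotL2Zl//; exact: F1.
Qed.

Lemma goodV_eq_ae u v : L2 a b u -> L2 a b v -> eq_ae a b u v ->
  eq_ae a b (F u) (F v).
Proof.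
move=> su sv uv; have [F1 _ [G [G1 G2]]] := gF.
apply: eq_ae_dual => [||w sw]; [exact: F1..|].
by rewrite !G2//; apply: eq_ae_dotL2 => //; exact: G1.
Qed.

End linearity.

End vector_L2.

(** * Divided powers and bounded kernels *)

Section monomial.
Context (R : realType).

(** Divided power: differentiation lowers the index without producing a coefficient. It is the
    common entry of [Qmx], [E1], [Ed] and of the Taylor kernel. *)
Definition mono (m : nat) (y : R) : R := y ^+ m / m`!%:R.

Lemma mono0 y : mono 0 y = 1.
Proof. by rewrite /mono expr0 fact0 divr1. Qed.

Lemma mono_horner m : mono m = horner (m`!%:R^-1 *: 'X^m).
Proof. by apply/funext => y; rewrite hornerZ hornerXn mulrC. Qed.

Lemma is_derive_mono m (y : R) :
  is_derive y (1 : R) (mono m) (if m is m'.+1 then mono m' y else 0).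
Proof.
have := is_derive_poly (m`!%:R^-1 *: 'X^m) y; rewrite -mono_horner.
rewrite derivZ derivXn hornerZ hornerMn hornerXn.
case: m => [|m]; first by rewrite mulr0n mulr0.
congr (is_derive _ _ _ _); rewrite /mono factS natrM invfM.
have m0 : m.+1%:R != 0 :> R by rewrite pnatr_eq0.
by rewrite -[y ^+ m *+ _]mulr_natr mulrC -mulrA (mulrA m.+1%:R) divff// mul1r.
Qed.

Lemma derive1n_mono j m (z : R) :
  derive1n j (mono m) z = if (j <= m)%N then mono (m - j) z else 0.
Proof.
elim: j z => [|j IH] z; first by rewrite subn0.
rewrite derive1nS (_ : derive1n j (mono m) =
  fun z => if (j <= m)%N then mono (m - j) z else 0); last exact/funext.
have [jm|jm] := leqP j m; last first.
  rewrite derive1_cst ltnNge (ltnW jm) //=.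
have /is_derive1P[_ ->] := is_derive_mono (m - j) z.
have [jm'|jm'] := ltnP j m; first by rewrite -[(m - j)%N]prednK ?subn_gt0// subnS.
by rewrite (_ : (m - j)%N = 0%N)//; lia.
Qed.

End monomial.

Section kernels.
Context (R : realType) (I : set R).
Local Notation Rm := (measurableTypeR R).
Implicit Types ka : Rm * Rm -> R.

(** Measurable on the whole plane but bounded only over [I]: polynomial kernels are unbounded
    elsewhere. *)
Definition bker ka := measurable_fun setT ka /\
  exists M, forall x y, I x -> I y -> `|ka (x, y)| <= M.

Lemma bker_cst c : bker (fun=> c).
Proof. by split => //; exists `|c|. Qed.

Lemma bkerD k1 k2 : bker k1 -> bker k2 -> bker (fun p => k1 p + k2 p).
Proof.
move=> [m1 [M1 h1]] [m2 [M2 h2]]; split; first exact: measurable_funD.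
exists (M1 + M2) => x y Ix Iy; rewrite (le_trans (ler_normD _ _))// lerD//.
  exact: h1.
exact: h2.
Qed.

Lemma bkerM k1 k2 : bker k1 -> bker k2 -> bker (fun p => k1 p * k2 p).
Proof.
move=> [m1 [M1 h1]] [m2 [M2 h2]]; split; first exact: measurable_funM.
exists (M1 * M2) => x y Ix Iy; rewrite normrM ler_pM//; [exact: h1|exact: h2].
Qed.

Lemma bkerB k1 k2 : bker k1 -> bker k2 -> bker (fun p => k1 p - k2 p).
Proof.
move=> h1 h2; have := bkerD h1 (bkerM (bker_cst (-1)) h2).
by under eq_fun do rewrite mulN1r.
Qed.

Lemma bker_sum J (r : seq J) (k : J -> Rm * Rm -> R) :
  (forall j, bker (k j)) -> bker (fun p => \sum_(j <- r) k j p).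
Proof.
move=> h; elim: r => [|j r IH].
  by under eq_fun do rewrite big_nil; exact: bker_cst.
by under eq_fun do rewrite big_cons; exact: bkerD.
Qed.

Lemma bker_le : bker (fun p => ((p.2 : R) <= p.1)%R%:R).
Proof.
split; last by exists 1 => x y _ _ /=; case: (y <= x); rewrite ?normr1 ?normr0.
rewrite (_ : (fun p => _) = \1_[set p : Rm * Rm | (p.2 : R) <= p.1]).
  apply: measurable_indic; rewrite -[X in measurable X]setTI.
  have := @measurable_fun_ler _ (Rm * Rm)%type R setT (fun p => p.2 : R) (fun p => p.1 : R)
    measurable_snd measurable_fst.
  move=> /(_ measurableT [set true]); rewrite /preimage /=; apply.
  by [].
apply/funext => p; rewrite indicE (_ : (p \in _) = ((p.2 : R) <= p.1))//.
by apply/idP/idP => [/set_mem|/mem_set].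
Qed.

Lemma bker_ge : bker (fun p => ((p.1 : R) <= p.2)%R%:R).
Proof.
split; last by exists 1 => x y _ _ /=; case: (x <= y); rewrite ?normr1 ?normr0.
have [h _] := bker_le.
have -> : (fun p : Rm * Rm => ((p.1 : R) <= p.2)%R%:R) =
    (fun p => ((p.2 : R) <= p.1)%R%:R) \o (fun p : Rm * Rm => (p.2, p.1)) :> (_ -> R) by [].
apply: measurableT_comp h _.
by apply: measurable_fun_pair; [exact: measurable_snd|exact: measurable_fst].
Qed.

Hypothesis Ibd : exists a b, a <= b /\ I `<=` `[a, b]%classic.

Let horner_bounded (p : {poly R}) : exists M, forall x, I x -> `|p.[x]| <= M.
Proof.
have [a [b [ab Iab]]] := Ibd.
have cp : {within `[a, b], continuous (fun x => `|p.[x]|)}.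
  by apply: continuous_subspaceT => x; apply: cvg_norm; exact: continuous_horner.
have [c _ hc] := EVT_max ab cp; exists `|p.[c]| => x Ix; apply: hc; exact: Iab.
Qed.

Lemma bker_poly1 (p : {poly R}) : bker (fun z => p.[z.1]).
Proof.
split.
  apply: (@measurableT_comp _ _ _ _ _ _ (horner p : Rm -> R)); last exact: measurable_fst.
  exact: continuous_measurable_fun (@continuous_horner R p).
by have [M hM] := horner_bounded p; exists M => x y Ix _; exact: hM.
Qed.

Lemma bker_poly2 (p : {poly R}) : bker (fun z => p.[z.2]).
Proof.
split.
  apply: (@measurableT_comp _ _ _ _ _ _ (horner p : Rm -> R)); last exact: measurable_snd.
  exact: continuous_measurable_fun (@continuous_horner R p).
by have [M hM] := horner_bounded p; exists M => x y _ Iy; exact: hM.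
Qed.

Lemma bker_pow1 m : bker (fun z => z.1 ^+ m).
Proof. by have := bker_poly1 'X^m; under eq_fun do rewrite hornerXn. Qed.

Lemma bker_pow2 m : bker (fun z => z.2 ^+ m).
Proof. by have := bker_poly2 'X^m; under eq_fun do rewrite hornerXn. Qed.

Lemma bker_monoB m : bker (fun z => mono m (z.1 - z.2)).
Proof.
have h : bker (fun z => z.1 - z.2).
  by apply: bkerB; [exact: (bker_pow1 1)|exact: (bker_pow2 1)].
rewrite /mono; apply: bkerM; last exact: bker_cst.
elim: m => [|m IH]; first by under eq_fun do rewrite expr0; exact: bker_cst.
by under eq_fun do rewrite exprS; exact: bkerM.
Qed.

End kernels.

Section kernel_entries.
Context (R : realType) (n d : nat).

Lemma E1_poly j q k : exists p : {poly R}, forall z, E1 (R := R) n d j z q k = p.[z].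
Proof.
exists ((if (j <= tagnat.sig1 q)%N then ((tagnat.sig1 q - j)`!%:R^-1 *: 'X^(tagnat.sig1 q - j)) else 0) *+
  (tagnat.sig2 q == k)) => z.
rewrite !mxE -/(mono _) derive1n_mono hornerMn; congr (_ *+ _).
by case: ifP => _; [rewrite mono_horner|rewrite horner0].
Qed.

Lemma Ed_poly q k : exists p : {poly R}, forall z, Ed (R := R) n d z q k = p.[z].
Proof.
exists (((d.-1 - tagnat.sig1 q)`!%:R^-1 *: 'X^(d.-1 - tagnat.sig1 q)) *+ (tagnat.sig2 q == k)) => z.
by rewrite !mxE hornerMn; congr (_ *+ _); rewrite hornerZ hornerXn mulrC.
Qed.

(** The entries of E_1 and E_d are polynomials, so the kernel is a finite sum of products of a
    polynomial in one variable and a polynomial in the other. *)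
Lemma bker_EKE (I : set R) (a b : R) (K : 'M[R]_(\sum_(i < d) n)) j k c :
  (exists a b, a <= b /\ I `<=` `[a, b]%classic) ->
  bker I (fun p => ((E1 n d j (p.1 - a))^T *m K *m Ed n d (b - p.2)) k c).
Proof.
move=> Ibd.
rewrite (_ : (fun p => _) = fun p => \sum_q (\sum_r E1 n d j (p.1 - a) r k * K r q) *
    Ed n d (b - p.2) q c); last first.
  apply/funext => p; rewrite mxE; apply: eq_bigr => q _; rewrite mxE.
  by congr (_ * _); apply: eq_bigr => r _; rewrite mxE.
apply: bker_sum => q; apply: bkerM.
  apply: bker_sum => r; apply: bkerM; last exact: bker_cst.
  have [p hp] := E1_poly j r k.
  under eq_fun do rewrite hp; have := bker_poly1 Ibd (p \Po ('X - a%:P)).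
  by under eq_fun do rewrite horner_comp !hornerE.
have [p hp] := Ed_poly q c.
under eq_fun do rewrite hp; have := bker_poly2 Ibd (p \Po (b%:P - 'X)).
by under eq_fun do rewrite horner_comp !hornerE.
Qed.

End kernel_entries.

(** * Boundedness and adjoints of the operators of the statement *)

Section operators.
Context (R : realType) (n N : nat) (a b : 'I_N.+1 -> R) (ab : forall i, a i <= b i).
Local Notation leb := (@lebesgue_measure R).
Local Notation mu := (lebesgueN R N.+1).
Local Notation Om := (box a b).
Local Notation Rm := (measurableTypeR R).
Local Notation vfun n := (N.+1.-tuple R -> 'cV[R]_n).
Local Notation I i := (`[a i, b i]%classic : set Rm).

Let mOm : measurable Om := measurable_box a b.

Lemma Ibounded i : exists a0 b0, a0 <= b0 /\ I i `<=` `[a0, b0]%classic.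
Proof. by exists (a i), (b i); split; first exact: ab. Qed.

Lemma goodS_bker i ka : bker (I i) ka -> goodS a b (kop a b i ka).
Proof. by move=> [mk [M hM]]; exact: (goodS_kop (ab i) mk hM). Qed.

Lemma Rintegral_lower (a0 b0 x : R) (f : R -> R) : x <= b0 ->
  \int[leb]_(th in `[a0, x]) f th =
  \int[leb]_(th in (`[a0, b0]%classic : set Rm)) ((th <= x)%R%:R * f th).
Proof.
move=> xb; rewrite (_ : `[a0, x]%classic = `[a0, b0] `&` [set th | th <= x]).
  rewrite Rintegral_mkcondr; apply: eq_Rintegral => th _; rewrite patchE.
  have -> : (th \in [set th | th <= x]) = (th <= x).
    by apply/idP/idP => h; [exact: (set_mem h)|exact: mem_set].
  by case: ifP; rewrite ?mul1r ?mul0r.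
apply/seteqP; split => th /=; rewrite !in_itv /=.
  by move=> /andP[h1 h2]; split => //; rewrite h1 (le_trans h2).
by move=> [/andP[-> _] ->].
Qed.

Lemma Rintegral_upper (a0 b0 x : R) (f : R -> R) : a0 <= x ->
  \int[leb]_(th in `[x, b0]) f th =
  \int[leb]_(th in (`[a0, b0]%classic : set Rm)) ((x <= th)%R%:R * f th).
Proof.
move=> xb; rewrite (_ : `[x, b0]%classic = `[a0, b0] `&` [set th | x <= th]).
  rewrite Rintegral_mkcondr; apply: eq_Rintegral => th _; rewrite patchE.
  have -> : (th \in [set th | x <= th]) = (x <= th).
    by apply/idP/idP => h; [exact: (set_mem h)|exact: mem_set].
  by case: ifP; rewrite ?mul1r ?mul0r.
apply/seteqP; split => th /=; rewrite !in_itv /=.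
  by move=> /andP[h1 h2]; split => //; rewrite h2 (le_trans xb).
by move=> [/andP[_ ->] ->].
Qed.

Section opA.
Context (delta : 'I_N.+1 -> nat)
  (B C : forall i, 'I_(delta i) -> 'I_(delta i) -> 'M[R]_n).

Definition ker0 i j (p : Rm * Rm) : R :=
  ((p.2 : R) <= p.1)%R%:R * mono (delta i - 1 - j) (p.1 - p.2).

Definition ker1 i j k c (p : Rm * Rm) : R :=
  ((E1 n (delta i) j (p.1 - a i))^T *m Kmat a b B C i *m
    Ed n (delta i) (b i - p.2)) k c.

(** Entry (k, c) of the matrix kernel of A_{i,j}. The Volterra part is scalar, hence diagonal;
    different components are coupled only by the boundary part. *)
Definition kerA i j k c (p : Rm * Rm) : R :=
  (k == c)%:R * ker0 i j p - ker1 i j k c p.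

Lemma bker0 i j : bker (I i) (ker0 i j).
Proof. by apply: bkerM; [exact: bker_le|exact: bker_monoB (Ibounded i) _]. Qed.

Lemma bker1 i j k c : bker (I i) (ker1 i j k c).
Proof. exact: bker_EKE (Ibounded i). Qed.

Lemma bkerA i j k c : bker (I i) (kerA i j k c).
Proof.
by apply: bkerB; [apply: bkerM; [exact: bker_cst|exact: bker0]|exact: bker1].
Qed.

(** Valid at every point of the box, because the sum over c stays inside the integral. Measurability
    of [opA_] is obtained from this form. *)
Lemma opA_split i j (v : vfun n) s k : Om s -> (j < delta i)%N ->
  cmp (opA_ a b B C i j v) k s = kop a b i (ker0 i j) (cmp v k) s -
    \int[leb]_(th in I i) (\sum_c ker1 i j k c (tnth s i, th) * cmp v c (upd s i th)).
Proof.
move=> Os ji; rewrite /cmp /opA_ ji !mxE; congr (_ - _).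
  have /andP[_ sb] := Os i; rewrite (Rintegral_lower _ _ sb).
  by apply: eq_Rintegral => th _; rewrite mxE /ker0 /= mulrA.
by apply: eq_Rintegral => th _; rewrite mxE.
Qed.

Lemma integrable_bker i ka x f : I i x -> bker (I i) ka -> sqint leb (I i) f ->
  leb.-integrable (I i) (EFin \o (fun th => ka (x, th) * f th)).
Proof.
move=> Ix [mk [M hM]] sf; have mI : measurable (I i) by exact: measurable_itv.
have fi := sqint_integrable mI (leb_itv_fin (ab i)) sf.
have mk1 : measurable_fun (I i) (fun th => ka (x, th)).
  apply: measurable_funTS; apply: measurableT_comp mk _.
  exact: measurable_fun_pair.
have := le_integrable_mul mI fi mk1 (fun th Ith => hM x th Ix Ith).
by apply: eq_integrable => // th _ /=; rewrite mulrC.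
Qed.

(** Taking the sum over c out of the integral requires every component of v to be square-integrable
    on the line through s, which holds for almost every s. *)
Lemma opA_kop i j (v : vfun n) k : (j < delta i)%N -> L2 a b v ->
  {ae mu, forall s, Om s ->
    cmp (opA_ a b B C i j v) k s = \sum_c kop a b i (kerA i j k c) (cmp v c) s}.
Proof.
move=> ji sv; have mI : measurable (I i) by exact: measurable_itv.
have : {ae mu, forall s, forall c, Om s -> sqint leb (I i) (fun th => cmp v c (upd s i th))}.
  by apply: ae_forall_count => c; apply: (ae_sqint_upd i); exact: sv.
apply: filterS => s hs Os; have {}hs c := hs c Os.
have Is : I i (tnth s i) by have := Os i; rewrite /= in_itv.
rewrite (opA_split _ _ Os)// Rintegral_sum//; last first.
  by move=> c; apply: integrable_bker => //; exact: bker1.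
transitivity (\sum_c ((k == c)%:R * kop a b i (ker0 i j) (cmp v c) s -
    \int[leb]_(th in I i) (ker1 i j k c (tnth s i, th) * cmp v c (upd s i th)))).
  rewrite sumrB; congr (_ - _); rewrite (bigD1 k)//= eqxx mul1r big1 ?addr0//.
  by move=> c /negbTE ck; rewrite eq_sym ck mul0r.
apply: eq_bigr => c _.
have i0 : leb.-integrable (I i)
    (EFin \o (fun th => ker0 i j (tnth s i, th) * cmp v c (upd s i th))).
  by apply: integrable_bker => //; exact: bker0.
have i1 : leb.-integrable (I i)
    (EFin \o (fun th => ker1 i j k c (tnth s i, th) * cmp v c (upd s i th))).
  by apply: integrable_bker => //; exact: bker1.
rewrite /kop -RintegralZl// -RintegralB//.
  by apply: eq_Rintegral => th _; rewrite /kerA mulrBl mulrA.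
exact: (integrableZl mI _ i0).
Qed.

Lemma goodV_opA_ i j : goodV a b (opA_ a b B C i j).
Proof.
have [ji|ji] := ltnP j (delta i); last first.
  have -> : opA_ a b B C i j = id by rewrite /opA_ ltnNge ji.
  exact: goodV_id.
have mI : measurable (I i) by exact: measurable_itv.
apply: (@goodV_matrix _ _ _ _ _ _ _ (fun k c => kop a b i (kerA i j k c))).
- by move=> k c; exact: goodS_bker (bkerA _ _ _ _).
- move=> v sv k.
  apply: (eq_measurable_fun (fun s => kop a b i (ker0 i j) (cmp v k) s -
    \int[leb]_(th in I i) (\sum_c ker1 i j k c (tnth s i, th) * cmp v c (upd s i th)))).
    by move=> s /set_mem Os; rewrite (opA_split _ _ Os).
  apply: measurable_funB.
    by apply: measurable_kop; [exact: (bker0 i j).1|exact: (sv k).1].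
  apply: (@measurable_Rintegral_param _ _ _ _ _ leb Om (I i)
    (fun p => \sum_c ker1 i j k c (tnth p.1 i, p.2) * cmp v c (upd p.1 i p.2))) => //.
  apply: measurable_sum => c; apply: measurable_funM; last first.
    by apply: measurable_fun_upd; exact: (sv c).1.
  apply: measurable_funTS; apply: (measurableT_comp (bker1 i j k c).1).
  apply: measurable_fun_pair => /=; last exact: measurable_snd.
  apply: (@measurableT_comp _ _ _ _ _ _ (fun s => tnth s i)) => //.
  exact: measurable_tnth.
- by move=> v sv k; exact: opA_kop.
Qed.

Lemma goodV_comp_all m (F : 'I_N.+1 -> vfun m -> vfun m) :
  (forall i, goodV a b (F i)) -> goodV a b (comp_all F).
Proof.
move=> gF; rewrite /comp_all; elim: (index_enum _) => [|i r IH].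
  by rewrite big_nil; exact: goodV_id.
by rewrite big_cons; exact: goodV_comp.
Qed.

Lemma goodV_opT : goodV a b (opT a b B C).
Proof. by apply: goodV_comp_all => i; exact: goodV_opA_. Qed.

Lemma tnth_pow_bounded i m : exists M, forall s, Om s -> `|tnth s i ^+ m| <= M.
Proof.
have [_ [M hM]] := bker_poly1 (Ibounded i) 'X^m.
exists M => s Os; have Is : I i (tnth s i) by have := Os i; rewrite /= in_itv.
by have := hM _ _ Is Is; rewrite /= hornerXn.
Qed.

Lemma goodV_mulMpoly (A : 'M[mpoly.mpoly N.+1 R]_n) : goodV a b (mulMpoly A).
Proof.
have mono_ok (m : 'I_N.+1 -> nat) :
    measurable_fun Om (fun s : N.+1.-tuple R => \prod_i tnth s i ^+ m i) /\
    exists M, forall s, Om s -> `|\prod_i tnth s i ^+ m i| <= M.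
  split.
    apply: measurable_funTS; apply: measurable_prod => i _.
    by apply: measurable_funX; exact: measurable_tnth.
  have /choice[M hM] := fun i => tnth_pow_bounded i (m i).
  exists (\prod_i M i) => s Os; rewrite normr_prod; apply: ler_prod => i _.
  by rewrite normr_ge0 hM.
have poly_ok (p : mpoly.mpoly N.+1 R) :
    measurable_fun Om (fun s => mpoly.meval (tnth s) p) /\
    exists M, forall s, Om s -> `|mpoly.meval (tnth s) p| <= M.
  pose f r (s : N.+1.-tuple R) :=
    \sum_(m <- r) mpoly.mcoeff m p * \prod_i tnth s i ^+ mpoly.fun_of_multinom m i.
  (* [meval] is by definition this sum over the support of p; the support is then generalized to any
     list. *)
  suff : measurable_fun Om (f (mpoly.msupp p)) /\
      exists M, forall s, Om s -> `|f (mpoly.msupp p) s| <= M by [].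
  elim: (mpoly.msupp p) => [|m r [IH [M hM]]].
    split; first by rewrite /f; under eq_fun do rewrite big_nil; exact: measurable_cst.
    by exists 0 => s _; rewrite /f big_nil normr0.
  have [h [M' hM']] := mono_ok (mpoly.fun_of_multinom m).
  split.
    rewrite /f; under eq_fun do rewrite big_cons; apply: measurable_funD IH.
    exact: measurable_funM.
  exists (`|mpoly.mcoeff m p| * M' + M) => s Os; rewrite /f big_cons.
  by rewrite (le_trans (ler_normD _ _))// lerD ?hM// normrM ler_wpM2l// hM'.
apply: (@goodV_matrix _ _ _ _ _ _ _ (fun k c v s => mpoly.meval (tnth s) (A k c) * v s)).
- by move=> k c; have [m [M hM]] := poly_ok (A k c); exact: goodS_mul m hM.
- move=> v sv k; rewrite (_ : cmp _ k = fun s =>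
    \sum_c mpoly.meval (tnth s) (A k c) * cmp v c s).
    apply: measurable_sum => c; apply: measurable_funM; last exact: (sv c).1.
    by have [] := poly_ok (A k c).
  by apply/funext => s; rewrite /cmp mxE; apply: eq_bigr => c _; rewrite mxE.
- move=> v sv k; apply: aeW => s _.
  by rewrite /cmp mxE; apply: eq_bigr => c _; rewrite mxE.
Qed.

Lemma goodV_opA (A : midx delta -> 'M[mpoly.mpoly N.+1 R]_n) :
  goodV a b (opA a b B C A).
Proof.
apply: goodV_sum => al.
apply: (goodV_comp (goodV_mulMpoly (A al))).
by apply: goodV_comp_all => i; exact: goodV_opA_.
Qed.

End opA.

Lemma goodV_mulM m p (P : 'M[R]_(m, p)) : goodV a b (mulM (N := N.+1) P).
Proof.
apply: (@goodV_matrix _ _ _ _ _ _ _ (fun k c v s => P k c * v s)).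
- by move=> k c; exact: (@goodS_mul _ _ _ _ (fun=> P k c) `|P k c|).
- move=> v sv k; rewrite (_ : cmp _ k = fun s => \sum_c P k c * cmp v c s).
    by apply: measurable_sum => c; apply: measurable_funM => //; exact: (sv c).1.
  by apply/funext => s; rewrite /cmp mxE.
- by move=> v sv k; apply: aeW => s _; rewrite /cmp mxE.
Qed.

(** An index beyond the end of the list yields the default [id], which is good as well. *)
Lemma goodS_map T (f : T -> _) (s : seq T) : (forall x, goodS a b (f x)) ->
  forall q, goodS a b (nth id (map f s) q).
Proof.
move=> h; elim: s => [|x s IH] [|q] /=; [exact: goodS_id..|exact: h|exact: IH].
Qed.

Lemma goodS_cat s1 s2 : (forall q, goodS a b (nth id s1 q)) ->
  (forall q, goodS a b (nth id s2 q)) -> forall q, goodS a b (nth id (s1 ++ s2) q).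
Proof. by move=> h1 h2 q; rewrite nth_cat; case: ifP. Qed.

Lemma goodS_Z1 d i q : goodS a b (nth id (Z1 a b d i) q).
Proof.
rewrite /Z1; apply: goodS_cat; [|apply: goodS_cat]; apply: goodS_map.
- move=> p; have [M hM] := tnth_pow_bounded i p.
  apply: (@goodS_mul _ _ _ _ (fun s => tnth s i ^+ p) M) => //.
  by apply: measurable_funX; apply: measurable_funTS; exact: measurable_tnth.
- move=> pq; have k : bker (I i) (fun z => ((z.2 : R) <= z.1)%R%:R * (z.1 ^+ pq.1 * z.2 ^+ pq.2)).
    apply: bkerM; first exact: bker_le.
    by apply: bkerM; [exact: (bker_pow1 (Ibounded i))|exact: (bker_pow2 (Ibounded i))].
  apply: eq_goodS (goodS_bker k) => v s Os.
  have /andP[_ sb] := Os i; rewrite /Zlower (Rintegral_lower _ _ sb).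
  by apply: eq_Rintegral => th _; rewrite /= !mulrA.
- move=> pq; have k : bker (I i) (fun z => ((z.1 : R) <= z.2)%R%:R * (z.1 ^+ pq.1 * z.2 ^+ pq.2)).
    apply: bkerM; first exact: bker_ge.
    by apply: bkerM; [exact: (bker_pow1 (Ibounded i))|exact: (bker_pow2 (Ibounded i))].
  apply: eq_goodS (goodS_bker k) => v s Os.
  have /andP[sa _] := Os i; rewrite /Zupper (Rintegral_upper _ _ sa).
  by apply: eq_Rintegral => th _; rewrite /= !mulrA.
Qed.

Lemma goodS_foldr (Z : 'I_N.+1 -> seq ((N.+1.-tuple R -> R) -> N.+1.-tuple R -> R)) l q :
  (forall i q, goodS a b (nth id (Z i) q)) ->
  goodS a b (nth id
    (foldr (fun i Zs => [seq F \o G | F <- Z i, G <- Zs]) [:: id] l) q).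
Proof.
move=> gZ; elim: l q => [|i l IH] q /=.
  by case: q => [|[|q]] /=; exact: goodS_id.
elim: (Z i) q (gZ i) => [|F r IHr] q hr.
  by case: q => [|q] /=; exact: goodS_id.
rewrite allpairs_cons nth_cat; case: ifP => [qs|_]; last first.
  by apply: IHr => q0; exact: (hr q0.+1).
rewrite (nth_map id); last by move: qs; rewrite size_map.
by apply: goodS_comp; [exact: (hr 0%N)|exact: IH].
Qed.

Lemma goodS_Zbasis d q : goodS a b (nth id (Zbasis a b d) q).
Proof. by apply: goodS_foldr => i q'; exact: goodS_Z1. Qed.

(** Through [mxvec], each row of [IZ] is one basis operator applied to one component of v. *)
Lemma goodV_IZ d : goodV a b (IZ (n := n) a b d).
Proof.
have /choice[c /choice[q hcq]] (k : 'I_(n * mudim d ^ N.+1)) : exists c q,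
    forall (v : vfun n) s, cmp (IZ a b d v) k s = nth id (Zbasis a b d) q (cmp v c) s.
  case/mxvec_indexP: k => c q; exists c, q => v s.
  by rewrite /cmp /IZ mxE mxvecE mxE.
apply: (@goodV_matrix _ _ _ _ _ _ _ (fun k c' =>
  if c' == c k then nth id (Zbasis a b d) (q k) else fun _ _ => 0)).
- by move=> k c'; case: ifP => _; [exact: goodS_Zbasis|exact: goodS_zero].
- move=> v sv k; rewrite (funext (hcq k v)).
  have [G [D [_ h _ _ _]]] := goodS_Zbasis d (q k).
  by have [] := h _ (sv (c k)).
- move=> v sv k; apply: aeW => s _; rewrite hcq (bigD1 (c k))//= eqxx.
  by rewrite big1 ?addr0// => c' /negbTE ->.
Qed.

End operators.

(** * Weak derivatives *)

Section continuous_measurable.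
Context (R : realType) (N : nat).
Local Notation row s := (\row_i tnth s i : 'rV[R]_N).

Let grid (m : nat) (s : N.-tuple R) : N.-tuple R :=
  [tuple (Num.floor (m.+1%:R * tnth s i))%:~R / m.+1%:R | i < N].

Let cell (m : nat) (z : N.-tuple int) : set (N.-tuple R) :=
  [set s | forall i, (tnth z i)%:~R <= m.+1%:R * tnth s i < (tnth z i + 1)%:~R].

Let measurable_cell m z : measurable (cell m z).
Proof.
rewrite (_ : cell m z = \big[setI/setT]_(i < N)
    ((fun s => m.+1%:R * tnth s i) @^-1` `[(tnth z i)%:~R, (tnth z i + 1)%:~R[)).
  apply: bigsetI_measurable => i _; rewrite -[X in measurable X]setTI.
  apply: (@measurable_funM _ _ _ _ (fun=> m.+1%:R) (fun s => tnth s i)) => //.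
  exact: measurable_tnth.
rewrite -bigcap_seq; apply/seteqP; split=> s.
  by move=> h i _ /=; rewrite in_itv /=.
by move=> h i; have := h i (mem_index_enum i); rewrite /= in_itv.
Qed.

Let measurable_grid (psi : N.-tuple R -> R) m : measurable_fun setT (psi \o grid m).
Proof.
move=> _ Y mY; rewrite setTI.
pose val (z : N.-tuple int) : N.-tuple R := [tuple (tnth z i)%:~R / m.+1%:R | i < N].
rewrite (_ : _ @^-1` Y = \bigcup_k (if unpickle k is Some z then
  (if `[< Y (psi (val z)) >] then cell m z else set0) else set0)).
  apply: bigcupT_measurable => k; case: (unpickle k) => [z|//].
  by case: ifP => _.
apply/seteqP; split => [s /= Ys|s [k _]].
  exists (pickle [tuple Num.floor (m.+1%:R * tnth s i) | i < N]) => //.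
  rewrite pickleK ifT.
    by move=> i; rewrite tnth_mktuple; exact: floor_itv.
  apply/asboolP; move: Ys.
  rewrite (_ : grid m s = val [tuple Num.floor (m.+1%:R * tnth s i) | i < N])//.
  by apply: eq_from_tnth => i; rewrite !tnth_mktuple.
case: (unpickle k) => [z|//]; case: asboolP => // Yz sz; rewrite /preimage /=.
suff -> : grid m s = val z by [].
apply: eq_from_tnth => i; rewrite !tnth_mktuple; congr (_%:~R / _).
exact: floor_def.
Qed.

(** Continuity refers to row vectors and measurability to tuples. The bridge is psi evaluated at the
    grid point of mesh 1/(m+1) below s: it is constant on countably many measurable cells and
    converges to psi by continuity. *)
Lemma measurable_continuous_rV (psi : N.-tuple R -> R) :
  continuous (fun x : 'rV[R]_N => psi [tuple x ord0 i | i < N]) ->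
  measurable_fun setT psi.
Proof.
move=> cpsi; apply: (@measurable_fun_cvg _ _ _ _ (fun m => psi \o grid m)) => [m|s _].
  exact: (@measurable_grid psi m).
pose G := fun x : 'rV[R]_N => psi [tuple x ord0 i | i < N].
have GE (t : N.-tuple R) : psi t = G (row t).
  by congr psi; apply: eq_from_tnth => i; rewrite tnth_mktuple mxE.
rewrite GE [X in X @ _ --> _](_ : _ = fun m => G (row (grid m s))); last first.
  by apply/funext => m /=; rewrite GE.
apply: continuous_cvg; first exact: cpsi.
apply/cvg_ballP => e e0; near=> m; split => // i j; rewrite !mxE tnth_mktuple /ball /=.
have m0 : 0 < m.+1%:R :> R by [].
have me : m.+1%:R^-1 < e by near: m; exact: near_infty_natSinv_lt (PosNum e0).
have /andP[h1 h2] := floor_itv (m.+1%:R * tnth s j).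
set z := Num.floor _ in h1 h2 *.
have -> : tnth s j - z%:~R / m.+1%:R = (m.+1%:R * tnth s j - z%:~R) / m.+1%:R.
  by field; rewrite ?pnatr_eq0 // gt_eqF.
rewrite ger0_norm ?divr_ge0 ?subr_ge0// (le_lt_trans _ me)//.
rewrite -[leRHS]mul1r ler_wpM2r// lerBlDl.
by move: h2; rewrite intrD => /ltW.
Unshelve. all: by end_near. Qed.

End continuous_measurable.

Section weak_derivatives.
Context (R : realType) (N : nat) (a b : 'I_N -> R) (ab : forall i, a i < b i).
Local Notation mu := (lebesgueN R N).
Local Notation Om := (box a b).
Local Notation vfun n := (N.-tuple R -> 'cV[R]_n).

Let mOm : measurable Om := measurable_box a b.
Let abW i : a i <= b i := ltW (ab i).

Let Omfin : (mu Om < +oo)%E := lebesgueN_box_fin a b.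

Lemma continuous_box_bounded (psi : N.-tuple R -> R) :
  continuous (fun x : 'rV[R]_N => psi [tuple x ord0 i | i < N]) ->
  exists M, forall s, Om s -> `|psi s| <= M.
Proof.
move=> cpsi.
pose A := [set v : 'rV[R]_N | forall i, `[a i, b i]%classic (v ord0 i)].
have cA : compact A.
  apply: (@rV_compact R N (fun i => `[a i, b i]%classic)) => i.
  exact: segment_compact.
have A0 : A !=set0.
  by exists (\row_i a i) => i; rewrite mxE /= in_itv /= lexx abW.
have [|c _ hc] := @EVT_max_rV R N (fun x => `|psi [tuple x ord0 i | i < N]|) A A0 cA.
  apply: continuous_subspaceT => x.
  by apply: (continuous_comp (cpsi x)); exact: norm_continuous.
exists `|psi [tuple c ord0 i | i < N]| => s Os.
have := hc (\row_i tnth s i).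
rewrite (_ : [tuple (\row_i tnth s i : 'rV[R]_N) ord0 i | i < N] = s).
  by apply; apply/mem_set => i; rewrite mxE /= in_itv /=.
by apply: eq_from_tnth => i; rewrite tnth_mktuple mxE.
Qed.

Lemma mderiv_foldr al (phi : N.-tuple R -> R) :
  exists l, mderiv al phi = foldr (@pderiv R N) phi l.
Proof.
rewrite /mderiv /comp_all; elim: (index_enum _) => [|i r [l IH]].
  by exists [::]; rewrite big_nil.
exists (nseq (al i) i ++ l); rewrite big_cons foldr_cat /= IH.
by elim: (al i) => //= k ->.
Qed.

Lemma test_fun_mderiv al phi : test_fun a b phi ->
  measurable_fun Om (mderiv al phi) /\
  exists M, forall s, Om s -> `|mderiv al phi s| <= M.
Proof.
move=> [sp _]; have [l ->] := mderiv_foldr al phi; have [cp _] := sp l.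
split; last exact: continuous_box_bounded.
by apply: measurable_funTS; exact: measurable_continuous_rV.
Qed.

Lemma test_fun_bounded phi : test_fun a b phi ->
  measurable_fun Om phi /\ exists M, forall s, Om s -> `|phi s| <= M.
Proof.
move=> [sp _]; have [cp _] := sp [::].
split; last exact: continuous_box_bounded.
by apply: measurable_funTS; exact: measurable_continuous_rV.
Qed.

Lemma weak_derivD n al c (u v w z : vfun n) : L2 a b u -> L2 a b v -> L2 a b w ->
  L2 a b z -> weak_deriv a b al u w -> weak_deriv a b al v z ->
  weak_deriv a b al (fun s => u s + c *: v s) (fun s => w s + c *: z s).
Proof.
move=> su sv sw sz h1 h2 phi tphi k.
have [m1 [M1 b1]] := test_fun_mderiv al tphi; have [m2 [M2 b2]] := test_fun_bounded tphi.
have lin (x y : vfun n) (g : N.-tuple R -> R) M : L2 a b x -> L2 a b y ->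
    measurable_fun Om g -> (forall s, Om s -> `|g s| <= M) ->
    \int[mu]_(s in Om) ((x s + c *: y s) k 0 * g s) =
    \int[mu]_(s in Om) (x s k 0 * g s) + c * \int[mu]_(s in Om) (y s k 0 * g s).
  move=> sx sy mg gM.
  have ix := le_integrable_mul mOm (sqint_integrable mOm Omfin (sx k)) mg gM.
  have iy := le_integrable_mul mOm (sqint_integrable mOm Omfin (sy k)) mg gM.
  rewrite -RintegralZl// -RintegralD//; last exact: (integrableZl mOm _ iy).
  by apply: eq_Rintegral => s _; rewrite !mxE mulrDl mulrA.
rewrite (lin _ _ _ M1)// (lin _ _ _ M2)// h1// h2//; ring.
Qed.

Lemma weak_tensor n al (u w : vfun n) phi k : weak_deriv a b al u w ->
  (forall i, test1 (a i) (b i) (phi i)) ->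
  \int[mu]_(s in Om) (cmp u k s * tensor (dtensor al phi) s) =
  (-1) ^+ (\sum_i al i)%N * \int[mu]_(s in Om) (cmp w k s * tensor phi s).
Proof.
move=> h tphi; rewrite -mderiv_tensor; last by move=> i; have [] := tphi i.
exact: (h _ (test_fun_tensor tphi) k).
Qed.

Lemma sign_inj m (x y : R) : (-1) ^+ m * x = (-1) ^+ m * y -> x = y.
Proof. by move=> /(congr1 ( *%R ((-1) ^+ m))); rewrite !signrMK. Qed.

Lemma fundamentalN_eq (f g : N.-tuple R -> R) :
  mu.-integrable Om (EFin \o f) -> mu.-integrable Om (EFin \o g) ->
  (forall phi, (forall i, test1 (a i) (b i) (phi i)) ->
    \int[mu]_(s in Om) (f s * tensor phi s) =
    \int[mu]_(s in Om) (g s * tensor phi s)) ->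
  {ae mu, forall s, Om s -> f s = g s}.
Proof.
move=> fi gi h.
have : {ae mu, forall s, Om s -> f s - g s = 0}.
  apply: (@fundamentalN R N a b (fun s => f s - g s)) => //.
    exact: (integrableB mOm fi gi).
  move=> phi tphi; have sp i : smooth1 (phi i) by have [] := tphi i.
  have := h _ tphi => /eqP; rewrite -subr_eq0 -RintegralB//;
    [move=> /eqP <-|exact: integrable_tensor..].
  by apply: eq_Rintegral => s _; rewrite mulrBl.
by apply: filterS => s h0 Os; apply/eqP; rewrite -subr_eq0 h0.
Qed.

(** Tensor tests separate square-integrable functions, so [Deriv], a choice by [xget], is determined
    almost everywhere. *)
Lemma weak_unique n al (u w w' : vfun n) : L2 a b w -> L2 a b w' ->
  weak_deriv a b al u w -> weak_deriv a b al u w' -> eq_ae a b w w'.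
Proof.
move=> sw sw' h h'; apply/eq_ae_cmp => k.
apply: fundamentalN_eq; [exact: (sqint_integrable mOm Omfin (sw k))|
  exact: (sqint_integrable mOm Omfin (sw' k))|].
move=> phi tphi; apply: (@sign_inj (\sum_i al i)%N).
by rewrite -(weak_tensor k h tphi) -(weak_tensor k h' tphi).
Qed.

Lemma Deriv_spec n delta al (u : vfun n) : S2 a b delta u ->
  (forall i, al i <= delta i)%N ->
  L2 a b (Deriv a b al u) /\ weak_deriv a b al u (Deriv a b al u).
Proof.
move=> [_ h] hal; have [w sw hw] := h al hal.
exact: (@xgetPex _ (fun=> 0) [set w | L2 a b w /\ weak_deriv a b al u w]
  (ex_intro _ w (conj sw hw))).
Qed.

Lemma S2_lin n delta c (u v : vfun n) : S2 a b delta u -> S2 a b delta v ->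
  S2 a b delta (fun s => u s + c *: v s).
Proof.
move=> hu hv; have [su _] := hu; have [sv _] := hv.
split; first by apply: L2D => //; exact: L2Z.
move=> al hal; have [sw hw] := Deriv_spec hu hal; have [sz hz] := Deriv_spec hv hal.
exists (fun s => Deriv a b al u s + c *: Deriv a b al v s).
  by apply: L2D => //; exact: L2Z.
exact: weak_derivD.
Qed.

Lemma Deriv_lin n delta al c (u v : vfun n) : S2 a b delta u -> S2 a b delta v ->
  (forall i, al i <= delta i)%N ->
  eq_ae a b (Deriv a b al (fun s => u s + c *: v s))
    (fun s => Deriv a b al u s + c *: Deriv a b al v s).
Proof.
move=> hu hv hal; have [su _] := hu; have [sv _] := hv.
have [sw hw] := Deriv_spec hu hal; have [sz hz] := Deriv_spec hv hal.
have [sx hx] := Deriv_spec (S2_lin c hu hv) hal.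
apply: weak_unique hx _ => //; first by apply: L2D => //; exact: L2Z.
exact: weak_derivD.
Qed.

Lemma Deriv0 n (u : vfun n) : L2 a b u -> eq_ae a b (Deriv a b (fun=> 0%N) u) u.
Proof.
move=> su.
have wd : weak_deriv a b (fun=> 0%N) u u.
  move=> phi tphi k; rewrite big1// expr0 mul1r; apply: eq_Rintegral => s _.
  congr (_ * _); rewrite /mderiv /comp_all; elim: (index_enum _) => [|i r IH].
    by rewrite big_nil.
  by rewrite big_cons.
have hS : S2 a b (fun=> 0%N) u.
  split => // al hal; exists u => //.
  rewrite (_ : al = fun=> 0%N)//; apply/funext => i; apply/eqP.
  by rewrite -leqn0; exact: hal.
have [sw hw] := Deriv_spec hS (fun i => leqnn _).
exact: weak_unique hw wd.
Qed.

(** An equality of functions, not of classes: the set from which [Deriv] chooses depends on u only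
    up to null sets. It identifies D^delta u(0) with D^delta u_0. *)
Lemma Deriv_eq_ae n al (u v : vfun n) : L2 a b u -> L2 a b v -> eq_ae a b u v ->
  Deriv a b al u = Deriv a b al v.
Proof.
move=> su sv uv; rewrite /Deriv; congr xget; apply/seteqP.
have E phi k : test_fun a b phi ->
    \int[mu]_(s in Om) (u s k 0 * mderiv al phi s) =
    \int[mu]_(s in Om) (v s k 0 * mderiv al phi s).
  move=> tphi; have [m1 _] := test_fun_mderiv al tphi.
  apply: ae_eq_Rintegral => //.
  - by apply: measurable_funM => //; exact: (su k).1.
  - by apply: measurable_funM => //; exact: (sv k).1.
  - by apply: filterS uv => s h Os; rewrite h.
by split=> w [sw hw]; split => // phi tphi k; [rewrite -E|rewrite E] => //; exact: hw.
Qed.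

End weak_derivatives.

(** * The du Bois-Reymond lemma and continuous representatives *)

Section dubois_reymond.
Context (R : realType) (a b : R) (ab : a < b).
Local Notation leb := (@lebesgue_measure R).
Local Notation Rm := (measurableTypeR R).
Local Notation I := (`[a, b]%classic : set Rm).

Let mI : measurable I. Proof. exact: measurable_itv. Qed.
Let abW : a <= b := ltW ab.

Lemma Rintegral_FTC2 (F f : R -> R) x y : x <= y -> continuous f ->
  (forall z, is_derive z (1 : R) F (f z)) ->
  \int[leb]_(t in `[x, y]) f t = F y - F x.
Proof.
rewrite le_eqVlt => /predU1P[<- _ _|xy cf dF].
  by rewrite set_itv1 Rintegral_set1 subrr.
have cF : continuous F.
  by move=> z; apply/differentiable_continuous/derivable1_diffP; have [] := dF z.
rewrite /Rintegral (@continuous_FTC2 _ f F _ _ xy)//.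
- exact: continuous_subspaceT.
- split; first by move=> z _; have [] := dF z.
    exact/cvg_at_right_filter/cF.
  exact/cvg_at_left_filter/cF.
- by move=> z _; have /is_derive1P[] := dF z.
Qed.

Lemma smooth1_is_derive (f : R -> R) x : smooth1 f -> is_derive x (1 : R) f (derive1 f x).
Proof. by move=> sf; apply/is_derive1P; split => //; exact: smooth1_derivable. Qed.

Lemma test1_bound_right phi x : test1 a b phi -> b <= x -> phi x = 0.
Proof.
move=> [_ [e e0 h]] bx; apply/eqP/negPn/negP => /h /andP[_].
by apply/negP; rewrite -ltNge; lra.
Qed.

Lemma test1_bound_left phi x : test1 a b phi -> x <= a -> phi x = 0.
Proof.
move=> [_ [e e0 h]] bx; apply/eqP/negPn/negP => /h /andP[+ _].
by apply/negP; rewrite -ltNge; lra.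
Qed.

Lemma smooth1_integrable x y f : x <= y -> smooth1 f ->
  leb.-integrable `[x, y] (EFin \o f).
Proof.
move=> xy sf; apply: continuous_compact_integrable; first exact: segment_compact.
by apply: continuous_subspaceT; exact: smooth1_continuous.
Qed.

(** The primitive from a vanishes to the left of the support, and to its right because the mean is
    0. *)
Lemma test1_primitive th : test1 a b th -> \int[leb]_(t in I) th t = 0 ->
  exists2 phi, test1 a b phi & derive1 phi = th.
Proof.
move=> tth i0; have [sth [e e0 he]] := tth.
pose phi x := \int[leb]_(t in `[a, x]) th t.
have phi_left x : x < a + e -> phi x = 0.
  move=> xe; rewrite /phi -[RHS](@mul0r _ (fine (leb `[a, x]))) -Rintegral_cst//.
  apply: eq_Rintegral => t; rewrite inE /= in_itv /= => /andP[at_ tx].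
  apply/eqP/negPn/negP => /he /andP[+ _].
  by apply/negP; rewrite -ltNge; exact: le_lt_trans xe.
have phi_right x : b - e < x -> phi x = 0.
  move=> xe; have [xa|ax] := ltP x a; first by apply: phi_left; lra.
  (* Since x may lie beyond b, the integrals up to x and up to b are both compared with the integral
     up to the larger endpoint: th vanishes beyond b - e. *)
  pose y := Num.max x b.
  have yb : \int[leb]_(t in `[a, y]) th t = \int[leb]_(t in I) th t.
    rewrite (@Rintegral_lower _ _ y)// /y ?le_max ?lexx ?orbT//.
    apply: eq_Rintegral => t _; have [//|bt] := leP t b; rewrite ?mul1r// mul0r.
    by apply: (test1_bound_right tth); exact: ltW.
  have yx : \int[leb]_(t in `[a, y]) th t = phi x.
    rewrite /phi (@Rintegral_lower _ _ y)// /y ?le_max ?lexx//.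
    apply: eq_Rintegral => t _; have [//|xt] := leP t x; rewrite ?mul1r// mul0r.
    apply/eqP/negPn/negP => /he /andP[_].
    by apply/negP; rewrite -ltNge; exact: lt_trans xt.
  by rewrite -yx yb.
have dphi x : is_derive x (1 : R) phi (th x).
  have [xa|ax] := leP x a.
    rewrite (test1_bound_left tth xa).
    apply: (@near_eq_is_derive _ _ _ (cst 0)).
    near=> y; rewrite phi_left//; near: y; apply: lt_nbhsl; lra.
  apply/is_derive1P; apply: (@continuous_FTC1_closed _ _ _ _ (x + 1)) => //.
  - by rewrite ltrDl.
  - by apply: smooth1_integrable => //; lra.
  - exact: smooth1_continuous.
have dE : derive1 phi = th by apply/funext => x; have /is_derive1P[] := dphi x.
exists phi; [split|exact: dE].
  case=> [|k] x; first by have [] := dphi x.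
  by rewrite /derive1n iterSr dE; exact: sth.
exists e => // x; apply: contraNT; rewrite negb_and -!ltNge => /orP[h|h]; apply/eqP.
  exact: phi_left.
exact: phi_right.
Unshelve. all: by end_near. Qed.

Lemma test1_lin c phi psi : test1 a b phi -> test1 a b psi ->
  test1 a b (fun x => phi x + c * psi x).
Proof.
move=> [s1 [e1 e10 h1]] [s2 [e2 e20 h2]]; split.
  exact: smooth1D s1 (smooth1M (@smooth1_cst R c) s2).
exists (Num.min e1 e2); first by rewrite lt_min e10.
move=> x h; have : (phi x != 0) || (psi x != 0).
  apply: contraNT h; rewrite negb_or !negbK => /andP[/eqP -> /eqP ->].
  by rewrite mulr0 addr0.
have m1 : Num.min e1 e2 <= e1 by rewrite ge_min lexx.
have m2 : Num.min e1 e2 <= e2 by rewrite ge_min lexx orbT.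
by move=> /orP[/h1|/h2] /andP[? ?]; apply/andP; split; lra.
Qed.

(** A test of mean 0 is the derivative of a test, and subtracting a suitable multiple of a fixed
    bump psi0 gives any test mean 0. This forces c to be the integral of f psi0 divided by that of
    psi0. *)
Lemma dubois_reymond f : leb.-integrable I (EFin \o f) ->
  (forall phi, test1 a b phi -> \int[leb]_(x in I) (f x * derive1 phi x) = 0) ->
  exists c, {ae leb, forall x, I x -> f x = c}.
Proof.
move=> fi H.
have ab' := ab; pose p := a + (b - a) / 3; pose q := a + 2 * (b - a) / 3.
have ap : a < p by rewrite /p; lra.
have pq : p < q by rewrite /p /q; lra.
have qb : q < b by rewrite /q; lra.
pose psi0 := bump p q 0.
have t0 : test1 a b psi0 by exact: test1_bump.
have int phi : test1 a b phi -> leb.-integrable I (EFin \o phi).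
  by move=> [sp _]; exact: smooth1_integrable.
have fint phi : test1 a b phi -> leb.-integrable I (EFin \o (fun x => f x * phi x)).
  by move=> [sp _]; exact: integrable_itv_smooth1.
pose J := \int[leb]_(x in I) psi0 x.
(* A nonnegative function of integral 0 vanishes almost everywhere, but psi0 is positive on ]p, q[,
   which has positive length. *)
have J0 : J != 0.
  apply/negP => /eqP J0.
  have : {ae leb, forall x, I x -> psi0 x = 0}.
    have z : (\int[leb]_(x in I) (psi0 x)%:E = 0)%E.
      by rewrite -[LHS](fineK (integrable_fin_num mI (int _ t0))) (_ : fine _ = J) ?J0.
    have mpsi : measurable_fun I (EFin \o psi0) by have /integrableP[] := int _ t0.
    have psi_ge0 x : (0 <= (EFin \o psi0) x)%E.
      by rewrite /= lee_fin; have /andP[] := bump_itv p q 0 x.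
    have := (@ge0_integral_eq0 _ _ _ leb I (EFin \o psi0) mI mpsi psi_ge0).1 z.
    by apply: filterS => x + Ix => /(_ Ix) [].
  move=> [A [mA A0 hA]].
  have sub : `]p, q[%classic `<=` A.
    move=> x; rewrite /= in_itv /= => pxq; apply: hA => /=.
    apply/not_implyP; split.
      by move: pxq => /andP[? ?]; rewrite /= in_itv /=; apply/andP; split; lra.
    by apply/eqP; rewrite gt_eqF// bump_gt0.
  have : leb (`]p, q[%classic : set Rm) = 0%E.
    by apply: (subset_measure0 _ mA sub A0); exact: measurable_itv.
  by rewrite lebesgue_measure_itv /= lte_fin pq -EFinB => /eqP; rewrite eqe subr_eq0 gt_eqF.
pose c := (\int[leb]_(x in I) (f x * psi0 x)) / J.
exists c.
have : {ae leb, forall x, I x -> f x - c = 0}.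
  apply: fundamental1 => //.
    have ic : leb.-integrable I (EFin \o (fun=> c)).
      exact: (sqint_integrable mI (leb_itv_fin abW) (sqint_cst mI (leb_itv_fin abW) c)).
    exact: (integrableB mI fi ic).
  move=> p' q' m ap' pq' qb'.
  pose psi := bump (ratr p' : R) (ratr q') m.
  have tpsi : test1 a b psi by exact: test1_bump.
  pose k := - (\int[leb]_(x in I) psi x / J).
  pose th x := psi x + k * psi0 x.
  have tth : test1 a b th by exact: test1_lin.
  have ith : \int[leb]_(x in I) th x = 0.
    rewrite RintegralD//; [|exact: int|exact: (integrableZl mI _ (int _ t0))].
    by rewrite RintegralZl//; [rewrite -/J /k mulNr divfK// subrr|exact: int].
  have [phi tphi dphi] := test1_primitive tth ith.
  have := H _ tphi; rewrite dphi.
  have -> : \int[leb]_(x in I) (f x * th x) =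
      \int[leb]_(x in I) (f x * psi x) + k * \int[leb]_(x in I) (f x * psi0 x).
    rewrite -RintegralZl//; last exact: fint.
    rewrite -RintegralD//; [|exact: fint|exact: (integrableZl mI _ (fint _ t0))].
    by apply: eq_Rintegral => x _; rewrite /th; ring.
  move=> h.
  have -> : \int[leb]_(x in I) ((f x - c) * psi x) =
      \int[leb]_(x in I) (f x * psi x) - c * \int[leb]_(x in I) psi x.
    rewrite -RintegralZl//; last exact: int.
    rewrite -RintegralB//; [|exact: fint|exact: (integrableZl mI _ (int _ tpsi))].
    by apply: eq_Rintegral => x _; ring.
  by rewrite -[RHS]h /c /k; congr (_ + _); field.
by apply: filterS => x h Ix; apply/eqP; rewrite -subr_eq0 h.
Qed.

(** In the open interval h is the derivative of its primitive, which is identically 0; the endpoints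
    follow by one-sided limits. *)
Lemma continuous_ae0 (h : R -> R) : {within `[a, b], continuous h} ->
  {ae leb, forall x, I x -> h x = 0} -> forall x, I x -> h x = 0.
Proof.
move=> ch h0.
have hi : leb.-integrable I (EFin \o h).
  exact: continuous_compact_integrable (@segment_compact _ _ _) ch.
have mh : measurable_fun I h by apply/measurable_EFinP; exact: measurable_int hi.
have hin x : a < x < b -> h x = 0.
  move=> /andP[ax xb].
  have cx : {for x, continuous h}.
    by apply: (within_continuous_continuous ab ch); rewrite in_itv /= ax.
  have [_ <-] := continuous_FTC1_closed xb hi ax cx.
  rewrite derive1E (@near_eq_derive _ _ _ _ (fun=> 0)) ?derive_cst//.
  near=> y.
  have yb : y <= b by apply: ltW; near: y; exact: lt_nbhsl.
  rewrite (@Rintegral_lower _ _ b)// -[RHS](@mul0r _ (fine (leb I))).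
  rewrite -Rintegral_cst//; apply: ae_eq_Rintegral => //.
    apply: measurable_funM => //; apply: measurable_funTS.
    rewrite (_ : (fun x => _) = \1_(`]-oo, y]%classic : set Rm)).
      by apply: measurable_indic; exact: measurable_itv.
    by apply/funext => z; rewrite indicE mem_setE in_itv.
  by apply: filterS h0 => z hz Iz; rewrite hz// mulr0.
have /(continuous_within_itvP _ ab)[_ ha hb] := ch.
move=> x; rewrite /= in_itv /= => /andP[ax xb].
have [->|xa] := eqVneq x a.
  apply: (cvg_unique (@Rhausdorff R) ha).
  apply: cvg_near_cst.
  near=> y; rewrite hin//; apply/andP; split; near: y; [exact: nbhs_right_gt|].
  exact: nbhs_right_lt.
have [->|xb'] := eqVneq x b.
  apply: (cvg_unique (@Rhausdorff R) hb).
  apply: cvg_near_cst.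
  near=> y; rewrite hin//; apply/andP; split; near: y; [exact: nbhs_left_gt|].
  exact: nbhs_left_lt.
by apply: hin; rewrite !lt_neqAle ax xb eq_sym xa xb'.
Unshelve. all: by end_near. Qed.

Let bkle := (bker_le (R := R) I).

(** g and the primitive F of w have the same weak derivative, so g - F is constant almost
    everywhere, hence everywhere by continuity; its value is read at a, where F is 0. *)
Lemma weak_FTC (g w : R -> R) : {within `[a, b], continuous g} -> sqint leb I w ->
  (forall phi, test1 a b phi ->
    \int[leb]_(x in I) (g x * derive1 phi x) = - \int[leb]_(x in I) (w x * phi x)) ->
  forall x, I x -> g x = g a + \int[leb]_(t in `[a, x]) w t.
Proof.
move=> cg sw H.
have wi := sqint_integrable mI (leb_itv_fin abW) sw.
have gi : leb.-integrable I (EFin \o g).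
  exact: continuous_compact_integrable (@segment_compact _ _ _) cg.
pose F x := \int[leb]_(t in `[a, x]) w t.
have cF : {within `[a, b], continuous F}.
  exact: parameterized_integral_continuous abW wi.
have Fi : leb.-integrable I (EFin \o F).
  exact: continuous_compact_integrable (@segment_compact _ _ _) cF.
(* The primitive is an integral operator with indicator kernel; its transpose applied to phi' is the
   integral of phi' over [x, b], that is, - phi x. *)
have HF phi : test1 a b phi ->
    \int[leb]_(x in I) (F x * derive1 phi x) = - \int[leb]_(x in I) (w x * phi x).
  move=> tphi; have [sp _] := tphi; have sp' := smooth1_derive sp.
  have [mk [M hM]] := bkle.
  have sd : sqint leb I (derive1 phi).
    have [M' hM'] := smooth1_bounded abW sp'.
    exact: (sqint_bounded mI (leb_itv_fin abW) (smooth1_measurableR sp') hM').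
  have := kernel1_adjoint abW mk hM sw sd.
  rewrite (_ : \int[leb]_(x in I) _ = \int[leb]_(x in I) (F x * derive1 phi x)); last first.
    apply: eq_Rintegral => x; rewrite inE /= in_itv /= => /andP[_ xb].
    by rewrite /F (Rintegral_lower _ _ xb).
  move=> ->; rewrite -mulN1r -RintegralZl//; last exact: integrable_itv_smooth1.
  apply: eq_Rintegral => x; rewrite inE /= in_itv /= => /andP[ax xb].
  rewrite -(Rintegral_upper _ _ ax).
  rewrite (Rintegral_FTC2 xb (smooth1_continuous sp') (fun z => smooth1_is_derive z sp)).
  by rewrite (test1_bound_right tphi (lexx b)) sub0r mulrN mulN1r.
have [|phi tphi|c hc] := @dubois_reymond (fun x => g x - F x).
- exact: (integrableB mI gi Fi).
- have [sp _] := tphi; have sp' := smooth1_derive sp.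
  have := H _ tphi; rewrite -HF// => h.
  rewrite (_ : \int[leb]_(x in I) _ = \int[leb]_(x in I) (g x * derive1 phi x) -
    \int[leb]_(x in I) (F x * derive1 phi x)); first by rewrite h subrr.
  rewrite -RintegralB//; [|exact: integrable_itv_smooth1..].
  by apply: eq_Rintegral => x _; rewrite mulrBl.
have hc' x : I x -> g x - F x - c = 0.
  apply: (@continuous_ae0 (fun x => g x - F x - c)).
    apply/subspace_continuousP => y Iy; apply: cvgB; last exact: cvg_cst.
    by apply: cvgB; [move/subspace_continuousP : cg|move/subspace_continuousP : cF]; exact.
  by apply: filterS hc => y h Iy; rewrite h// subrr.
have F0 : F a = 0 by rewrite /F set_itv1 Rintegral_set1.
move=> x Ix; have := hc' x Ix; have := hc' a.
rewrite F0 subr0 /= in_itv /= lexx abW => /(_ isT) /eqP; rewrite subr_eq0 => /eqP ->.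
by move=> /eqP; rewrite subr_eq0 subr_eq => /eqP.
Qed.

End dubois_reymond.

(** * Taylor's formula with integral remainder *)

Section taylor.
Context (R : realType) (a b : R) (ab : a < b).
Local Notation leb := (@lebesgue_measure R).
Local Notation Rm := (measurableTypeR R).
Local Notation I := (`[a, b]%classic : set Rm).

Let mI : measurable I. Proof. exact: measurable_itv. Qed.
Let abW : a <= b := ltW ab.

Lemma Rintegral_mono x y m : x <= y ->
  \int[leb]_(t in `[x, y]) mono m (t - x) = mono m.+1 (y - x).
Proof.
move=> xy.
have d z : is_derive z (1 : R) (mono m.+1 \o (fun t => t - x)) (mono m (z - x)).
  have d2 : is_derive z (1 : R) (fun t : R => t - x) 1.
    rewrite (_ : (fun t : R => _) = (fun t => 1 * t + - x)); first exact: is_derive_affine.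
    by apply/funext => t; rewrite mul1r.
  have := @is_derive1_comp _ (mono m.+1) (fun t => t - x) z _ _
    (is_derive_mono m.+1 (z - x)) d2.
  by rewrite mulr1.
rewrite (Rintegral_FTC2 xy _ d).
  by rewrite /= subrr /mono expr0n mul0r subr0.
rewrite (mono_horner R m) => z; apply: (@continuous_comp _ _ _ (fun t => t - x)).
  by apply: cvgB; [exact: cvg_id|exact: cvg_cst].
exact: continuous_horner.
Qed.

Lemma sqint_sub x w : I x -> sqint leb I w ->
  sqint leb (`[a, x]%classic : set Rm) w.
Proof.
rewrite /= in_itv /= => /andP[ax xb] [mw iw].
have sub : `[a, x]%classic `<=` I.
  by move=> y /=; rewrite !in_itv /= => /andP[-> h]; exact: le_trans xb.
have mx : measurable (`[a, x]%classic : set Rm) by exact: measurable_itv.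
by split; [exact: measurable_funS mw|exact: integrableS iw].
Qed.

Let ibd x : a <= x -> exists a0 b0 : R, a0 <= b0 /\
  (`[a, x]%classic : set Rm) `<=` `[a0, b0]%classic.
Proof. by move=> ax; exists a, x; split. Qed.

Lemma bker_lemono x m : a <= x -> bker (`[a, x]%classic : set Rm)
  (fun p : Rm * Rm => ((p.2 : R) <= p.1)%R%:R * mono m (p.1 - p.2)).
Proof. by move=> ax; apply: bkerM; [exact: bker_le|exact: (bker_monoB (ibd ax))]. Qed.

(** Exchanging the integrals over the triangle th <= y <= x leaves the integral of the kernel in y,
    which is the next divided power. The exchange is [kernel1_adjoint] with second function 1. *)
Lemma Rintegral_iterated x m w : I x -> sqint leb I w ->
  \int[leb]_(y in `[a, x]) \int[leb]_(th in `[a, y]) (mono m (y - th) * w th) =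
  \int[leb]_(th in `[a, x]) (mono m.+1 (x - th) * w th).
Proof.
move=> Ix sw; have sw' := sqint_sub Ix sw.
have /andP[ax xb] : a <= x <= b by move: Ix; rewrite /= in_itv.
have mx : measurable (`[a, x]%classic : set Rm) by exact: measurable_itv.
have [mk [M hM]] := bker_lemono m ax.
have K := kernel1_adjoint ax mk hM sw' (sqint_cst mx (leb_itv_fin ax) 1).
apply: etrans (etrans _ K) _.
  apply: eq_Rintegral => y; rewrite inE /= in_itv /= => /andP[_ yx].
  rewrite mulr1 (Rintegral_lower _ _ yx).
  by apply: eq_Rintegral => th _; rewrite mulrA.
apply: eq_Rintegral => th; rewrite inE /= in_itv /= => /andP[ath thx].
rewrite mulrC -(Rintegral_mono m thx) (Rintegral_upper _ _ ath); congr (_ * _).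
by apply: eq_Rintegral => y _; rewrite mulr1.
Qed.

(** Induction on the length of the expansion: g j is g j a plus the integral of g j.+1, whose
    expansion is integrated term by term. The conditional makes w, which is merely
    square-integrable, the derivative of the last g. *)
Lemma taylor_int d (g : nat -> R -> R) w : sqint leb I w ->
  (forall k x, (k < d)%N -> I x -> g k x =
    g k a + \int[leb]_(t in `[a, x]) (if (k.+1 < d)%N then g k.+1 t else w t)) ->
  forall m j, (j + m.+1)%N = d -> forall x, I x -> g j x =
    \sum_(l < m.+1) mono l (x - a) * g (j + l)%N a +
    \int[leb]_(th in `[a, x]) (mono m (x - th) * w th).
Proof.
move=> sw H; elim=> [|m IH] j jd x Ix.
  rewrite big_ord1 addn0 mono0 mul1r H//; last by lia.
  congr (_ + _); apply: eq_Rintegral => th _.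
  by rewrite ifF; [rewrite mono0 mul1r|lia].
have /andP[ax xb] : a <= x <= b by move: Ix; rewrite /= in_itv.
have mx : measurable (`[a, x]%classic : set Rm) by exact: measurable_itv.
rewrite H//; last by lia.
rewrite (_ : \int[leb]_(t in `[a, x]) _ = \int[leb]_(t in `[a, x])
   (\sum_(l < m.+1) mono l (t - a) * g (j.+1 + l)%N a +
    \int[leb]_(th in `[a, t]) (mono m (t - th) * w th))); last first.
  apply: eq_Rintegral => t; rewrite inE /= in_itv /= => /andP[at_ tx].
  rewrite ifT; last by lia.
  by rewrite IH//; [lia|rewrite /= in_itv /= at_ (le_trans tx)].
have im (l : 'I_m.+1) : leb.-integrable `[a, x] (EFin \o (fun t => mono l (t - a) * g (j.+1 + l)%N a)).
  apply: continuous_compact_integrable; first exact: segment_compact.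
  apply: continuous_subspaceT; rewrite (mono_horner R l) => z.
  apply: cvgM; last exact: cvg_cst.
  apply: (@continuous_comp _ _ _ (fun t => t - a)); last exact: continuous_horner.
  by apply: cvgB; [exact: cvg_id|exact: cvg_cst].
have iK : leb.-integrable `[a, x]
    (EFin \o (fun t => \int[leb]_(th in `[a, t]) (mono m (t - th) * w th))).
  have sw' := sqint_sub Ix sw; have [mk [M hM]] := bker_lemono m ax.
  have e t : (`[a, x]%classic : set Rm) t ->
      \int[leb]_(th in (`[a, x]%classic : set Rm)) ((th <= t)%R%:R * mono m (t - th) * w th) =
      \int[leb]_(th in `[a, t]) (mono m (t - th) * w th).
    rewrite /= in_itv /= => /andP[_ tx]; rewrite (Rintegral_lower _ _ tx).
    by apply: eq_Rintegral => th _; rewrite mulrA.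
  have mK : measurable_fun (`[a, x]%classic : set Rm)
      (fun t => \int[leb]_(th in `[a, t]) (mono m (t - th) * w th)).
    apply: (eq_measurable_fun (fun t : Rm => \int[leb]_(th in (`[a, x]%classic : set Rm))
        ((th <= t)%R%:R * mono m (t - th) * w th))).
      by move=> t /set_mem; exact: e.
    apply: (@measurable_Rintegral_param _ _ _ _ _ leb _ (`[a, x]%classic : set Rm)
      (fun p => ((p.2 : R) <= p.1)%R%:R * mono m (p.1 - p.2) * w p.2)) => //.
    apply: measurable_funM; first exact: measurable_funTS.
    apply: (measurable_comp mx _ sw'.1); first by move=> _ [[? ?] [_ ?] <-].
    exact: measurable_funTS measurable_snd.
  apply: (sqint_integrable mx (leb_itv_fin ax)).
  (* [kernel1_bound] controls the square of the remainder y, and |y| <= 1 + y^2. *)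
  apply: (@sqint_bounded _ _ _ _ _ mx (leb_itv_fin ax) (1 + M ^+ 2 * (x - a) * ip leb (`[a, x]%classic : set Rm) w w) _ mK).
  move=> t It; rewrite -e//.
  have := kernel1_bound ax mk hM sw' It; set y := Rintegral _ _ _ => h.
  have := sqr_ge0 (`|y| - 1); rewrite -(real_normK (num_real y)) in h; nra.
rewrite RintegralD//; last first.
  have := @integrable_sum _ _ _ leb _ mx _ (index_enum 'I_m.+1) predT
    (fun l : 'I_m.+1 => EFin \o (fun t => mono l (t - a) * g (j.+1 + l)%N a)).
  move=> h; have {}h := h (fun i _ => im i).
  by apply: eq_integrable h => // t _ /=; rewrite sumEFin.
rewrite Rintegral_iterated//.
rewrite [in RHS]big_ord_recl mono0 mul1r addn0 -addrA; congr (_ + _).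
congr (_ + _); rewrite Rintegral_sum//; apply: eq_bigr => l _.
rewrite RintegralZr//; first by rewrite Rintegral_mono// lift0 addnS addSn.
apply: continuous_compact_integrable; first exact: segment_compact.
apply: continuous_subspaceT; rewrite (mono_horner R l) => z.
apply: (@continuous_comp _ _ _ (fun t => t - a)); last exact: continuous_horner.
by apply: cvgB; [exact: cvg_id|exact: cvg_cst].
Qed.

End taylor.

(** * Elimination of the boundary values *)

Section boundary_conditions.
Context (R : realType) (n d : nat) (a b : R) (ab : a < b).
Local Notation leb := (@lebesgue_measure R).
Local Notation Rm := (measurableTypeR R).
Local Notation I := (`[a, b]%classic : set Rm).
Context (B C : 'I_d -> 'I_d -> 'M[R]_n).
Hypothesis adm : admissible a b B C.

Let mI : measurable I. Proof. exact: measurable_itv. Qed.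
Let abW : a <= b := ltW ab.

Lemma mulmx_vintegral m p (D : set Rm) (M : 'M[R]_(m, p)) (f : R -> 'cV[R]_p) :
  measurable D -> (forall k, leb.-integrable D (EFin \o (fun x => f x k 0))) ->
  M *m vintegral D f = vintegral D (fun x => M *m f x).
Proof.
move=> mD fi; apply/colP => k; rewrite !mxE.
rewrite (_ : \int[leb]_(x in D) _ = \int[leb]_(x in D) \sum_c M k c * f x c 0); last first.
  by apply: eq_Rintegral => x _; rewrite mxE.
rewrite Rintegral_sum//; last by move=> c; exact: (integrableZl mD _ (fi c)).
by apply: eq_bigr => c _; rewrite mxE RintegralZl.
Qed.

Variables (g : 'I_d -> R -> 'cV[R]_n) (w : R -> 'cV[R]_n).
Hypothesis sw : forall c, sqint leb I (fun x => w x c 0).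
Hypothesis gE : forall (j : 'I_d) x, I x -> g j x =
  \sum_(l < d) (if (j <= l)%N then mono (l - j) (x - a) else 0) *: g l a +
  vintegral `[a, x] (fun th => mono (d - 1 - j) (x - th) *: w th).
Hypothesis bc : forall j, \sum_k (B j k *m g k a + C j k *m g k b) = 0.

(** The Taylor remainders at b of all derivatives at once: block j is that of g j ([WE]). *)
Let W := vintegral I (fun th => Ed n d (b - th) *m w th).

Let intEd k : leb.-integrable I (EFin \o (fun th => (Ed n d (b - th) *m w th) k 0)).
Proof.
have Ib : exists a0 b0, a0 <= b0 /\ I `<=` `[a0, b0]%classic by exists a, b; split.
have i c : leb.-integrable I (EFin \o (fun th => Ed n d (b - th) k c * w th c 0)).
  have [p hp] := @Ed_poly R n d k c.
  have [mk [M hM]] := bker_poly2 Ib (p \Po (b%:P - 'X)).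
  have bI : I b by rewrite /= in_itv /= abW lexx.
  have mk1 : measurable_fun I (fun th : Rm => Ed n d (b - th) k c).
    rewrite (_ : (fun th => _) = (fun z : Rm * Rm => (p \Po (b%:P - 'X)).[z.2]) \o
        (fun th : Rm => ((b : Rm), th))); last first.
      by apply/funext => th; rewrite /= horner_comp !hornerE hp.
    by apply: measurable_funTS; apply: measurableT_comp mk _; exact: measurable_fun_pair.
  have kM th : I th -> `|Ed n d (b - th) k c| <= M.
    by move=> Ith; have := hM b th bI Ith; rewrite /= horner_comp !hornerE hp.
  have := le_integrable_mul mI (sqint_integrable mI (leb_itv_fin abW) (sw c)) mk1 kM.
  by apply: eq_integrable => // th _ /=; rewrite mulrC.
have := @integrable_sum _ _ _ leb _ mI _ (index_enum 'I_n) predT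
  (fun c => EFin \o (fun th => Ed n d (b - th) k c * w th c 0)) (fun c _ => i c).
by apply: eq_integrable => // th _ /=; rewrite sumEFin mxE.
Qed.

Let ga := \mxcol_(k < d) g k a.
Let gb := \mxcol_(k < d) g k b.

Let IbP : I b. Proof. by rewrite /= in_itv /= abW lexx. Qed.

Let WE : W = \mxcol_(j < d) vintegral I (fun th => mono (d - 1 - j) (b - th) *: w th).
Proof.
apply/colP => k; rewrite !mxE; apply: eq_Rintegral => th _.
rewrite /Ed mxcol_mul !mxE (bigD1 (tagnat.sig2 k))//= !mxE eqxx mulr1n subn1.
by rewrite big1 ?addr0// => c /negbTE h; rewrite !mxE eq_sym h mulr0n mul0r.
Qed.

Let gbE : gb = Qmx n d (b - a) *m ga + W.
Proof.
rewrite /gb /ga /Qmx mul_mxblock_mxrow WE -mxcolD; apply: eq_mxcol => j.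
rewrite gE//; congr (_ + _).
apply: eq_bigr => l _; case: ifP => _; last by rewrite scale0r mul0mx.
by rewrite mul_scalar_mx.
Qed.

(** Substituting [gbE] in the boundary conditions gives (H_a + H_b Q) ga = - H_b W, and
    admissibility inverts the matrix on the left. This is the origin of K. *)
Let gaE : ga = - (Kmx a b B C *m W).
Proof.
have h : Hmx B *m ga + Hmx C *m gb = 0.
  rewrite /Hmx /ga /gb !mul_mxblock_mxrow -mxcolD -[RHS](mxcol0 _); apply: eq_mxcol => j.
  by rewrite -big_split /= bc.
move: h; rewrite gbE mulmxDr addrA mulmxA -mulmxDl => /eqP.
rewrite addr_eq0 => /eqP h.
by rewrite /Kmx -mulmxA -mulmxN -h mulmxA mulVmx ?mul1mx//; exact: adm.
Qed.

(** The Taylor polynomial of g j is the transpose of [E1] at order j applied to the values at a,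
    which [gaE] expresses by W, an integral of w. *)
Lemma boundary_repr (j : 'I_d) x : I x -> g j x =
  vintegral `[a, x] (fun th => mono (d - 1 - j) (x - th) *: w th) -
  vintegral I (fun th => (E1 n d j (x - a))^T *m Kmx a b B C *m Ed n d (b - th) *m w th).
Proof.
move=> Ix; rewrite gE// addrC; congr (_ + _).
have -> : vintegral I (fun th => (E1 n d j (x - a))^T *m Kmx a b B C *m
    Ed n d (b - th) *m w th) = (E1 n d j (x - a))^T *m Kmx a b B C *m W.
  rewrite mulmx_vintegral//; congr (vintegral _ _); apply/funext => th.
  by rewrite !mulmxA.
rewrite -mulmxA -mulmxN -gaE /E1 tr_mxcol mul_mxrow_mxcol; apply: eq_bigr => l _.
by rewrite tr_scalar_mx mul_scalar_mx derive1n_mono.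
Qed.

End boundary_conditions.

Section univariate_domain.
Context (R : realType) (n d : nat) (a b : R) (ab : a < b).
Local Notation leb := (@lebesgue_measure R).
Local Notation Rm := (measurableTypeR R).
Local Notation I := (`[a, b]%classic : set Rm).
Local Notation a1 := (fun _ : 'I_1 => a).
Local Notation b1 := (fun _ : 'I_1 => b).
Local Notation t1 x := (@ins R 1 ord0 x [tuple]).

Let mI : measurable I. Proof. exact: measurable_itv. Qed.
Let abW : a <= b := ltW ab.
Let ab1 (i : 'I_1) : a1 i < b1 i := ab.

(** The measure on empty tuples is a unit mass at [[tuple]], so almost everywhere means at that
    point. It turns slices of a one-dimensional box into functions on the interval. *)
Let ae0 (P : 0.-tuple R -> Prop) :
  {ae lebesgueN R 0, forall t, box (a1 \o lift ord0) (b1 \o lift ord0) t -> P t} ->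
  P [tuple].
Proof.
move=> [A [mA A0 hA]]; apply: contrapT => nP.
have : A [tuple] by apply: hA => /= h; apply: nP; apply: h => -[].
move=> h; move: A0; rewrite /= diracE mem_set// => -[].
by move/eqP; rewrite oner_eq0.
Qed.

Lemma Rintegral_box1 (f : 1.-tuple R -> R) :
  (lebesgueN R 1).-integrable (box a1 b1) (EFin \o f) ->
  \int[lebesgueN R 1]_(s in box a1 b1) f s = \int[leb]_(x in I) f (t1 x).
Proof. by move=> fi; rewrite (Rintegral_slice ord0 fi) Rintegral_lebesgue0. Qed.

Lemma sqint_box1 f : sqint (lebesgueN R 1) (box a1 b1) f ->
  sqint leb I (fun x => f (t1 x)).
Proof. by move=> /(sqint_slice ord0)/ae0. Qed.

Lemma ae_box1 (P : 1.-tuple R -> Prop) :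
  {ae lebesgueN R 1, forall s, box a1 b1 s -> P s} ->
  {ae leb, forall x, I x -> P (t1 x)}.
Proof. by move=> /(ae_slice ord0)/ae0. Qed.

Lemma weak_box1 k (u w : 1.-tuple R -> 'cV[R]_n) c phi :
  L2 a1 b1 u -> L2 a1 b1 w -> weak_deriv a1 b1 (fun=> k) u w -> test1 a b phi ->
  \int[leb]_(x in I) (cmp u c (t1 x) * derive1n k phi x) =
  (-1) ^+ k * \int[leb]_(x in I) (cmp w c (t1 x) * phi x).
Proof.
move=> su sw h tphi; have t0 (i : 'I_1) : test1 (a1 i) (b1 i) phi by [].
have := weak_tensor c h t0; rewrite big_ord1.
have sp (i : 'I_1) : smooth1 phi by have [] := tphi.
have Ofin := lebesgueN_box_fin a1 b1; have mO := measurable_box a1 b1.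
have iu := sqint_integrable mO Ofin (su c); have iw := sqint_integrable mO Ofin (sw c).
have ab1W i : a1 i <= b1 i by [].
rewrite !Rintegral_box1; [|exact: (integrable_tensor ab1W sp iw)|
  exact: (integrable_tensor ab1W (@smooth1_dtensor R 1 (fun=> k) (fun=> phi) sp) iu)].
have e (f : R -> R) x : tensor (fun=> f) (t1 x) = f x.
  by rewrite /tensor big_ord1 tnth_ins.
by under eq_Rintegral do rewrite e; under [in X in _ = X]eq_Rintegral do rewrite e.
Qed.

Context (B C : 'I_d -> 'I_d -> 'M[R]_n).
Hypothesis adm : admissible a b B C.

(** D k.+1 is the weak derivative of D k ([step]), so the continuous representatives g k obey the
    fundamental theorem of calculus ([gFTC]), then Taylor's formula, then the elimination of
    boundary values. The conclusion is almost everywhere because D j agrees with g j only there. *)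
Lemma univ_dom_repr (w : R -> 'cV[R]_n) : univ_dom a b B C w ->
  let D k x := Deriv a1 b1 (fun=> k) (fun s => w (thead s)) (t1 x) in
  forall j, (j < d)%N -> {ae leb, forall x, I x -> D j x =
    vintegral `[a, x] (fun th => mono (d - 1 - j) (x - th) *: D d th) -
    vintegral I (fun th => (E1 n d j (x - a))^T *m Kmx a b B C *m
      Ed n d (b - th) *m D d th)}.
Proof.
move=> [hS [g hg bc]] D j jd.
set w1 := (fun s : 1.-tuple R => w (thead s)) in hS hg D *.
have spec k : (k <= d)%N -> L2 a1 b1 (Deriv a1 b1 (fun=> k) w1) /\
    weak_deriv a1 b1 (fun=> k) w1 (Deriv a1 b1 (fun=> k) w1).
  by move=> kd; apply: (Deriv_spec hS).
have sw1 : L2 a1 b1 w1 by case: hS.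
have sD k c : (k <= d)%N -> sqint leb I (fun x => D k x c 0).
  by move=> kd; have [h _] := spec k kd; exact: (sqint_box1 (h c)).
(* Order k against phi' and order k.+1 against phi pair w1 with the same derivative of phi. *)
have step k c phi : (k < d)%N -> test1 a b phi ->
    \int[leb]_(x in I) (D k x c 0 * derive1 phi x) =
    - \int[leb]_(x in I) (D k.+1 x c 0 * phi x).
  move=> kd tphi; have [s1 h1] := spec k (ltnW kd); have [s2 h2] := spec k.+1 kd.
  have e1 := weak_box1 c sw1 s1 h1 (test1_derive tphi).
  have e2 := weak_box1 c sw1 s2 h2 tphi.
  apply: (@sign_inj _ k); rewrite -e1 mulrN -mulNr -mulN1r -exprS -e2.
  by apply: eq_Rintegral => x _; rewrite /derive1n -iterSr.
have gD k : {ae leb, forall x, I x -> g k x = D k x}.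
  have [_ h] := hg k; have := ae_box1 h; apply: filterS => x hx Ix.
  by have := hx Ix; rewrite /thead tnth_ins.
have cg k c : {within `[a, b], continuous (fun x => g k x c 0)}.
  move=> x; apply: (@continuous_comp _ _ _ (g k : subspace `[a, b] -> _) (fun M : 'cV[R]_n => M c 0)).
    by have [h _] := hg k; exact: h.
  exact: coord_continuous.
have mcg k c : measurable_fun I (fun x => g k x c 0).
  have gi : leb.-integrable I (EFin \o (fun x => g k x c 0)).
    exact: continuous_compact_integrable (@segment_compact _ _ _) (cg k c).
  by apply/measurable_EFinP; exact: measurable_int gi.
have gFTC (k : 'I_d) c x : I x -> g k x c 0 = g k a c 0 +
    \int[leb]_(t in `[a, x]) D k.+1 t c 0.
  apply: (weak_FTC ab (cg k c) (sD k.+1 c (ltn_ord k))) => phi tphi.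
  rewrite -step//; apply: ae_eq_Rintegral => //.
  - apply: measurable_funM => //; have [sp _] := tphi.
    exact: smooth1_measurableR (smooth1_derive sp).
  - apply: measurable_funM; first exact: (sD k c (ltnW (ltn_ord k))).1.
    have [sp _] := tphi; exact: smooth1_measurableR (smooth1_derive sp).
  - by apply: filterS (gD k) => y h Iy; rewrite h.
(* Taylor's formula is indexed by nat; the value 0 given at indices beyond d is never reached. *)
pose gn c k x := oapp (fun k : 'I_d => g k x c 0) 0 (insub k).
have gnE c (k : 'I_d) x : gn c k x = g k x c 0 by rewrite /gn valK.
have tay c m i : (i + m.+1)%N = d -> forall x, I x -> gn c i x =
    \sum_(l < m.+1) mono l (x - a) * gn c (i + l)%N a +
    \int[leb]_(th in `[a, x]) (mono m (x - th) * D d th c 0).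
  apply: (taylor_int ab (sD d c (leqnn d))) => k x kd Ix.
  rewrite -[k]/(nat_of_ord (Ordinal kd)) !gnE gFTC//=; congr (_ + _).
  have [kd'|kd'] := ltnP k.+1 d; last by rewrite (_ : k.+1 = d)//; lia.
  have /andP[ax xb] : a <= x <= b by move: Ix; rewrite /= in_itv.
  have sub : (`[a, x]%classic : set Rm) `<=` I.
    by move=> y /=; rewrite !in_itv /= => /andP[-> h]; exact: le_trans xb.
  rewrite -[k.+1]/(nat_of_ord (Ordinal kd')).
  apply: ae_eq_Rintegral; first exact: measurable_itv.
  - by apply: (measurable_funS mI sub); exact: (sD k.+1 c kd).1.
  - apply: (measurable_funS mI sub).
    by rewrite (funext (gnE c (Ordinal kd'))); exact: mcg.
  - by apply: filterS (gD (Ordinal kd')) => y h Iy; rewrite gnE h//; exact: sub.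
have sh (F : nat -> R) i m : (i + m.+1)%N = d ->
    \sum_(i <= l < d) F l = \sum_(l < m.+1) F (i + l)%N.
  move=> <-; rewrite -{1}[i]add0n big_addn addKn big_mkord.
  by apply: eq_bigr => l _; rewrite addnC.
have gR (i : 'I_d) x : I x -> g i x =
    \sum_(l < d) (if (i <= l)%N then mono (l - i) (x - a) else 0) *: g l a +
    vintegral `[a, x] (fun th => mono (d - 1 - i) (x - th) *: D d th).
  move=> Ix; apply/colP => c; rewrite -gnE (tay c (d - 1 - i)%N)//; last first.
    by have := ltn_ord i; lia.
  rewrite !mxE summxE; congr (_ + _); last first.
    by apply: eq_Rintegral => th _; rewrite mxE.
  transitivity (\sum_(i <= l < d) mono (l - i) (x - a) * gn c l a).
    rewrite (sh _ _ (d - 1 - i)%N); last by have := ltn_ord i; lia.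
    by apply: eq_bigr => l _; rewrite addKn.
  rewrite (big_nat_widenl _ 0)//= big_mkord big_mkcond /=.
  apply: eq_bigr => l _; rewrite ?andbT mxE -gnE.
  by case: ifP => _; rewrite ?mul0r.
have := gD (Ordinal jd); apply: filterS => x h Ix; rewrite -[j]/(nat_of_ord (Ordinal jd)) -h//.
by apply: (boundary_repr ab adm _ gR bc) => // c; exact: (sD d c (leqnn d)).
Qed.

End univariate_domain.

(** * Integration against tests split along one coordinate *)

Section insert_test.
Context (R : realType) (N : nat) (a b : 'I_N.+1 -> R) (ab : forall i, a i < b i).
Context (i : 'I_N.+1).
Local Notation mu := (lebesgueN R N.+1).
Local Notation mu' := (lebesgueN R N).
Local Notation leb := (@lebesgue_measure R).
Local Notation Om := (box a b).
Local Notation Om' := (box (a \o lift i) (b \o lift i)).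
Local Notation Rm := (measurableTypeR R).
Local Notation I := (`[a i, b i]%classic : set Rm).
Local Notation ins x t := (@ins R N.+1 i x t).

Let abW j : a j <= b j := ltW (ab j).
Let abW' j : (a \o lift i) j <= (b \o lift i) j := abW (lift i j).
Let mI : measurable I. Proof. exact: measurable_itv. Qed.
Let mOm : measurable Om := measurable_box a b.
Let mOm' : measurable Om' := measurable_box (a \o lift i) (b \o lift i).

Definition mkt (phi0 : R -> R) (Phi : 'I_N -> R -> R) (j : 'I_N.+1) : R -> R :=
  oapp Phi phi0 (unlift i j).

Lemma mkt_split phi : phi = mkt (phi i) (phi \o lift i).
Proof.
apply/funext => j; rewrite /mkt; case: unliftP => [k ->|->] //.
Qed.

Lemma test1_mkt phi0 Phi : test1 (a i) (b i) phi0 ->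
  (forall j, test1 ((a \o lift i) j) ((b \o lift i) j) (Phi j)) ->
  forall j, test1 (a j) (b j) (mkt phi0 Phi j).
Proof.
by move=> h0 h j; rewrite /mkt; case: unliftP => [k ->|->] //=; exact: h.
Qed.

Lemma smooth1_mkt phi0 Phi : smooth1 phi0 -> (forall j, smooth1 (Phi j)) ->
  forall j, smooth1 (mkt phi0 Phi j).
Proof. by move=> h0 h j; rewrite /mkt; case: unliftP => [k _|_] //=; exact: h. Qed.

Lemma tensor_mkt phi0 Phi x t : tensor (mkt phi0 Phi) (ins x t) = phi0 x * tensor Phi t.
Proof.
rewrite tensor_ins /mkt unlift_none; congr (_ * tensor _ _).
by apply/funext => j /=; rewrite liftK.
Qed.

Lemma dtensor_mkt al phi0 Phi :
  dtensor al (mkt phi0 Phi) = mkt (derive1n (al i) phi0) (dtensor (al \o lift i) Phi).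
Proof. by apply/funext => j; rewrite /dtensor /mkt; case: unliftP => [k ->|->]. Qed.

Lemma Rintegral_mkt f phi0 Phi : mu.-integrable Om (EFin \o f) -> smooth1 phi0 ->
  (forall j, smooth1 (Phi j)) ->
  \int[mu]_(s in Om) (f s * tensor (mkt phi0 Phi) s) =
  \int[mu']_(t in Om') ((\int[leb]_(x in I) (f (ins x t) * phi0 x)) * tensor Phi t).
Proof.
move=> fi s0 sP; have fti := integrable_tensor abW (smooth1_mkt s0 sP) fi.
(* Constant factors 1 in the other variables turn the inner integral into a slice of an integrable
   tensor product, which gives its measurability. *)
pose one (j : 'I_N) : R -> R := fun=> 1.
have s1 (j : 'I_N) : smooth1 (one j) by exact: smooth1_cst.
have ft1 := integrable_tensor abW (smooth1_mkt s0 s1) fi.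
have e1 t : \int[leb]_(x in I) (f (ins x t) * tensor (mkt phi0 one) (ins x t)) =
    \int[leb]_(x in I) (f (ins x t) * phi0 x).
  by apply: eq_Rintegral => x _; rewrite tensor_mkt /tensor big1 ?mulr1.
have i1 := integrable_slice i ft1; have i2 := integrable_slice i fti.
rewrite (Rintegral_slice i fti); apply: ae_eq_Rintegral => //.
- by apply/measurable_EFinP; exact: measurable_int i2.
- apply: measurable_funM; last exact: measurable_tensor.
  by rewrite -(funext e1); apply/measurable_EFinP; exact: measurable_int i1.
have := ae_integrable_slice i fi; apply: filterS => t ht Ot.
rewrite -RintegralZr//; last exact: integrable_itv_smooth1 (abW i) (ht Ot) s0.
by apply: eq_Rintegral => x _; rewrite tensor_mkt mulrA.
Qed.

Lemma integrable_mkt f phi0 : mu.-integrable Om (EFin \o f) -> smooth1 phi0 ->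
  mu'.-integrable Om' (EFin \o (fun t => \int[leb]_(x in I) (f (ins x t) * phi0 x))).
Proof.
move=> fi s0; pose one (j : 'I_N) : R -> R := fun=> 1.
have s1 (j : 'I_N) : smooth1 (one j) by exact: smooth1_cst.
have := integrable_slice i (integrable_tensor abW (smooth1_mkt s0 s1) fi).
apply: eq_integrable => // t _; congr EFin; apply: eq_Rintegral => x _.
by rewrite tensor_mkt /tensor big1 ?mulr1.
Qed.

Section other_order.
Context (f : N.+1.-tuple R -> R) (chi : R -> R) (M : R) (Phi : 'I_N -> R -> R).
Hypotheses (fi : mu.-integrable Om (EFin \o f)).
Hypotheses (mchi : measurable_fun (I : set R) chi) (chiM : forall x, I x -> `|chi x| <= M).
Hypothesis sP : forall j, smooth1 (Phi j).

Let one : R -> R := fun=> 1.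
Let s1 : smooth1 one. Proof. exact: smooth1_cst. Qed.
Let fti := integrable_tensor abW (smooth1_mkt s1 sP) fi.
Let e1 x : \int[mu']_(t in Om') (f (ins x t) * tensor (mkt one Phi) (ins x t)) =
    \int[mu']_(t in Om') (f (ins x t) * tensor Phi t).
Proof. by apply: eq_Rintegral => t _; rewrite tensor_mkt mul1r. Qed.

Lemma integrable_mkt1 :
  leb.-integrable I (EFin \o (fun x => \int[mu']_(t in Om') (f (ins x t) * tensor Phi t))).
Proof. by have := integrable_slice1 i fti; rewrite (funext e1). Qed.

(** The factor chi is merely bounded and measurable because it will be [adj_test], the image of a
    test under a transposed kernel. *)
Lemma Rintegral_mkt1 (psi : N.+1.-tuple R -> R) :
  (forall x t, I x -> Om' t -> psi (ins x t) = chi x * tensor Phi t) ->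
  \int[mu]_(s in Om) (f s * psi s) =
  \int[leb]_(x in I) (chi x * \int[mu']_(t in Om') (f (ins x t) * tensor Phi t)).
Proof.
move=> hpsi; pose psi' s := chi (tnth s i) * tensor (mkt one Phi) s.
have -> : \int[mu]_(s in Om) (f s * psi s) =
    \int[mu]_(s in Om) ((f s * tensor (mkt one Phi) s) * chi (tnth s i)).
  apply: eq_Rintegral => s /set_mem Os; rewrite -mulrA; congr (_ * _).
  have := Os; rewrite {1}(ins_split i s) => /box_ins[Ix Ot].
  by rewrite (ins_split i s) hpsi// tensor_mkt mul1r tnth_ins mulrC.
have gi : mu.-integrable Om (EFin \o (fun s => (f s * tensor (mkt one Phi) s) * chi (tnth s i))).
  apply: (@le_integrable_mul _ _ _ _ _ _ (fun s => chi (tnth s i)) M mOm fti).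
    apply: (@measurable_comp _ _ _ _ _ _ (I : set R)) => //.
    - by move=> _ [s Os <-]; have := Os i; rewrite /= in_itv.
    - by apply: measurable_funTS; exact: measurable_tnth.
  by move=> s Os; apply: chiM; have := Os i; rewrite /= in_itv.
have mchi' : measurable_fun I chi by exact: mchi.
rewrite (Rintegral_slice1 i gi); apply: ae_eq_Rintegral => //.
- by apply/measurable_EFinP; exact: measurable_int (integrable_slice1 i gi).
- by apply: measurable_funM => //; apply/measurable_EFinP; exact: measurable_int integrable_mkt1.
have := ae_integrable_slice1 i fti; apply: filterS => x hx Ix.
rewrite -(e1 x) -RintegralZl//; last exact: hx.
by apply: eq_Rintegral => t _; rewrite tnth_ins mulrC.
Qed.

End other_order.

End insert_test.

Lemma ae_imp4 d (T : measurableType d) (R : realType) (m : {measure set T -> \bar R})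
    (P1 P2 P3 P4 Q : T -> Prop) :
  (forall t, P1 t -> P2 t -> P3 t -> P4 t -> Q t) ->
  {ae m, forall t, P1 t} -> {ae m, forall t, P2 t} -> {ae m, forall t, P3 t} ->
  {ae m, forall t, P4 t} -> {ae m, forall t, Q t}.
Proof.
move=> h h1 h2 h3 h4.
have h12 : {ae m, forall t, P1 t /\ P2 t} by apply: filterS2 h1 h2.
have h34 : {ae m, forall t, P3 t /\ P4 t} by apply: filterS2 h3 h4.
by apply: filterS2 h12 h34 => t [? ?] [? ?]; exact: h.
Qed.

(** * Representation of the pure derivatives along one axis *)

Section representation.
Context (R : realType) (n N : nat) (a b : 'I_N.+1 -> R) (ab : forall i, a i < b i).
Context (delta : 'I_N.+1 -> nat)
  (B C : forall i, 'I_(delta i) -> 'I_(delta i) -> 'M[R]_n).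
Hypothesis adm : forall i, admissible (a i) (b i) (@B i) (@C i).
Local Notation mu := (lebesgueN R N.+1).
Local Notation mu' := (lebesgueN R N).
Local Notation leb := (@lebesgue_measure R).
Local Notation Om := (box a b).
Local Notation Rm := (measurableTypeR R).
Local Notation vfun := (N.+1.-tuple R -> 'cV[R]_n).

Let abW j : a j <= b j := ltW (ab j).
Let mOm : measurable Om := measurable_box a b.
Let Ofin : (mu Om < +oo)%E := lebesgueN_box_fin a b.

Let L2int (v : vfun) c : L2 a b v -> mu.-integrable Om (EFin \o cmp v c).
Proof. by move=> sv; exact: (sqint_integrable mOm Ofin (sv c)). Qed.

Definition axis (i : 'I_N.+1) (k : nat) : 'I_N.+1 -> nat :=
  fun j => if j == i then k else 0%N.

Lemma sum_axis i k : (\sum_j axis i k j)%N = k.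
Proof. by rewrite (bigD1 i)//= /axis eqxx big1 ?addn0// => j /negbTE ->. Qed.

Lemma dtensor_axis i k (phi0 : R -> R) (Phi : 'I_N -> R -> R) :
  dtensor (axis i k) (mkt i phi0 Phi) = mkt i (derive1n k phi0) Phi.
Proof.
rewrite dtensor_mkt /axis eqxx; congr mkt; apply/funext => j.
by rewrite /dtensor /= eq_sym (negbTE (neq_lift _ _)).
Qed.

Section slicewise.
Context (i : 'I_N.+1) (u : vfun).
Hypothesis hS : S2 a b (axis i (delta i)) u.
Local Notation Om' := (box (a \o lift i) (b \o lift i)).
Local Notation I := (`[a i, b i]%classic : set Rm).
Local Notation ins x t := (@ins R N.+1 i x t).
Local Notation D k := (Deriv a b (axis i k) u).

Let mI : measurable I. Proof. exact: measurable_itv. Qed.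

Let axis_le k : (k <= delta i)%N -> forall j, (axis i k j <= axis i (delta i) j)%N.
Proof. by move=> kd j; rewrite /axis; case: ifP. Qed.

Let spec k : (k <= delta i)%N -> L2 a b (D k) /\ weak_deriv a b (axis i k) u (D k).
Proof. by move=> kd; exact: Deriv_spec hS (axis_le kd). Qed.

Let su : L2 a b u := hS.1.

(** A derivative along s_i leaves the other factors of a tensor test alone. The weak identity is
    therefore a pairing with an arbitrary tensor in the other variables, and the fundamental lemma
    there gives it on almost every line, with a null set depending on phi0. *)
Lemma ae_slice_weak k c phi0 : (k <= delta i)%N -> test1 (a i) (b i) phi0 ->
  {ae mu', forall t : N.-tuple R, Om' t ->
    \int[leb]_(x in I) (cmp u c (ins x t) * derive1n k phi0 x) =
    (-1) ^+ k * \int[leb]_(x in I) (cmp (D k) c (ins x t) * phi0 x)}.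
Proof.
move=> kd t0; have [sD hD] := spec kd; have [s0 _] := t0.
have sk := @smooth1_iter R phi0 k s0.
have i1 := integrable_mkt ab i (L2int c su) sk.
have i2 := integrable_mkt ab i (L2int c sD) s0.
apply: (fundamentalN_eq _ i1) => //.
- by move=> j; exact: ab.
- exact: (integrableZl (measurable_box _ _) _ i2).
move=> Phi tPhi; have sPhi j : smooth1 (Phi j) by have [] := tPhi j.
rewrite -(Rintegral_mkt ab i (L2int c su) sk sPhi) -dtensor_axis.
rewrite (weak_tensor c hD (test1_mkt t0 tPhi)) sum_axis.
rewrite (Rintegral_mkt ab i (L2int c sD) s0 sPhi) -RintegralZl//.
- by apply: eq_Rintegral => t _; rewrite mulrA.
- exact: measurable_box.
- by apply: integrable_tensor => // j; exact: abW.
Qed.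

(** [Deriv] of the slice is a choice made anew on each line, so the two sides are compared through
    their weak identities: those of [ae_slice_weak] for countably many bumps hold together on almost
    every line and determine the derivative there. *)
Lemma ae_slice_Deriv k c : (k <= delta i)%N -> {ae mu', forall t : N.-tuple R, Om' t ->
  univ_dom (a i) (b i) (@B i) (@C i) (fun x => u (ins x t)) ->
  {ae leb, forall x, I x -> cmp (D k) c (ins x t) =
    Deriv (fun _ : 'I_1 => a i) (fun=> b i) (fun=> k)
      (fun s => u (ins (thead s) t)) (@Defs.ins R 1 ord0 x [tuple]) c 0}}.
Proof.
move=> kd; have [sD hD] := spec kd.
have : {ae mu', forall t : N.-tuple R, forall z : rat * rat * nat, a i < ratr z.1.1 -> ratr z.1.2 < b i ->
    Om' t -> let phi0 := bump (ratr z.1.1) (ratr z.1.2) z.2 in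
    \int[leb]_(x in I) (cmp u c (ins x t) * derive1n k phi0 x) =
    (-1) ^+ k * \int[leb]_(x in I) (cmp (D k) c (ins x t) * phi0 x)}.
  apply: ae_forall_count => -[[p q] m] /=.
  have [ap|ap] := pselect (a i < ratr p); last exact: aeW.
  have [qb|qb] := pselect (ratr q < b i); last exact: aeW.
  by have := ae_slice_weak c kd (test1_bump m ap qb); apply: filterS => t h _ _.
have := sqint_slice i (sD c); apply: filterS2 => t hst ht Ot hU.
have [hS1 _] := hU.
have ab1 (j : 'I_1) : (fun _ : 'I_1 => a i) j < (fun _ : 'I_1 => b i) j by exact: ab.
have [sE hE] := Deriv_spec hS1 (fun=> kd : (_ <= _)%N).
set E := Deriv _ _ _ _ in sE hE *.
have se := sqint_box1 (sE c); have sd := hst Ot.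
have id := sqint_integrable mI (leb_itv_fin (abW i)) sd.
have ie := sqint_integrable mI (leb_itv_fin (abW i)) se.
suff : {ae leb, forall x, I x -> cmp (D k) c (ins x t) - cmp E c (@Defs.ins R 1 ord0 x [tuple]) = 0}.
  by apply: filterS => x hx Ix; apply/eqP; rewrite -subr_eq0 hx.
apply: (fundamental1 (ab i)); first exact: (integrableB mI id ie).
move=> p q m ap pq qb; have := ht (p, q, m) ap qb Ot => /= h1.
have tb := test1_bump m ap qb; have [sb _] := tb.
have h2 := weak_box1 (ab i) c hS1.1 sE hE tb.
have e : \int[leb]_(x in I) (cmp (D k) c (ins x t) * bump (ratr p) (ratr q) m x) =
    \int[leb]_(x in I) (cmp E c (@Defs.ins R 1 ord0 x [tuple]) * bump (ratr p) (ratr q) m x).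
  apply: (@sign_inj _ k); rewrite -h1 -h2; apply: eq_Rintegral => x _.
  by rewrite /cmp /thead tnth_ins.
rewrite (_ : \int[leb]_(x in _) _ =
  \int[leb]_(x in I) (cmp (D k) c (ins x t) * bump (ratr p) (ratr q) m x) -
  \int[leb]_(x in I) (cmp E c (@Defs.ins R 1 ord0 x [tuple]) * bump (ratr p) (ratr q) m x)).
  by rewrite e subrr.
rewrite -RintegralB//; try exact: integrable_itv_smooth1.
by apply: eq_Rintegral => x _; rewrite mulrBl.
Qed.

Lemma opA_ins j (v : vfun) x t : (j < delta i)%N ->
  opA_ a b B C i j v (ins x t) =
  vintegral `[a i, x] (fun th => mono (delta i - 1 - j) (x - th) *: v (ins th t)) -
  vintegral I (fun th => (E1 n (delta i) j (x - a i))^T *m Kmx (a i) (b i) (@B i) (@C i) *m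
    Ed n (delta i) (b i - th) *m v (ins th t)).
Proof.
move=> ji; rewrite /opA_ ji tnth_ins; congr (_ - _).
  by congr (vintegral _ _); apply/funext => th; rewrite upd_ins.
by congr (vintegral _ _); apply/funext => th; rewrite upd_ins.
Qed.

Lemma eq_ae_vintegral (f g : R -> 'cV[R]_n) (M : R -> 'M[R]_n) (J : set Rm) :
  measurable J -> J `<=` I ->
  (forall k c, measurable_fun I (fun x => M x k c)) ->
  (forall c, measurable_fun I (fun x => f x c 0)) ->
  (forall c, measurable_fun I (fun x => g x c 0)) ->
  {ae leb, forall x, I x -> f x = g x} ->
  vintegral J (fun x => M x *m f x) = vintegral J (fun x => M x *m g x).
Proof.
move=> mJ JI mM mf mg fg; apply/colP => k; rewrite !mxE.
have m (h : R -> 'cV[R]_n) : (forall c, measurable_fun I (fun x => h x c 0)) ->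
    measurable_fun J (fun x => (M x *m h x) k 0).
  move=> mh; apply: (measurable_funS mI JI).
  rewrite (_ : (fun x => _) = (fun x => \sum_c M x k c * h x c 0)).
    by apply: measurable_sum => c; exact: measurable_funM.
  by apply/funext => x; rewrite mxE.
apply: ae_eq_Rintegral => //; [exact: m|exact: m|].
by apply: filterS fg => x h Jx; rewrite h//; exact: JI.
Qed.

(** On almost every line the derivatives of u are those of its slice, and the slice satisfies the
    boundary conditions, so [univ_dom_repr] applies. Both sides being measurable, [slice_ae] lifts
    the equality to the box. *)
Lemma axis_repr j : lifted_dom a b B C i u -> (j < delta i)%N ->
  eq_ae a b (D j) (opA_ a b B C i j (D (delta i))).
Proof.
move=> [_ hU'] jd.
have hU : {ae mu', forall t : N.-tuple R, Om' t ->
    univ_dom (a i) (b i) (@B i) (@C i) (fun x => u (ins x t))} by exact: hU'.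
have [sDj _] := spec (ltnW jd); have [sDd _] := spec (leqnn (delta i)).
have [gA _ _] := goodV_opA_ abW B C i j.
have sO := gA _ sDd.
apply/eq_ae_cmp => c; apply: (slice_ae (i := i)); [exact: (sDj c).1|exact: (sO c).1|].
have h1 := ae_slice_Deriv c (ltnW jd).
have h2 : {ae mu', forall t : N.-tuple R, forall c', Om' t ->
  univ_dom (a i) (b i) (@B i) (@C i) (fun x => u (ins x t)) ->
  {ae leb, forall x, I x -> cmp (D (delta i)) c' (ins x t) =
    Deriv (fun _ : 'I_1 => a i) (fun=> b i) (fun=> delta i)
      (fun s => u (ins (thead s) t)) (@Defs.ins R 1 ord0 x [tuple]) c' 0}}.
  by apply: ae_forall_count => c'; exact: ae_slice_Deriv.
have h3 : {ae mu', forall t : N.-tuple R, forall c', Om' t -> sqint leb I (fun x => cmp (D (delta i)) c' (ins x t))}.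
  by apply: ae_forall_count => c'; exact: sqint_slice (sDd c').
have key : {ae mu', forall t : N.-tuple R, Om' t ->
    {ae leb, forall x, I x -> D j (ins x t) c 0 = opA_ a b B C i j (D (delta i)) (ins x t) c 0}}.
  apply: (@ae_imp4 _ _ _ mu' _ _ _ _ _ _ hU h1 h2 h3) => t Ut g1 g2 g3 Ot.
  have U := Ut Ot; have {}g1 := g1 Ot U.
  have g2' := ae_forall_count (fun c' => g2 c' Ot U).
  have r := univ_dom_repr (ab i) (adm i) U jd.
  have sE c' := sqint_box1 ((Deriv_spec U.1 (fun=> leqnn (delta i))).1 c').
  set E := Deriv _ _ (fun _ : 'I_1 => delta i) _ in g2' r sE.
  have ED : {ae leb, forall x, I x -> E (@Defs.ins R 1 ord0 x [tuple]) = D (delta i) (ins x t)}.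
    apply: filterS g2' => x hx Ix; apply/colP => c'.
    by rewrite -(hx c' Ix).
  apply: filterS2 g1 r => x e1 e2 Ix; rewrite -/(cmp _ c _) e1// e2// opA_ins//.
  have /andP[ax xb] : a i <= x <= b i by move: Ix; rewrite /= in_itv.
  have sub : (`[a i, x]%classic : set Rm) `<=` I.
    by move=> y /=; rewrite !in_itv /= => /andP[-> h]; exact: le_trans xb.
  have mpair : measurable_fun setT (fun th : Rm => ((x : Rm), th)).
    exact: measurable_fun_pair.
  have m0 k c' : measurable_fun I (fun th => ((mono (delta i - 1 - j) (x - th))%:M : 'M[R]_n) k c').
    rewrite (_ : (fun th => _) = (fun th : Rm => (k == c')%:R * mono (delta i - 1 - j) (x - th))).
      apply: measurable_funM => //; apply: measurable_funTS.
      exact: measurableT_comp (bker_monoB (Ibounded abW i) (delta i - 1 - j)).1 mpair.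
    by apply/funext => th; rewrite mxE mulr_natl.
  have m1 k c' : measurable_fun I (fun th => ((E1 n (delta i) j (x - a i))^T *m
      Kmx (a i) (b i) (@B i) (@C i) *m Ed n (delta i) (b i - th)) k c').
    by apply: measurable_funTS; exact: measurableT_comp (bker1 abW B C i j k c').1 mpair.
  have mJ : measurable (`[a i, x]%classic : set Rm) by exact: measurable_itv.
  have mE c' := (sE c').1; have mDd c' := (g3 c' Ot).1.
  have v1 := eq_ae_vintegral mJ sub m0 mE mDd ED.
  have v2 := eq_ae_vintegral mI (fun x h => h) m1 mE mDd ED.
  (* The Volterra kernel, viewed as a scalar matrix, falls under [eq_ae_vintegral] like the boundary
     kernel. *)
  have z (v : R -> 'cV[R]_n) : (fun th => (mono (delta i - 1 - j) (x - th))%:M *m v th) =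
      (fun th => mono (delta i - 1 - j) (x - th) *: v th).
    by apply/funext => th; rewrite mul_scalar_mx.
  by rewrite !z in v1; rewrite v2 v1.
exact: key.
Qed.
End slicewise.
End representation.

(** * Mixed derivatives and the identity u = T D^delta u *)

Section mixed_representation.
Context (R : realType) (n N : nat) (a b : 'I_N.+1 -> R) (ab : forall i, a i < b i).
Context (delta : 'I_N.+1 -> nat)
  (B C : forall i, 'I_(delta i) -> 'I_(delta i) -> 'M[R]_n).
Hypothesis adm : forall i, admissible (a i) (b i) (@B i) (@C i).
Local Notation mu := (lebesgueN R N.+1).
Local Notation mu' := (lebesgueN R N).
Local Notation leb := (@lebesgue_measure R).
Local Notation Om := (box a b).
Local Notation Rm := (measurableTypeR R).
Local Notation vfun := (N.+1.-tuple R -> 'cV[R]_n).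

Let abW j : a j <= b j := ltW (ab j).
Let mOm : measurable Om := measurable_box a b.
Let Ofin : (mu Om < +oo)%E := lebesgueN_box_fin a b.

Let L2int (v : vfun) c : L2 a b v -> mu.-integrable Om (EFin \o cmp v c).
Proof. by move=> sv; exact: (sqint_integrable mOm Ofin (sv c)). Qed.

Section along.
Context (i : 'I_N.+1).
Local Notation Om' := (box (a \o lift i) (b \o lift i)).
Local Notation I := (`[a i, b i]%classic : set Rm).
Local Notation ins x t := (@ins R N.+1 i x t).

Let mI : measurable I. Proof. exact: measurable_itv. Qed.

Let sqint_mkt phi0 Psi : smooth1 phi0 -> (forall j, smooth1 (Psi j)) ->
  sqint mu Om (tensor (mkt i phi0 Psi)).
Proof.
move=> s0 sP; have sm := smooth1_mkt (i := i) s0 sP.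
have [M hM] := tensor_bounded abW sm.
have mt : measurable_fun Om (tensor (mkt i phi0 Psi)) by exact: measurable_tensor sm.
exact: (sqint_bounded mOm Ofin mt hM).
Qed.

(** The transposed kernel of A_{i,j} applied to a test; the result need not be a test, as boundary
    terms survive at the ends of the interval. *)
Definition adj_test j (c c' : 'I_n) (phi0 : R -> R) (x : R) : R :=
  \int[leb]_(th in I) (kerA a b B C i j c c' (th, x) * phi0 th).

Lemma adj_test_bounded j c c' phi0 : smooth1 phi0 ->
  measurable_fun I (adj_test j c c' phi0) /\
  exists M, forall x, I x -> `|adj_test j c c' phi0 x| <= M.
Proof.
move=> s0; have [mk [M hM]] := bkerA abW B C i j c c'.
have mk' : measurable_fun setT (fun p : Rm * Rm => kerA a b B C i j c c' (p.2, p.1)).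
  exact: measurableT_comp mk (@measurable_swap _ _ Rm Rm).
have hM' (x y : Rm) : I x -> I y -> `|kerA a b B C i j c c' (y, x)| <= M.
  by move=> Ix Iy; exact: hM.
split.
  apply: (@measurable_Rintegral_param _ _ Rm Rm R leb I I
    (fun p => kerA a b B C i j c c' (p.2, p.1) * phi0 p.2)) => //.
  apply: measurable_funTS; apply: measurable_funM => //.
  apply: (@measurableT_comp _ _ _ (Rm * Rm)%type Rm R phi0) => //.
  exact: smooth1_measurableR.
have [K hK] := smooth1_bounded (abW i) s0.
have s2 : sqint leb I phi0.
  by apply: (sqint_bounded mI (leb_itv_fin (abW i)) _ hK); exact: smooth1_measurableR.
exists (Num.sqrt (M ^+ 2 * (b i - a i) * ip leb I phi0 phi0)) => x Ix.
by rewrite -sqrtr_sqr; apply: ler_wsqrtr; exact: (kernel1_bound (abW i) mk' hM' s2 Ix).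
Qed.

(** The operator moves onto the factor phi0 and leaves Psi alone, so the pairing sees v only through
    its integrals against Psi over the hyperplanes s_i = x. *)
Lemma opA_adj_test j (v : vfun) c phi0 Psi : L2 a b v -> (j < delta i)%N ->
  smooth1 phi0 -> (forall l, smooth1 (Psi l)) ->
  \int[mu]_(s in Om) (cmp (opA_ a b B C i j v) c s * tensor (mkt i phi0 Psi) s) =
  \sum_c' \int[leb]_(x in I) (adj_test j c c' phi0 x *
     \int[mu']_(t in Om') (cmp v c' (ins x t) * tensor Psi t)).
Proof.
move=> sv jd s0 sP; have st := sqint_mkt s0 sP.
have gk c' := goodS_bker abW (bkerA abW B C i j c c').
have [gA _ _] := goodV_opA_ abW B C i j.
have sk c' : sqint mu Om (kop a b i (kerA a b B C i j c c') (cmp v c')).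
  by have [G [K [_ h _ _ _]]] := gk c'; exact: h (sv c').
have ik c' := sqint_mul mOm (sk c') st.
transitivity (\int[mu]_(s in Om) \sum_c' (kop a b i (kerA a b B C i j c c') (cmp v c') s *
    tensor (mkt i phi0 Psi) s)).
  apply: ae_eq_Rintegral => //.
  - by apply: measurable_funM; [exact: ((gA _ sv) c).1|exact: st.1].
  - by apply: measurable_sum => c'; apply: measurable_funM; [exact: (sk c').1|exact: st.1].
  have := opA_kop abW B C c jd sv; apply: filterS => s h Os.
  by rewrite h// mulr_suml.
rewrite Rintegral_sum//; apply: eq_bigr => c' _.
have [mk [M hM]] := bkerA abW B C i j c c'.
rewrite -/(ip mu Om _ _) (kop_adjoint (abW i) mk hM (sv c') st) /ip.
have [mt [K hK]] := adj_test_bounded j c c' s0.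
apply: (Rintegral_mkt1 ab (L2int c' sv) mt hK sP) => x t Ix Ot.
rewrite kop_ins /adj_test -RintegralZr//.
  by apply: eq_Rintegral => th _; rewrite tensor_mkt mulrA.
apply: integrable_itv_smooth1 => //; apply: (@sqint_integrable _ _ _ leb I mI (leb_itv_fin (abW i))).
apply: (sqint_bounded mI (leb_itv_fin (abW i)) (M := M)).
  apply: measurable_funTS; apply: measurableT_comp mk _.
  exact: measurable_fun_pair.
by move=> y Iy; exact: hM.
Qed.

Section mixed.
Context (u : vfun) (hS : S2 a b delta u) (hi : lifted_dom a b B C i u).
Context (al : 'I_N.+1 -> nat) (al_le : forall l, (al l <= delta l)%N).
Local Notation D be := (Deriv a b be u).

Definition set_idx (k : nat) : 'I_N.+1 -> nat := fun l => if l == i then k else al l.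

Let set_idx_le k : (k <= delta i)%N -> forall l, (set_idx k l <= delta l)%N.
Proof. by move=> kd l; rewrite /set_idx; case: eqP => [->|_]. Qed.

Let axis_le k : (k <= delta i)%N -> forall l, (axis i k l <= delta l)%N.
Proof. by move=> kd l; rewrite /axis; case: eqP => [->|_]. Qed.

Lemma sum_set_idx k : (\sum_l set_idx k l = k + \sum_l al (lift i l))%N.
Proof.
rewrite (bigD1_ord i)//= /set_idx eqxx; congr addn; apply: eq_bigr => l _.
by rewrite eq_sym (negbTE (neq_lift _ _)).
Qed.

Lemma dtensor_set_idx k (chi : R -> R) (Phi : 'I_N -> R -> R) : dtensor (set_idx k) (mkt i chi Phi) =
  dtensor (axis i k) (mkt i chi (dtensor (al \o lift i) Phi)).
Proof.
rewrite dtensor_axis dtensor_mkt /set_idx eqxx; congr mkt; apply/funext => l.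
by rewrite /dtensor /= eq_sym (negbTE (neq_lift _ _)).
Qed.

Context (Phi : 'I_N -> R -> R)
  (tPhi : forall l, test1 ((a \o lift i) l) ((b \o lift i) l) (Phi l)).
Local Notation Psi := (dtensor (al \o lift i) Phi).

Let sPhi l : smooth1 (Phi l). Proof. by have [] := tPhi l. Qed.
Let tPsi l : test1 ((a \o lift i) l) ((b \o lift i) l) (Psi l).
Proof. exact: test1_iter. Qed.
Let sPsi l : smooth1 (Psi l). Proof. by have [] := tPsi l. Qed.

(** Up to sign both sides are the integral of u against the same derivative of [mkt i chi Phi], of
    order k in s_i and al in the other variables. *)
Lemma weak_mixed k c chi : (k <= delta i)%N -> test1 (a i) (b i) chi ->
  \int[mu]_(s in Om) (cmp (D (axis i k)) c s * tensor (mkt i chi Psi) s) =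
  (-1) ^+ (\sum_l al (lift i l))%N *
  \int[mu]_(s in Om) (cmp (D (set_idx k)) c s * tensor (mkt i chi Phi) s).
Proof.
move=> kd tchi; have [s1 h1] := Deriv_spec hS (axis_le kd).
have [s2 h2] := Deriv_spec hS (set_idx_le kd).
have e1 := weak_tensor c h1 (test1_mkt tchi tPsi).
have := weak_tensor c h2 (test1_mkt tchi tPhi).
rewrite dtensor_set_idx e1 sum_axis sum_set_idx exprD -mulrA.
exact: sign_inj.
Qed.

(** As chi runs over the bumps, [fundamental1] removes it from [weak_mixed] and leaves an identity
    for almost every x. *)
Lemma ae_mixed c : {ae leb, forall x, I x ->
  \int[mu']_(t in Om') (cmp (D (axis i (delta i))) c (ins x t) * tensor Psi t) =
  (-1) ^+ (\sum_l al (lift i l))%N *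
  \int[mu']_(t in Om') (cmp (D (set_idx (delta i))) c (ins x t) * tensor Phi t)}.
Proof.
have [s1 _] := Deriv_spec hS (axis_le (leqnn _)).
have [s2 _] := Deriv_spec hS (set_idx_le (leqnn _)).
have i1 := integrable_mkt1 ab i (L2int c s1) sPsi.
have i2 := integrable_mkt1 ab i (L2int c s2) sPhi.
set e : R := (-1) ^+ _.
set f : R -> R := fun x : R => \int[mu']_(t in Om')
  (cmp (D (axis i (delta i))) c (ins x t) * tensor Psi t) in i1 *.
set g : R -> R := fun x : R => \int[mu']_(t in Om')
  (cmp (D (set_idx (delta i))) c (ins x t) * tensor Phi t) in i2 *.
suff : {ae leb, forall x, I x -> f x - e * g x = 0}.
  by apply: filterS => x hx Ix; apply/eqP; rewrite -subr_eq0; apply/eqP; exact: hx.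
have ig : leb.-integrable I (EFin \o (fun x => e * g x)) by exact: (integrableZl mI e i2).
apply: (fundamental1 (ab i)); first exact: (integrableB mI i1 ig).
move=> p q m ap pq qb; have tb := test1_bump m ap qb; have [sb _] := tb.
have sbR := @smooth1_bump R (ratr p) (ratr q) m.
have [K hK] := smooth1_bounded (abW i) sbR.
have mb : measurable_fun (I : set R) (bump (ratr p) (ratr q) m) by exact: smooth1_measurable.
have := weak_mixed c (leqnn _) tb.
rewrite (Rintegral_mkt1 ab (L2int c s1) mb hK sPsi); last by move=> *; rewrite tensor_mkt.
rewrite (Rintegral_mkt1 ab (L2int c s2) mb hK sPhi); last by move=> *; rewrite tensor_mkt.
move=> h.
have j1 := integrable_itv_smooth1 (abW i) i1 sbR.
have j2 := integrable_itv_smooth1 (abW i) i2 sbR.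
transitivity (\int[leb]_(x in I) (f x * bump (ratr p) (ratr q) m x) -
    e * \int[leb]_(x in I) (g x * bump (ratr p) (ratr q) m x)).
  rewrite -RintegralZl// -RintegralB//; last exact: (integrableZl mI e j2).
  by apply: eq_Rintegral => x _; rewrite mulrBl mulrA.
apply/eqP; rewrite subr_eq0; apply/eqP; move: h.
under eq_Rintegral do rewrite mulrC; under [in RHS]eq_Rintegral do rewrite mulrC.
by [].
Qed.

End mixed.

(* Pairing with tests in the variables other than s_i moves the remaining
   derivatives onto the tests, which reduces to axis_repr. *)
Lemma Deriv_opA (u : vfun) al : S2 a b delta u -> lifted_dom a b B C i u ->
  (forall l, (al l <= delta l)%N) -> (al i < delta i)%N ->
  eq_ae a b (Deriv a b al u) (opA_ a b B C i (al i) (Deriv a b (set_idx al (delta i)) u)).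
Proof.
move=> hS hi al_le ji.
have set_id : set_idx al (al i) = al.
  by apply/funext => l; rewrite /set_idx; case: eqP => [->|].
have [gA _ _] := goodV_opA_ abW B C i (al i).
have hx l : (axis i (al i) l <= delta l)%N by rewrite /axis; case: eqP => [->|_]; rewrite // ltnW.
have hd l : (axis i (delta i) l <= delta l)%N by rewrite /axis; case: eqP => [->|_].
have hs l : (set_idx al (delta i) l <= delta l)%N by rewrite /set_idx; case: eqP => [->|_].
have [s1 _] := Deriv_spec hS al_le; have [s2 _] := Deriv_spec hS hs.
have [s3 _] := Deriv_spec hS hd; have [s4 _] := Deriv_spec hS hx.
have hA := axis_repr ab adm hi.1 hi ji.
apply/eq_ae_cmp => c; apply: fundamentalN_eq => //; try exact: L2int.
  exact: L2int (gA _ s2).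
move=> phi tphi; have sphi l : smooth1 (phi l) by have [] := tphi l.
rewrite (mkt_split i phi); set Phi := phi \o lift i.
have tPhi l : test1 ((a \o lift i) l) ((b \o lift i) l) (Phi l) by exact: tphi.
have sPhi l : smooth1 (Phi l) by exact: sphi.
have sPsi l : smooth1 (dtensor (al \o lift i) Phi l).
  by have [] := test1_iter (al (lift i l)) (tPhi l).
have w := weak_mixed hS al_le tPhi c (ltnW ji) (tphi i).
rewrite set_id in w.
(* [w] replaces D^al u paired with Phi by the pure derivative in s_i paired with the differentiated
   tests; the sign it costs is put on both sides. *)
apply: (@sign_inj _ (\sum_l al (lift i l))%N); rewrite -w.
transitivity (\int[mu]_(s in Om) (cmp (opA_ a b B C i (al i) (Deriv a b (axis i (delta i)) u)) c s *
   tensor (mkt i (phi i) (dtensor (al \o lift i) Phi)) s)).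
  have st := sqint_mkt (sphi i) sPsi.
  apply: ae_eq_Rintegral => //.
  - by apply: measurable_funM; [exact: (s4 c).1|exact: st.1].
  - by apply: measurable_funM; [exact: ((gA _ s3) c).1|exact: st.1].
  by have/eq_ae_cmp/(_ c) := hA; apply: filterS => s h Os; rewrite h.
(* Both pairings now see their argument only through integrals over hyperplanes, which [ae_mixed]
   equates up to that sign. *)
rewrite opA_adj_test// opA_adj_test// mulr_sumr; apply: eq_bigr => c' _.
have [mt [K hK]] := adj_test_bounded (al i) c c' (sphi i).
have i1 := integrable_mkt1 ab i (L2int c' s3) sPsi.
have i2 := integrable_mkt1 ab i (L2int c' s2) sPhi.
have j1 := le_integrable_mul mI i1 mt hK.
have j2 := le_integrable_mul mI i2 mt hK.
rewrite -RintegralZl//; last first.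
  by apply: eq_integrable j2 => // x _ /=; rewrite mulrC.
apply: ae_eq_Rintegral => //.
- by apply: measurable_funM => //; apply/measurable_EFinP; exact: measurable_int i1.
- apply: measurable_funM => //; apply: measurable_funM => //.
  by apply/measurable_EFinP; exact: measurable_int i2.
by have := ae_mixed hS al_le tPhi c'; apply: filterS => x h Ix; rewrite h// mulrCA.
Qed.

End along.

(** The operators act one coordinate at a time: starting from delta, each lowers one entry of the
    multi-index to that of al, or is the identity if the two entries agree. *)
Lemma Deriv_comp_all (u : vfun) al : Dom a b B C u -> (forall l, (al l <= delta l)%N) ->
  eq_ae a b (Deriv a b al u)
    (comp_all (fun i => opA_ a b B C i (al i)) (Deriv a b delta u)).
Proof.
move=> [hS hD] al_le; have [sd _] := Deriv_spec hS (fun l => leqnn (delta l)).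
(* The multi-index reached once the operators of the coordinates in r have acted. *)
pose be (r : seq 'I_N.+1) l := if l \in r then al l else delta l.
have be_le r l : (be r l <= delta l)%N by rewrite /be; case: ifP.
suff H r : uniq r -> let w := (\big[(fun f g : vfun -> vfun => f \o g)/id]_(i <- r)
    opA_ a b B C i (al i)) (Deriv a b delta u) in
    L2 a b w /\ eq_ae a b (Deriv a b (be r) u) w.
  have [_] := H _ (index_enum_uniq 'I_N.+1).
  rewrite (_ : be _ = al)//; apply/funext => l.
  by rewrite /be mem_index_enum.
elim: r => [_|i r IH] /=.
  rewrite big_nil; split => //.
  by rewrite (_ : be _ = delta); [exact: eq_ae_refl|exact/funext].
move=> /andP[ir ur]; have [sw hw] := IH ur; rewrite big_cons /=.
have gA := goodV_opA_ abW B C i (al i); have [gA1 _ _] := gA.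
split; first exact: gA1.
have [sr _] := Deriv_spec hS (be_le r).
apply: eq_ae_trans (goodV_eq_ae gA sr sw hw).
have bei : be (i :: r) i = al i by rewrite /be mem_head.
have be_r : set_idx i (be (i :: r)) (delta i) = be r.
  apply/funext => l; rewrite /set_idx /be inE.
  by case: eqP => [->|] //=; rewrite (negbTE ir).
have [ji|ji] := ltnP (al i) (delta i).
  by have := Deriv_opA hS (hD i) (be_le (i :: r)); rewrite bei be_r; exact.
have -> : opA_ a b B C i (al i) = id by rewrite /opA_ ltnNge ji.
rewrite (_ : be (i :: r) = be r); first exact: eq_ae_refl.
apply/funext => l; rewrite /be inE; case: eqP => [->|] //=.
by rewrite (negbTE ir); apply/eqP; rewrite eqn_leq al_le.
Qed.

Lemma Dom_opT (u : vfun) : Dom a b B C u ->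
  eq_ae a b u (opT a b B C (Deriv a b delta u)).
Proof.
move=> hD; apply: eq_ae_trans (Deriv_comp_all hD (fun=> leq0n _)).
by apply: eq_ae_sym; apply: (Deriv0 ab); exact: hD.1.1.
Qed.

Lemma pde_rhs_opA A (u : vfun) : Dom a b B C u ->
  eq_ae a b (pde_rhs a b A u) (opA a b B C A (Deriv a b delta u)).
Proof.
move=> hD; have [sd _] := Deriv_spec hD.1 (fun l => leqnn (delta l)).
have le_al (al : midx delta) l : (midx_nat al l <= delta l)%N by rewrite -ltnS ltn_ord.
have : {ae mu, forall s, forall al : midx delta, Om s ->
    mulMpoly (A al) (Deriv a b (midx_nat al) u) s =
    mulMpoly (A al) (comp_all (fun i => opA_ a b B C i (al i)) (Deriv a b delta u)) s}.
  apply: ae_forall_count => al.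
  have [gc _ _] := goodV_comp_all (fun i => goodV_opA_ abW B C i (midx_nat al i)).
  have [s1 _] := Deriv_spec hD.1 (le_al al).
  exact: (goodV_eq_ae (goodV_mulMpoly abW (A al)) s1 (gc _ sd) (Deriv_comp_all hD (le_al al))).
by apply: filterS => s hs Os; apply: eq_bigr => al _; exact: hs.
Qed.

End mixed_representation.

(** * Tests on which T is not zero *)

Section box_volume.
Context (R : realType).
Local Notation leb := (@lebesgue_measure R).

Lemma Rintegral_box1_cst N (a b : 'I_N -> R) : (forall i, a i < b i) ->
  \int[lebesgueN R N]_(s in box a b) 1 = \prod_i (b i - a i).
Proof.
elim: N a b => [|N IH] a b ab; first by rewrite Rintegral_lebesgue0 big_ord0.
pose one (j : 'I_N) : R -> R := fun=> 1.
have s1 (j : 'I_N) : smooth1 (one j) by exact: smooth1_cst.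
have s0 : smooth1 (fun=> 1 : R) by exact: smooth1_cst.
have mB := measurable_box a b.
have i1 : (lebesgueN R N.+1).-integrable (box a b) (EFin \o (fun=> 1)).
  exact: (sqint_integrable mB (lebesgueN_box_fin a b) (sqint_cst mB (lebesgueN_box_fin a b) 1)).
transitivity (\int[lebesgueN R N.+1]_(s in box a b) (1 * tensor (mkt ord0 (fun=> 1) one) s)).
  apply: eq_Rintegral => s _; rewrite mul1r /tensor big1// => j _.
  by rewrite /mkt; case: unliftP.
rewrite (Rintegral_mkt ab ord0 i1 s0 s1) (bigD1_ord ord0)//=.
rewrite -(IH (a \o lift ord0) (b \o lift ord0)); last by move=> j; exact: ab.
rewrite -RintegralZl//; last 2 first.
- exact: measurable_box.
- have mB' := measurable_box (a \o lift ord0) (b \o lift ord0).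
  by apply: (sqint_integrable mB' (lebesgueN_box_fin _ _)); exact: (sqint_cst mB' (lebesgueN_box_fin _ _)).
apply: eq_Rintegral => t _; rewrite /tensor big1// !mulr1.
by rewrite (Rintegral_itv_cst (ltW (ab ord0))) mul1r.
Qed.

(** If every tensor test vanished almost everywhere, the constant 1 would be orthogonal to all of
    them, hence 0 almost everywhere, against the positive volume of the box. *)
Lemma tensor_neq0 N (a b : 'I_N -> R) : (forall i, a i < b i) ->
  exists2 phi, (forall i, test1 (a i) (b i) (phi i)) &
    ~ {ae lebesgueN R N, forall s, box a b s -> tensor phi s = 0}.
Proof.
move=> ab; apply: contrapT => h.
have mB := measurable_box a b.
have i1 : (lebesgueN R N).-integrable (box a b) (EFin \o (fun=> 1)).
  exact: (sqint_integrable mB (lebesgueN_box_fin a b) (sqint_cst mB (lebesgueN_box_fin a b) 1)).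
have z : {ae lebesgueN R N, forall s, box a b s -> 1 = 0 :> R}.
  apply: (fundamentalN ab i1) => phi tphi; have st i : smooth1 (phi i) by have [] := tphi i.
  have t0 : {ae lebesgueN R N, forall s, box a b s -> tensor phi s = 0}.
    by apply: contrapT => h'; apply: h; exists phi.
  rewrite -[RHS](@mul0r _ (fine (lebesgueN R N (box a b)))) -Rintegral_cst//.
  apply: ae_eq_Rintegral => //.
  - by apply: measurable_funM => //; exact: measurable_tensor.
  - by apply: filterS t0 => s hs Bs; rewrite hs// mulr0.
have : \int[lebesgueN R N]_(s in box a b) 1 = 0 :> R.
  rewrite -[RHS](@mul0r _ (fine (lebesgueN R N (box a b)))) -Rintegral_cst//.
  exact: ae_eq_Rintegral.
rewrite Rintegral_box1_cst// => /eqP; apply/negP; rewrite gt_eqF// prodr_gt0// => i _.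
by rewrite subr_gt0.
Qed.

End box_volume.

Section test_taylor.
Context (R : realType) (a b : R) (ab : a < b).
Local Notation leb := (@lebesgue_measure R).
Local Notation Rm := (measurableTypeR R).
Local Notation I := (`[a, b]%classic : set Rm).

Lemma sqint_smooth1 phi : smooth1 phi -> sqint leb I phi.
Proof.
move=> s0; have [K hK] := smooth1_bounded (ltW ab) s0.
apply: (sqint_bounded _ (leb_itv_fin (ltW ab)) _ hK); first exact: measurable_itv.
exact: smooth1_measurableR.
Qed.

(** A test vanishes at a with all its derivatives, so Taylor's formula reduces to its remainder. *)
Lemma test1_taylor phi m j x : test1 a b phi -> I x ->
  \int[leb]_(th in `[a, x]) (mono m (x - th) * derive1n (j + m.+1) phi th) = derive1n j phi x.
Proof.
move=> tphi Ix; have sk k : smooth1 (derive1n k phi) by have [] := test1_iter k tphi.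
have h := @taylor_int R a b ab (j + m.+1) (fun k => derive1n k phi)
  (derive1n (j + m.+1) phi) (sqint_smooth1 (sk _)).
rewrite (h _ m j) // {h}.
  rewrite big1 ?add0r// => l _; rewrite (test1_bound_left (test1_iter _ tphi))//.
  by rewrite mulr0.
move=> k y kd Iy.
have /andP[ay yb] : a <= y <= b by move: Iy; rewrite /= in_itv.
rewrite (_ : \int[leb]_(t in _) _ = \int[leb]_(t in `[a, y]) derive1n k.+1 phi t).
  have dk z : is_derive z (1 : R) (derive1n k phi) (derive1n k.+1 phi z).
    by rewrite derive1nS; exact: smooth1_is_derive.
  have ck : continuous (derive1n k.+1 phi) by exact: smooth1_continuous.
  by rewrite (Rintegral_FTC2 ay ck dk) addrCA subrr addr0.
apply: eq_Rintegral => t _; case: ltnP => // kd'.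
by congr derive1n; apply/eqP; rewrite eqn_leq kd' kd.
Qed.

Lemma integrable_mono_smooth1 phi m x : smooth1 phi -> I x ->
  leb.-integrable I (EFin \o (fun th => mono m (x - th) * phi th)).
Proof.
move=> sp Ix; pose a1 (_ : 'I_1) := a; pose b1 (_ : 'I_1) := b.
have ab1 i : a1 i <= b1 i by exact: ltW.
exact: (@integrable_bker R 0 a1 b1 ab1 ord0 _ x _ Ix
  (bker_monoB (Ibounded ab1 ord0) m) (sqint_smooth1 sp)).
Qed.

Lemma test1_taylorZ phi m j x c : test1 a b phi -> I x ->
  \int[leb]_(th in `[a, x]) (mono m (x - th) * (derive1n (j + m.+1) phi th * c)) =
  derive1n j phi x * c.
Proof.
move=> tphi Ix; rewrite -(test1_taylor m j tphi Ix).
have [sk _] := test1_iter (j + m.+1) tphi.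
have mx : measurable (`[a, x]%classic : set Rm) by exact: measurable_itv.
have /andP[ax xb] : a <= x <= b by move: Ix; rewrite /= in_itv.
rewrite -RintegralZr//; first by apply: eq_Rintegral => th _; rewrite mulrA.
have mI : measurable I by exact: measurable_itv.
have sub : (`[a, x]%classic : set Rm) `<=` I.
  by move=> y /=; rewrite !in_itv /= => /andP[-> h]; exact: le_trans xb.
exact: (integrableS mI mx sub (integrable_mono_smooth1 m sk Ix)).
Qed.
End test_taylor.

Section opT_tensor.
Context (R : realType) (n N : nat) (a b : 'I_N.+1 -> R) (ab : forall i, a i < b i).
Context (delta : 'I_N.+1 -> nat)
  (B C : forall i, 'I_(delta i) -> 'I_(delta i) -> 'M[R]_n).
Local Notation mu := (lebesgueN R N.+1).
Local Notation leb := (@lebesgue_measure R).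
Local Notation Om := (box a b).
Local Notation Rm := (measurableTypeR R).
Local Notation vfun := (N.+1.-tuple R -> 'cV[R]_n).

Let abW j : a j <= b j := ltW (ab j).

Definition vtensor (c : 'I_n) (phi : 'I_N.+1 -> R -> R) : vfun :=
  fun s => tensor phi s *: delta_mx c 0.

Lemma L2_vtensor c phi : (forall i, smooth1 (phi i)) -> L2 a b (vtensor c phi).
Proof.
move=> sp k; have [M hM] := tensor_bounded abW sp.
have mOm := measurable_box a b.
have mt : measurable_fun Om (tensor phi) by exact: measurable_tensor sp.
have st := sqint_bounded mOm (lebesgueN_box_fin a b) mt hM.
apply: (eq_sqint mOm _ (sqintZ mOm (delta_mx c 0 k 0) st)) => // s _.
by rewrite !mxE mulrC.
Qed.

(** By Taylor's formula the Volterra integral is phi0 at s_i, and each block of the boundary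
    integral is a derivative of phi0 at b_i, hence 0; K^i then multiplies 0. *)
Lemma opA_vtensor i c (phi : 'I_N.+1 -> R -> R) phi0 s : test1 (a i) (b i) phi0 ->
  phi i = derive1n (delta i) phi0 -> Om s ->
  opA_ a b B C i 0 (vtensor c phi) s =
  vtensor c (fun l => if l == i then phi0 else phi l) s.
Proof.
move=> t0 phii Os.
have Is : `[a i, b i]%classic (tnth s i) by have := Os i; rewrite /= in_itv.
set w : 'cV[R]_n := (\prod_(l < N.+1 | l != i) phi l (tnth s l)) *: delta_mx c 0.
have vE th : vtensor c phi (upd s i th) = phi i th *: w.
  by rewrite /vtensor tensor_upd scalerA mulrC.
have -> : vtensor c (fun l => if l == i then phi0 else phi l) s = phi0 (tnth s i) *: w.
  rewrite /vtensor /tensor (bigD1 i)//= eqxx scalerA; congr (_ * _ *: _).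
  by apply: eq_bigr => l /negbTE ->.
have [d0|d0] := leqP (delta i) 0.
  have -> : opA_ a b B C i 0 = id by rewrite /opA_ ltnNge d0.
  rewrite leqn0 in d0; rewrite -[in LHS](upd_tnth s i) vE phii.
  by rewrite (eqP d0).
have [m dm] : exists m, (delta i = m.+1)%N by exists (delta i).-1; rewrite prednK.
clearbody w; have mI : measurable (`[a i, b i]%classic : set Rm) by exact: measurable_itv.
have Ib : `[a i, b i]%classic (b i) by rewrite /= in_itv /= lexx abW.
rewrite /opA_ d0; under [X in vintegral _ X - _]eq_fun do rewrite vE.
under [X in _ - vintegral _ X]eq_fun do rewrite vE.
have dd : (0 + (delta i - 1 - 0).+1)%N = delta i by move: d0; case: (delta i) => // d' _; rewrite subn0 subSS subn0.
rewrite -[RHS]subr0; congr (_ - _).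
  apply/colP => k; rewrite !mxE -(test1_taylorZ (ab i) (delta i - 1 - 0)%N 0 (w k 0) t0 Is).
  by apply: eq_Rintegral => th _; rewrite !mxE phii dd.
set Mx := _^T *m _.
have -> : (fun th : R => Mx *m Ed n (delta i) (b i - th) *m (phi i th *: w)) =
    (fun th : R => Mx *m (Ed n (delta i) (b i - th) *m (phi i th *: w))).
  by apply/funext => th; rewrite mulmxA.
(* Row q lies in block [sig1 q]. Writing delta_i as [sig1 q] plus the degree of the monomial plus
   one puts the integral in the form of [test1_taylorZ]. *)
have fE q x : (Ed n (delta i) (b i - x) *m (phi i x *: w)) q 0 =
    mono ((delta i).-1 - tagnat.sig1 q) (b i - x) *
    (derive1n (tagnat.sig1 q + ((delta i).-1 - tagnat.sig1 q).+1) phi0 x * w (tagnat.sig2 q) 0).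
  have -> : (tagnat.sig1 q + ((delta i).-1 - tagnat.sig1 q).+1)%N = delta i.
    by have := ltn_ord (tagnat.sig1 q); lia.
  rewrite mxE (bigD1 (tagnat.sig2 q))//= [X in _ + X]big1 => [|l lq].
    by rewrite addr0 !mxE eqxx mulr1n phii.
  by rewrite !mxE eq_sym (negbTE lq) mulr0n mul0r.
rewrite -mulmx_vintegral//.
  rewrite [X in _ *m X](_ : _ = 0) ?mulmx0//; apply/colP => q; rewrite !mxE.
  under eq_Rintegral do rewrite fE.
  rewrite (test1_taylorZ (ab i) _ _ _ t0 Ib).
  by rewrite (test1_bound_right (test1_iter _ t0))// mul0r.
move=> q; set j := (tagnat.sig1 q + ((delta i).-1 - tagnat.sig1 q).+1)%N.
have [sj _] := test1_iter j t0.
have := integrableZl mI (w (tagnat.sig2 q) 0)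
  (integrable_mono_smooth1 (ab i) ((delta i).-1 - tagnat.sig1 q) sj Ib).
apply: eq_integrable => // x _; rewrite /= fE -EFinM.
by congr EFin; rewrite -/j; ring.
Qed.

Lemma opT_vtensor c phi : (forall i, test1 (a i) (b i) (phi i)) ->
  eq_ae a b (opT a b B C (vtensor c (dtensor delta phi))) (vtensor c phi).
Proof.
move=> tphi.
(* The intermediate tensors: the factors in r are already integrated back to phi, the others are
   still differentiated. *)
pose ph (r : seq 'I_N.+1) l := if l \in r then phi l else derive1n (delta l) (phi l).
have sph r l : smooth1 (ph r l).
  by rewrite /ph; case: ifP => _; [have [] := tphi l|have [] := test1_iter (delta l) (tphi l)].
suff H r : uniq r -> let w := (\big[(fun f g : vfun -> vfun => f \o g)/id]_(i <- r)
    opA_ a b B C i 0) (vtensor c (dtensor delta phi)) in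
    L2 a b w /\ eq_ae a b w (vtensor c (ph r)).
  have [_] := H _ (index_enum_uniq 'I_N.+1).
  rewrite (_ : ph _ = phi)//; apply/funext => l.
  by rewrite /ph mem_index_enum.
elim: r => [_|i r IH] /=.
  rewrite big_nil; split; first exact: L2_vtensor (sph [::]).
  exact: eq_ae_refl.
move=> /andP[ir ur]; have [sw hw] := IH ur; rewrite big_cons /=.
have gA := goodV_opA_ abW B C i 0; have [gA1 _ _] := gA.
split; first exact: gA1.
have sr := L2_vtensor c (sph r).
apply: eq_ae_trans (goodV_eq_ae gA sw sr hw) _.
apply: aeW => s Os; rewrite (@opA_vtensor i c (ph r) (phi i)) //; last first.
  by rewrite /ph (negbTE ir).
rewrite (_ : ph (i :: r) = fun l => if l == i then phi i else ph r l)//.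
by apply/funext => l; rewrite /ph inE; case: eqP => [->|].
Qed.

Lemma opT_neq0 : (0 < n)%N ->
  exists2 v, L2 a b v & 0 < dotL2 a b (opT a b B C v) (opT a b B C v).
Proof.
move=> n0; pose c := Ordinal n0.
have [phi tphi hphi] := tensor_neq0 ab.
have sd i : smooth1 (dtensor delta phi i) by have [] := test1_iter (delta i) (tphi i).
exists (vtensor c (dtensor delta phi)); first exact: L2_vtensor.
have [gT _ _] := goodV_opT abW B C.
have sT := gT _ (L2_vtensor c sd).
rewrite lt_neqAle dotL2_ge0 andbT; apply/eqP => /esym/(dotL2_eq0 sT) h.
apply: hphi; have := eq_ae_trans (eq_ae_sym (opT_vtensor c tphi)) h.
apply: filterS => s hs Os; have := hs Os => /(congr1 (fun v : 'cV[R]_n => v c 0)).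
by rewrite !mxE !eqxx mulr1.
Qed.

End opT_tensor.

(** * Decay from a differential inequality, and operator norms *)

Section gronwall.
Context (R : realType).

(** exp(k t) V(t) is nonincreasing. Differentiability is stated as an estimate restricted to r >= 0,
    the form in which [form_derivative] delivers it; k stands here for twice the rate. *)
Lemma gronwall_decay (V dV : R -> R) (k : R) :
  (forall t : R, 0 <= t -> forall e : R, 0 < e -> exists2 h : R, 0 < h & forall r : R, 0 <= r ->
    `|r - t| < h -> `|V r - V t - (r - t) * dV t| <= e * `|r - t|) ->
  (forall t : R, 0 <= t -> dV t <= - (k * V t)) ->
  forall t : R, 0 <= t -> V t <= expR (- (k * t)) * V 0.
Proof.
move=> hV hd T T0.
(* extending V linearly to the left of 0 makes it differentiable at 0 *)
pose f (t : R) := if 0 <= t then V t else V 0 + t * dV 0.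
have df (t : R) : 0 <= t -> is_derive t (1 : R) f (dV t).
  move=> t0; apply: is_derive_eps => e e0; have [d d0 hd'] := hV t t0 e e0.
  have ft : f t = V t by rewrite /f t0.
  have tri h : t + h - t = h by rewrite addrC addKr.
  have [tp|tn] := ltP 0 t.
    exists (Num.min d t); first by rewrite lt_min d0.
    move=> h; rewrite lt_min => /andP[hd1 ht]; have th : 0 <= t + h.
      by have := ler_norm (- h); rewrite normrN; lra.
    by have := hd' (t + h) th; rewrite tri => /(_ hd1); rewrite /f th t0.
  have {tn} tz : t = 0 by apply/le_anti; rewrite tn t0.
  exists d => // h hd1; case: (leP 0 (t + h)) => th.
    by have := hd' (t + h) th; rewrite tri => /(_ hd1); rewrite /f th t0.
  rewrite ft {1}/f [0 <= t + h]leNgt th /= tz.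
  have -> : V 0 + (0 + h) * dV 0 - V 0 - h * dV 0 = 0 by ring.
  by rewrite normr0 mulr_ge0// ltW.
have de (t : R) : is_derive t (1 : R) (fun t : R => expR (k * t)) (expR (k * t) * k).
  have dl : is_derive t (1 : R) (fun t : R => k * t) k.
    rewrite (_ : (fun t : R => _) = (fun t : R => k * t + 0)); first exact: is_derive_affine.
    by apply/funext => z; rewrite addr0.
  exact: (@is_derive1_comp R expR (fun t : R => k * t) t _ _ (is_derive_expR _) dl).
pose W (t : R) := expR (k * t) * f t.
have dW (t : R) : 0 <= t -> is_derive t (1 : R) W (expR (k * t) * (dV t + k * V t)).
  move=> t0; have := is_deriveM (de t) (df t t0).
  rewrite (_ : _ *: _ + _ = expR (k * t) * (dV t + k * V t)) // /f t0.
  by rewrite /GRing.scale /=; ring.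
have : W T <= W 0.
  apply: (@ler0_derive1_nincr R W 0 T) => //.
  - move=> x; rewrite in_itv /= => /andP[x0 _]; have /is_derive1P[//] := dW x (ltW x0).
  - move=> x; rewrite in_itv /= => /andP[x0 _]; have /is_derive1P[_ ->] := dW x (ltW x0).
    by rewrite pmulr_rle0 ?expR_gt0//; have := hd x (ltW x0); lra.
  - apply: continuous_in_subspaceT => x; rewrite inE /= in_itv /= => /andP[x0 _].
    apply/differentiable_continuous/derivable1_diffP.
    by have /is_derive1P[] := dW x x0.
rewrite /W /f T0 lexx mulr0 expR0 mul1r => h.
by rewrite expRN mulrC ler_pdivlMr ?expR_gt0// mulrC.
Qed.

End gronwall.

Section operator_norm.
Context (R : realType) (N : nat) (a b : 'I_N -> R).
Local Notation vfun n := (N.-tuple R -> 'cV[R]_n).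

Lemma goodV_norm n m (F : vfun n -> vfun m) : goodV a b F ->
  exists2 K, 0 <= K & forall v, L2 a b v -> normL2 a b (F v) <= K * normL2 a b v.
Proof.
move=> [_ [C C0 hC] _]; exists (Num.sqrt C); first exact: sqrtr_ge0.
by move=> v sv; rewrite /normL2 -sqrtrM//; apply: ler_wsqrtr; exact: hC.
Qed.

(** From |F^* v|^2 = <F F^* v, v> <= K |F^* v| |v|, divided by |F^* v| if it is not 0. It makes P^*
    T bounded, so that its [opnorm] is a genuine supremum. *)
Lemma goodV_adj n m (F : vfun n -> vfun m) : goodV a b F -> goodV a b (adjoint a b F).
Proof.
move=> gF; have [sF aF] := goodV_adjoint gF; have [K K0 hK] := goodV_norm gF.
have [F1 _ _] := gF; split => //.
- exists (K ^+ 2); first exact: sqr_ge0.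
  move=> v sv; have sG := sF _ sv.
  rewrite -!normL2_sqr -exprMn.
  rewrite ler_sqr ?nnegrE ?mulr_ge0 ?normL2_ge0//.
  have [z|z] := eqVneq (normL2 a b (adjoint a b F v)) 0.
    by rewrite z mulr_ge0// normL2_ge0.
  have p : 0 < normL2 a b (adjoint a b F v) by rewrite lt_neqAle eq_sym z normL2_ge0.
  rewrite -(ler_pM2l p) -expr2 normL2_sqr -(aF _ _ sG sv).
  apply: le_trans (ler_norm _) _; apply: le_trans (normL2_cs (F1 _ sG) sv) _.
  by rewrite mulrA [_ * K]mulrC; apply: ler_wpM2r; [exact: normL2_ge0|exact: hK].
- by exists F; split => // u v su sv; rewrite dotL2C -aF// dotL2C.
Qed.

Lemma opnorm_bound n m (F : vfun n -> vfun m) v : goodV a b F -> L2 a b v ->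
  normL2 a b (F v) <= opnorm a b F * normL2 a b v.
Proof.
move=> gF sv; have [K K0 hK] := goodV_norm gF; have [F1 _ _] := gF.
have [z|z] := eqVneq (normL2 a b v) 0.
  by have := hK v sv; rewrite z !mulr0.
have p : 0 < normL2 a b v by rewrite lt_neqAle eq_sym z normL2_ge0.
set c := (normL2 a b v)^-1.
have scv := L2Z c sv.
(* Homogeneity becomes an instance of [goodV_lin] once c v is written v + (c - 1) v. *)
have e1 : (fun s => v s + (c - 1) *: v s) = (fun s => c *: v s).
  by apply/funext => s; rewrite scalerBl scale1r addrC subrK.
have e2 : (fun s => F v s + (c - 1) *: F v s) = (fun s => c *: F v s).
  by apply/funext => s; rewrite scalerBl scale1r addrC subrK.
have := goodV_lin gF (c - 1) sv sv; rewrite e1 e2 => h.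
have := eq_ae_normL2 (F1 _ scv) (L2Z c (F1 _ sv)) h.
rewrite normL2Z; last exact: F1.
have cp : 0 < c by rewrite invr_gt0.
rewrite gtr0_norm// => hc.
rewrite -ler_pdivrMr// mulrC -/c -hc; apply: ub_le_sup; last first.
  exists (fun s => c *: v s) => //; split => //.
  by rewrite normL2Z// gtr0_norm// mulVf.
exists K => _ [w [sw w1] <-]; apply: le_trans (hK _ sw) _.
by rewrite -[leRHS]mulr1; apply: ler_wpM2l.
Qed.

End operator_norm.

Lemma goodV_lin3 (R : realType) N (a b : 'I_N -> R) n m
    (F : (N.-tuple R -> 'cV[R]_n) -> N.-tuple R -> 'cV[R]_m) c x y z :
  goodV a b F -> L2 a b x -> L2 a b y -> L2 a b z ->
  eq_ae a b (F (fun s => x s - y s - c *: z s)) (fun s => F x s - F y s - c *: F z s).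
Proof.
move=> gF sx sy sz; have sxy := L2D sx (L2Z (-1) sy).
have e : (fun s => x s - y s - c *: z s) = (fun s => (x s + (-1) *: y s) + (- c) *: z s).
  by apply/funext => s; rewrite scaleN1r scaleNr.
have := goodV_lin gF (- c) sxy sz; rewrite -e => h1.
have := goodV_lin gF (-1) sx sy => h2.
apply: filterS2 h1 h2 => s h1 h2 Os.
by rewrite h1// h2// scaleN1r scaleNr.
Qed.

(** * Differentiating D^delta u along a solution *)

Section solutions.
Context (R : realType) (n N : nat) (a b : 'I_N.+1 -> R) (ab : forall i, a i < b i).
Context (delta : 'I_N.+1 -> nat)
  (B C : forall i, 'I_(delta i) -> 'I_(delta i) -> 'M[R]_n).
Hypothesis adm : forall i, admissible (a i) (b i) (@B i) (@C i).
Context (A : midx delta -> 'M[mpoly.mpoly N.+1 R]_n).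
Local Notation vfun := (N.+1.-tuple R -> 'cV[R]_n).
Local Notation T := (opT a b B C).
Local Notation D := (Deriv a b delta).

Let abW j : a j <= b j := ltW (ab j).
Let gT : goodV a b T := goodV_opT abW B C.

Let sD (w : vfun) : S2 a b delta w -> L2 a b (D w).
Proof. by move=> hw; have [] := Deriv_spec hw (fun l => leqnn (delta l)). Qed.

Lemma normS2_Deriv (al : midx delta) (w : vfun) :
  normL2 a b (Deriv a b (midx_nat al) w) <= normS2 a b delta w.
Proof.
rewrite -[leLHS]ger0_norm ?normL2_ge0// -sqrtr_sqr; apply: ler_wsqrtr.
by rewrite (bigD1 al)//= lerDl sumr_ge0// => be _; exact: sqr_ge0.
Qed.

Lemma normS2_top (w : vfun) : normL2 a b (D w) <= normS2 a b delta w.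
Proof.
have := normS2_Deriv (finfun (fun i : 'I_N.+1 => @ord_max (delta i)) : midx delta) w.
by rewrite (_ : midx_nat _ = delta)//; apply/funext => i; rewrite /midx_nat ffunE.
Qed.

Lemma normS2_bot (w : vfun) : S2 a b delta w -> normL2 a b w <= normS2 a b delta w.
Proof.
move=> hw.
have := normS2_Deriv (finfun (fun i : 'I_N.+1 => @ord0 (delta i)) : midx delta) w.
rewrite (_ : midx_nat _ = fun=> 0%N); last by apply/funext => i; rewrite /midx_nat ffunE.
have [s0 _] := Deriv_spec hw (fun=> leq0n _).
by rewrite (eq_ae_normL2 s0 hw.1 (Deriv0 ab hw.1)).
Qed.

Lemma Deriv_lin3 c (x y z : vfun) : S2 a b delta x -> S2 a b delta y -> S2 a b delta z ->
  let w := fun s => x s - y s - c *: z s in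
  S2 a b delta w /\ eq_ae a b (D w) (fun s => D x s - D y s - c *: D z s).
Proof.
move=> hx hy hz w; have hxy := S2_lin ab (-1) hx hy.
have e : w = (fun s => (x s + (-1) *: y s) + (- c) *: z s).
  by apply/funext => s; rewrite scaleN1r scaleNr.
rewrite e; split; first exact: S2_lin.
have h1 := Deriv_lin ab (- c) hxy hz (fun l => leqnn (delta l)).
have h2 := Deriv_lin ab (-1) hx hy (fun l => leqnn (delta l)).
apply: filterS2 h1 h2 => s h1 h2 Os.
by rewrite h1// h2// scaleN1r scaleNr.
Qed.

(** v' is D^delta u', and T v' = A v amounts to the vanishing of the defect z = u' - T v'. Since T
    D^delta fixes u r and u t, (r - t) z equals T D^delta w - w, where w is the remainder of the
    expansion of u at t, which is o(r - t) in S_2^delta. *)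
Lemma solution_derivative u0 u t : solution a b B C A u0 u -> 0 <= t ->
  exists v', [/\ L2 a b v',
    forall e, 0 < e -> exists2 h, 0 < h & forall r, 0 <= r -> `|r - t| < h ->
      normL2 a b (fun s => D (u r) s - D (u t) s - (r - t) *: v' s) <= e * `|r - t| &
    eq_ae a b (T v') (opA a b B C A (D (u t)))].
Proof.
move=> [hD _ hd] t0; have [u' [hu' hlim] hrhs] := hd t t0.
have [K K0 hK] := goodV_norm gT; have [gT1 _ _] := gT.
have sv := sD hu'; exists (D u'); split => //.
  move=> e e0; have [h h0 hh] := hlim e e0; exists h => // r r0 rt.
  have [hw1 hw2] := Deriv_lin3 (r - t) (hD r r0).1 (hD t t0).1 hu'.
  apply: le_trans (hh r r0 rt); apply: le_trans (normS2_top _).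
  rewrite (eq_ae_normL2 _ _ hw2)//; first exact: sD.
  by apply: L2B; [apply: L2B; apply: sD; exact: (hD _ _).1|exact: L2Z].
have su' : L2 a b u' := hu'.1.
have sTv := gT1 _ sv.
pose z s := u' s - T (D u') s.
have sz : L2 a b z by exact: L2B.
suff z0 : normL2 a b z = 0.
  have dz : dotL2 a b z z = 0 by rewrite -normL2_sqr z0 expr0n.
  apply: eq_ae_trans (pde_rhs_opA ab adm A (hD t t0)).
  apply: eq_ae_trans hrhs; have := dotL2_eq0 sz dz.
  by apply: filterS => s hs Os; apply/esym/eqP; rewrite -subr_eq0; apply/eqP/hs.
have bnd e : 0 < e -> normL2 a b z <= (K + 1) * e.
  move=> e0; have [h h0 hh] := hlim e e0.
  (* A point to the right of t, so that t = 0 is covered as well. *)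
  pose r := t + h / 2; have r0 : 0 <= r by rewrite /r; lra.
  have rt : r - t = h / 2 by rewrite /r; lra.
  have rt0 : 0 < r - t by rewrite rt; lra.
  have nrt : `|r - t| < h by rewrite gtr0_norm// rt; lra.
  have hr := hh r r0 nrt.
  have hDr := hD r r0; have hDt := hD t t0.
  have [hw1 hw2] := Deriv_lin3 (r - t) hDr.1 hDt.1 hu'.
  set w := (fun s => _) in hw1 hw2 hr.
  have sw : L2 a b w := hw1.1.
  have sDw := sD hw1; have sDr := sD hDr.1; have sDt := sD hDt.1.
  have E : eq_ae a b (fun s => T (D w) s + (-1) *: w s) (fun s => (r - t) *: z s).
    have s3 : L2 a b (fun s => D (u r) s - D (u t) s - (r - t) *: D u' s).
      by apply: L2B; [exact: L2B|exact: L2Z].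
    have e1 := goodV_eq_ae gT sDw s3 hw2.
    have e2 := goodV_lin3 (r - t) gT sDr sDt sv.
    have e3 := Dom_opT ab adm hDr; have e4 := Dom_opT ab adm hDt.
    have e12 := eq_ae_trans e1 e2.
    apply: filterS3 e12 e3 e4 => s e12 e3 e4 Os.
    rewrite e12// /w e3// e4// /z scaleN1r scalerBr.
    move: (T (D (u r)) s) (T (D (u t)) s) (T (D u') s) (u' s) => X Y Z U.
    by apply/colP => c; rewrite !mxE; ring.
  have n1 := eq_ae_normL2 (L2D (gT1 _ sDw) (L2Z (-1) sw)) (L2Z (r - t) sz) E.
  rewrite normL2Z// gtr0_norm// in n1.
  rewrite gtr0_norm// in hr.
  rewrite -(ler_pM2l rt0) -n1; apply: le_trans (normL2_triangle (gT1 _ sDw) (L2Z _ sw)) _.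
  rewrite normL2Z// normrN1 mul1r.
  have := hK _ sDw; have := le_trans (normS2_top w) hr; have := le_trans (normS2_bot hw1) hr.
  move=> h1 h2 h3.
  have h4 : K * normL2 a b (D w) <= K * (e * (r - t)) by exact: ler_wpM2l.
  have -> : (r - t) * ((K + 1) * e) = K * (e * (r - t)) + e * (r - t) by ring.
  by apply: lerD => //; exact: le_trans h4.
apply/eqP; rewrite eq_le normL2_ge0 andbT leNgt; apply/negP => zp.
have K1 : 0 < K + 1 by lra.
(* With this value of e the bound reads |z| <= |z| / 2. *)
have := bnd (normL2 a b z / (K + 1) / 2); rewrite !divr_gt0// => /(_ isT).
apply/negP; rewrite -ltNge.
have -> : (K + 1) * (normL2 a b z / (K + 1) / 2) = normL2 a b z / 2 by field; rewrite gt_eqF.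
by lra.
Qed.

End solutions.

(** * The quadratic form <T v, P v> along a curve *)

Section quadratic_form.
Context (R : realType) (n N : nat) (a b : 'I_N -> R).
Local Notation vfun := (N.-tuple R -> 'cV[R]_n).
Context (T P : vfun -> vfun) (gT : goodV a b T) (gP : goodV a b P).
Local Notation Bf x y := (dotL2 a b (T x) (P y)).

Let T1 := let: And3 h _ _ := gT in h.
Let P1 := let: And3 h _ _ := gP in h.

Lemma form_linl c x y z : L2 a b x -> L2 a b y -> L2 a b z ->
  Bf (fun s => x s + c *: y s) z = Bf x z + c * Bf y z.
Proof.
move=> sx sy sz; have sxy := L2D sx (L2Z c sy).
rewrite (eq_ae_dotL2 (T1 sxy) _ (P1 sz) (goodV_lin gT c sx sy)).
  by rewrite dotL2Dl ?dotL2Zl//; [exact: T1|exact: P1|exact: T1|exact: L2Z (T1 sy)|exact: P1].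
by apply: L2D; [exact: T1|exact: L2Z (T1 sy)].
Qed.

Lemma form_bound : exists2 K, 0 <= K & forall x y, L2 a b x -> L2 a b y ->
  `|Bf x y| <= K * normL2 a b x * normL2 a b y.
Proof.
have [K1 K10 h1] := goodV_norm gT; have [K2 K20 h2] := goodV_norm gP.
exists (K1 * K2); first exact: mulr_ge0.
move=> x y sx sy; apply: le_trans (normL2_cs (T1 sx) (P1 sy)) _.
have -> : K1 * K2 * normL2 a b x * normL2 a b y = (K1 * normL2 a b x) * (K2 * normL2 a b y).
  by ring.
by apply: ler_pM; rewrite ?normL2_ge0//; [exact: h1|exact: h2].
Qed.

Hypothesis sym : forall x y, L2 a b x -> L2 a b y -> Bf x y = Bf y x.

Lemma form_linr c x y z : L2 a b x -> L2 a b y -> L2 a b z ->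
  Bf z (fun s => x s + c *: y s) = Bf z x + c * Bf z y.
Proof.
move=> sx sy sz; rewrite sym//; last by apply: L2D => //; exact: L2Z.
by rewrite form_linl// (sym sx)// (sym sy).
Qed.

(** Expansion of the form at v t + h v' + z with z = o(h). Symmetry merges the two first-order terms
    into 2 <T v', P (v t)>, and four remainders are left. *)
Lemma form_derivative (v : R -> vfun) t v' : 0 <= t -> (forall r, 0 <= r -> L2 a b (v r)) ->
  L2 a b v' ->
  (forall e : R, 0 < e -> exists2 h : R, 0 < h & forall r, 0 <= r -> `|r - t| < h ->
    normL2 a b (fun s => v r s - v t s - (r - t) *: v' s) <= e * `|r - t|) ->
  forall e : R, 0 < e -> exists2 h : R, 0 < h & forall r, 0 <= r -> `|r - t| < h ->
    `|Bf (v r) (v r) - Bf (v t) (v t) - (r - t) * (2 * Bf v' (v t))| <= e * `|r - t|.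
Proof.
move=> t0 sv sv' hv E E0; have [K K0 hK] := form_bound.
set nt := normL2 a b (v t); set n' := normL2 a b v'.
have nt0 : 0 <= nt by exact: normL2_ge0.
have n'0 : 0 <= n' by exact: normL2_ge0.
(* 1 + |v t| + |v'| bounds the norms of v t and v', and that of z once c |h| <= 1. Being at least 1
   it is below its square, so the same L serves all remainders. *)
pose L := K * (1 + nt + n') ^+ 2.
have L0 : 0 <= L by rewrite mulr_ge0// sqr_ge0.
(* The remainders, with coefficients 1, 2, 2 and 1, are each of size at most L c |h|, whence the 6;
   L + 1 avoids a division by 0. *)
pose c := Num.min 1 (E / (6 * (L + 1))).
have c0 : 0 < c by rewrite lt_min ltr01 divr_gt0// mulr_gt0//; lra.
have c1 : c <= 1 by rewrite ge_min lexx.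
have cE : 6 * (L * c) <= E.
  have : c <= E / (6 * (L + 1)) by rewrite ge_min lexx orbT.
  rewrite ler_pdivlMr; last by rewrite mulr_gt0//; lra.
  by have := mulr_ge0 L0 (ltW c0); lra.
have [h1 h10 hh] := hv c c0.
exists (Num.min h1 c); first by rewrite lt_min h10.
move=> r r0; rewrite lt_min => /andP[rh rc].
have nz := hh r r0 rh; set h := r - t in rh rc nz *.
pose z s := v r s - v t s - h *: v' s; rewrite -/z in nz.
have st := sv t t0; have sr := sv r r0.
have sz : L2 a b z by apply: L2B; [exact: L2B|exact: L2Z].
pose p s := v t s + h *: v' s.
have sp : L2 a b p by apply: L2D => //; exact: L2Z.
have vr : v r = fun s => p s + 1 *: z s.
  by apply/funext => s; rewrite /p /z; apply/colP => k; rewrite !mxE; ring.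
have -> : Bf (v r) (v r) - Bf (v t) (v t) - h * (2 * Bf v' (v t)) =
    h * h * Bf v' v' + 2 * Bf (v t) z + 2 * (h * Bf v' z) + Bf z z.
  rewrite {1 2}vr form_linl//; last by apply: L2D => //; exact: L2Z.
  rewrite !(form_linr 1 sp sz)// (sym sz sp) /p !form_linl// !(form_linr h st sv')//.
  by rewrite (sym st sv'); ring.
have b1 : `|h * h * Bf v' v'| <= `|h| * (L * c).
  rewrite !normrM -mulrA ler_wpM2l//.
  have q1 := hK _ _ sv' sv'; rewrite -/n' in q1.
  have q2 : K * n' * n' <= L.
    by rewrite /L -mulrA ler_wpM2l// -expr2 ler_sqr ?nnegrE; lra.
  rewrite mulrC; apply: ler_pM => //; [exact: le_trans q2|exact: ltW].
have kz x : L2 a b x -> normL2 a b x <= (1 + nt + n') -> `|Bf x z| <= L * (c * `|h|).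
  move=> sx nx; apply: le_trans (hK _ _ sx sz) _; apply: ler_pM => //; first exact: mulr_ge0 (normL2_ge0 _ _ _).
    exact: normL2_ge0.
  rewrite /L ler_wpM2l//; apply: le_trans nx _.
  by rewrite expr2 ler_peMr//; lra.
have ch1 : c * `|h| <= 1 by rewrite -[leRHS]mulr1; apply: ler_pM => //; [exact: ltW|apply: le_trans (ltW rc) c1].
have b2 : `|Bf (v t) z| <= L * (c * `|h|) by apply: kz => //; rewrite -/nt; lra.
have b3 : `|Bf v' z| <= L * (c * `|h|) by apply: kz => //; rewrite -/n'; lra.
have b4 : `|Bf z z| <= L * (c * `|h|).
  by apply: kz => //; apply: le_trans nz _; lra.
have b3' : `|h * Bf v' z| <= L * (c * `|h|).
  by rewrite normrM -[leRHS]mul1r; apply: ler_pM => //; apply: le_trans (ltW rc) c1.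
apply: le_trans (ler_normD _ _) _.
apply: le_trans (lerD (le_trans (ler_normD _ _) (lerD (ler_normD _ _) (lexx _))) (lexx _)) _.
rewrite [`|2 * Bf _ _|]normrM [`|2 * (h * _)|]normrM normr_nat.
have Eh : 6 * (L * c) * `|h| <= E * `|h| by apply: ler_wpM2r.
have e2 : L * (c * `|h|) = L * c * `|h| by rewrite mulrA.
have e3 : `|h| * (L * c) = L * c * `|h| by rewrite mulrC.
by rewrite e3 in b1; rewrite e2 in b2 b3' b4; lra.
Qed.

End quadratic_form.

(** * The Lyapunov argument *)

Section stability.
Context (R : realType) (n N : nat) (n_gt0 : (0 < n)%N).
Context (a b : 'I_N.+1 -> R) (ab : forall i, a i < b i) (delta : 'I_N.+1 -> nat)
  (B C : forall i, 'I_(delta i) -> 'I_(delta i) -> 'M[R]_n).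
Hypothesis adm : forall i, admissible (a i) (b i) (@B i) (@C i).
Context (A : midx delta -> 'M[mpoly.mpoly N.+1 R]_n) (d d' : nat) (eps k : R).
Hypotheses (eps_gt0 : 0 < eps) (k_ge0 : 0 <= k).
Context (P : 'M[R]_(n, n * mudim d ^ N.+1)) (Rm Qm : 'M[R]_(n * mudim d' ^ N.+1)).
Hypotheses (Rm_psd : psd Rm) (Qm_psd : psd Qm).
Local Notation TT := (opT a b B C).
Local Notation AA := (opA a b B C A).
Local Notation ZZ' := (IZ (n := n) a b d').
Local Notation PP := (mulM P \o IZ (n := n) a b d).
Local Notation adj F := (adjoint a b F).
Hypothesis PT_TP : eq_op_ae a b (adj PP \o TT) (adj TT \o PP).
Hypothesis TP_psd : eq_op_ae a b (adj TT \o PP)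
  (fun v s => eps ^+ 2 *: adj TT (TT v) s + adj ZZ' (mulM Rm (ZZ' v)) s).
Hypothesis PA_nsd : eq_op_ae a b
  (fun v s => adj PP (AA v) s + adj AA (PP v) s + (2 * k) *: adj PP (TT v) s)
  (fun v s => - adj ZZ' (mulM Qm (ZZ' v)) s).
Local Notation dot := (dotL2 a b).
Local Notation L2 := (L2 a b).

Let abW j : a j <= b j := ltW (ab j).
Let gT : goodV a b TT := goodV_opT abW B C.
Let gA : goodV a b AA := goodV_opA abW B C A.
Let gP : goodV a b PP := goodV_comp (goodV_mulM a b P) (goodV_IZ n abW d).
Let gZ : goodV a b ZZ' := goodV_IZ n abW d'.
Let T1 := let: And3 h _ _ := gT in h.
Let A1 := let: And3 h _ _ := gA in h.
Let P1 := let: And3 h _ _ := gP in h.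
Let Z1 := let: And3 h _ _ := gZ in h.
Let aT := goodV_adjoint gT.
Let aA := goodV_adjoint gA.
Let aP := goodV_adjoint gP.
Let aZ := goodV_adjoint gZ.

Let L2mulM (M : 'M[R]_(n * mudim d' ^ N.+1)) v : L2 v -> L2 (mulM M v).
Proof. by have [h _ _] := goodV_mulM a b M; exact: h. Qed.

(** Moving [ZZ'] across by its adjoint leaves the integral of a pointwise nonnegative quadratic
    form. *)
Lemma dotL2_psd (M : 'M[R]_(n * mudim d' ^ N.+1)) v : psd M -> L2 v ->
  0 <= dot v (adj ZZ' (mulM M (ZZ' v))).
Proof.
move=> [_ hM] sv; rewrite -aZ.2//; last exact/L2mulM/Z1.
apply: Rintegral_ge0 => s _; have := hM (ZZ' v s).
rewrite -mulmxA mxE (eq_bigr (fun c => ZZ' v s c 0 * mulM M (ZZ' v) s c 0))// => c _.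
by rewrite mxE.
Qed.

(** This is P^* T = T^* P read in a pairing; [form_derivative] needs it to merge the first-order
    terms. *)
Lemma form_sym x y : L2 x -> L2 y -> dot (TT x) (PP y) = dot (TT y) (PP x).
Proof.
move=> sx sy; rewrite aT.2//; last exact: P1.
rewrite dotL2C -(eq_ae_dotL2 _ _ sx (PT_TP sy)).
- by rewrite dotL2C -(aP.2 _ _ sx (T1 sy)) dotL2C.
- exact/aP.1/T1.
- exact/aT.1/P1.
Qed.

Lemma form_lower v : L2 v -> eps ^+ 2 * dot (TT v) (TT v) <= dot (TT v) (PP v).
Proof.
move=> sv; rewrite [leRHS]aT.2//; last exact: P1.
have s1 : L2 (adj TT (TT v)) by exact/aT.1/T1.
have s2 : L2 (adj ZZ' (mulM Rm (ZZ' v))) by apply/aZ.1/L2mulM/Z1.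
rewrite dotL2C (eq_ae_dotL2 _ _ sv (TP_psd sv)).
- rewrite dotL2Dl//; last exact: L2Z.
  rewrite dotL2Zl// dotL2C -aT.2//; last exact: T1.
  by rewrite lerDl dotL2C; exact: dotL2_psd.
- exact/aT.1/P1.
- by apply: L2D => //; exact: L2Z.
Qed.

Lemma form_upper v : L2 v ->
  dot (TT v) (PP v) <= opnorm a b (adj PP \o TT) * normL2 a b v ^+ 2.
Proof.
move=> sv; have gPT : goodV a b (adj PP \o TT) := goodV_comp (goodV_adj gP) gT.
have sPT : L2 (adj PP (TT v)) by exact/aP.1/T1.
rewrite dotL2C aP.2//; last exact: T1.
apply: le_trans (ler_norm _) _; apply: le_trans (normL2_cs sv sPT) _.
rewrite expr2 mulrA mulrC; apply: ler_wpM2r; first exact: normL2_ge0.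
exact: opnorm_bound gPT sv.
Qed.

(** Paired with v, the first two terms of the second operator identity are both <A v, P v>, and the
    right side is nonpositive because Q is positive semidefinite. *)
Lemma form_dissipation v : L2 v -> 2 * dot (AA v) (PP v) <= - (2 * k * dot (TT v) (PP v)).
Proof.
move=> sv.
have s1 : L2 (adj PP (AA v)) by exact/aP.1/A1.
have s2 : L2 (adj AA (PP v)) by exact/aA.1/P1.
have s3 : L2 (adj PP (TT v)) by exact/aP.1/T1.
have s4 : L2 (adj ZZ' (mulM Qm (ZZ' v))) by apply/aZ.1/L2mulM/Z1.
have s12 := L2D s1 s2; have s3' := L2Z (2 * k) s3.
have := eq_ae_dotL2 (L2D s12 s3') (L2N s4) sv (PA_nsd sv).
rewrite !dotL2Dl// dotL2Zl// dotL2Nl// !(dotL2C a b _ v).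
rewrite -(aP.2 _ _ sv (A1 sv)) -(aP.2 _ _ sv (T1 sv)) -(aA.2 _ _ sv (P1 sv)).
have := dotL2_psd Qm_psd sv; rewrite (dotL2C a b (PP v) (AA v)) (dotL2C a b (PP v) (TT v)).
move: (dot (AA v) (PP v)) (dot (TT v) (PP v)) (dot v _) => x y z.
by lra.
Qed.

(** At a v with T v nonzero the lower bound of the form is positive, hence so is the upper one. *)
Lemma opnorm_gt0 : 0 < opnorm a b (adj PP \o TT).
Proof.
have [v sv vT] := opT_neq0 ab B C n_gt0.
have h := le_trans (form_lower sv) (form_upper sv).
rewrite ltNge; apply/negP => o0; move: h; apply/negP; rewrite -ltNge.
apply: (@le_lt_trans _ _ 0); first by rewrite mulr_le0_ge0// sqr_ge0.
by rewrite mulr_gt0// exprn_gt0.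
Qed.

Lemma exp_stable_succ :
  exp_stable a b B C A k (Num.sqrt (opnorm a b (adj PP \o TT)) / eps).
Proof.
split => //; first by rewrite divr_gt0// sqrtr_gt0 opnorm_gt0.
move=> u0 u hu0 hu t t0; have [hD u00 _] := hu.
set o := opnorm _ _ _; have o0 : 0 < o := opnorm_gt0.
pose v r := Deriv a b delta (u r).
have sv r : 0 <= r -> L2 (v r).
  by move=> r0; have [] := Deriv_spec (hD r r0).1 (fun l => leqnn (delta l)).
(* [choice] needs a value for every real r; the condition [0 <= r] is kept inside so that a dummy
   serves for r < 0. *)
have ex r : exists v', 0 <= r -> [/\ L2 v',
    forall e, 0 < e -> exists2 h, 0 < h & forall r', 0 <= r' -> `|r' - r| < h ->
      normL2 a b (fun s => v r' s - v r s - (r' - r) *: v' s) <= e * `|r' - r| &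
    eq_ae a b (TT v') (AA (v r))].
  have [r0|r0] := pselect (0 <= r); last by exists (fun=> 0).
  by have [v' hv'] := solution_derivative ab adm hu r0; exists v'.
have /choice[v' hv'] := ex.
pose V r := dot (TT (v r)) (PP (v r)).
(* V is quadratic, so it decays at twice the rate; the final square root restores k and produces the
   one in the gain. *)
have decay : V t <= expR (- (2 * k * t)) * V 0.
  apply: (@gronwall_decay R V (fun r => 2 * dot (TT (v' r)) (PP (v r)))) => // r r0.
    move=> e e0; have [s1 h1 _] := hv' r r0.
    exact: (form_derivative gT gP form_sym r0 sv s1 h1 e0).
  have [s1 _ h2] := hv' r r0.
  rewrite (eq_ae_dotL2 (T1 s1) (A1 (sv r r0)) (P1 (sv r r0)) h2).
  exact: form_dissipation (sv r r0).
have su0 : L2 u0 := hu0.1.1.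
have v0 : v 0 = Deriv a b delta u0.
  by apply: Deriv_eq_ae => //; exact: (hD 0 (lexx _)).1.1.
have lo : eps ^+ 2 * normL2 a b (u t) ^+ 2 <= V t.
  have e := Dom_opT ab adm (hD t t0).
  have sut : L2 (u t) := (hD t t0).1.1.
  rewrite (eq_ae_normL2 sut (T1 (sv t t0)) e) normL2_sqr.
  exact: form_lower (sv t t0).
have hi : V 0 <= o * normL2 a b (Deriv a b delta u0) ^+ 2.
  by rewrite -v0; exact: form_upper (sv 0 (lexx _)).
set nd := normL2 a b (Deriv a b delta u0) in hi *.
have nd0 : 0 <= nd by exact: normL2_ge0.
have h : eps ^+ 2 * normL2 a b (u t) ^+ 2 <= expR (- (2 * k * t)) * (o * nd ^+ 2).
  apply: le_trans lo _; apply: le_trans decay _.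
  by rewrite ler_wpM2l// expR_ge0.
have r0 : 0 <= Num.sqrt o / eps * expR (- k * t) * nd.
  by rewrite !mulr_ge0 ?invr_ge0 ?expR_ge0 ?sqrtr_ge0 ?(ltW eps_gt0).
rewrite -ler_sqr ?nnegrE ?normL2_ge0//.
have e2 : 0 < eps ^+ 2 by rewrite exprn_gt0.
rewrite -(ler_pM2l e2); apply: le_trans h _.
have e : expR (- (2 * k * t)) = expR (- k * t) ^+ 2.
  by rewrite -expRM_natl; congr expR; ring.
rewrite e !exprMn (sqr_sqrtr (ltW o0)) exprVn le_eqVlt; apply/orP; left; apply/eqP.
by field; rewrite gt_eqF.
Qed.

End stability.

Theorem corollary35 (R : realType) (n N : nat) (n_gt0 : (0 < n)%N)
    (N_gt0 : (0 < N)%N) (a b : 'I_N -> R) (ab : forall i, a i < b i)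
    (delta : 'I_N -> nat)
    (B C : forall i, 'I_(delta i) -> 'I_(delta i) -> 'M[R]_n)
    (Dadm : forall i, admissible (a i) (b i) (B i) (C i))
    (Dcons : consistent a b B C)
    (A : midx delta -> 'M[mpoly.mpoly N R]_n)
    (wp : well_posed a b B C A)
    (d d' : nat) (eps k : R) (eps_gt0 : 0 < eps) (k_ge0 : 0 <= k)
    (P : 'M[R]_(n, n * mudim d ^ N)) (Rm Qm : 'M[R]_(n * mudim d' ^ N))
    (Rm_psd : psd Rm) (Qm_psd : psd Qm) :
  let TT := opT a b B C in
  let AA := opA a b B C A in
  let ZZ' := IZ (n := n) a b d' in
  let PP := mulM P \o IZ (n := n) a b d in
  let adj_PP := adjoint a b PP in
  let adj_TT := adjoint a b TT in
  let adj_AA := adjoint a b AA in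
  let adj_ZZ' := adjoint a b ZZ' in
  eq_op_ae a b (adj_PP \o TT) (adj_TT \o PP) ->
  eq_op_ae a b (adj_TT \o PP)
    (fun v s => eps ^+ 2 *: adj_TT (TT v) s + adj_ZZ' (mulM Rm (ZZ' v)) s) ->
  eq_op_ae a b
    (fun v s => adj_PP (AA v) s + adj_AA (PP v) s
                + (2 * k) *: adj_PP (TT v) s)
    (fun v s => - adj_ZZ' (mulM Qm (ZZ' v)) s) ->
  exp_stable a b B C A k (Num.sqrt (opnorm a b (adj_PP \o TT)) / eps).
Proof.
(* Slicing removes a coordinate, so the development works in dimension [N.+1]; [N_gt0] rules out
   dimension 0. *)
destruct N as [|N']; first by [].
by move=> TT AA ZZ' PP aP aT aA aZ h1 h2 h3; exact: exp_stable_succ h1 h2 h3.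
Qed.
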